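(* Use the notation of the context. Let $\mu_0=(K_{v0},D_{v0})^T$ be a bifurcation point, $\mu_1\in\mathbb R^2$ with $\|\mu_1\|=1$, $\beta=(1,-K_{v0}/D_{v0})^T$, and let $e_1,e_2$ be the standard basis vectors of $\mathbb R^2$. All quantities are evaluated at $\mu=\mu_0$. Put $$\mathcal S_0=\begin{pmatrix} 0 \\ e_2^T\mu_1\,\Omega_v^2B_0(i\lambda_I)\frac{I_0(\Omega_vr)}{I_0(\Omega_vR)} \\ 0 \\ -e_1^T\mu_1\,q_0(i\lambda_I) \end{pmatrix}e_2^T\boldsymbol\phi_0,\qquad \mathcal S_n=\begin{pmatrix} 0 \\ e_2^T\mu_1\,\omega_v^2B_n(0)\frac{I_n(\omega_vr)}{I_n(\omega_vR)} \\ 0 \\ -e_1^T\mu_1\,q_n(0) \end{pmatrix}e_2^T\boldsymbol\phi_n\,e^{in\theta},$$ with $\Omega_v=\sqrt{(i\lambda_I+\sigma_v)/D_{v0}}$ and $\omega_v=\sqrt{\sigma_v/D_{v0}}$. For $Z=(z_1,z_2,z_3,z_4)^T$ write $$\mathrm{BC}(Z)=\partial_r\begin{pmatrix} D_uz_1 \\ D_{v0}z_2 \end{pmatrix}\Big|_{r=R}-\begin{pmatrix} K_u(z_3-z_1|_{r=R}) \\ K_{v0}(z_4-z_2|_{r=R}) \end{pmatrix}.$$ (1) **Hopf bifurcation.** A necessary condition for the system $$i\lambda_IX-\mathcal L(\mu_0;X)=-\mathcal W_0\frac{dA_0}{d\tau}+\big(2\mathcal B(\mathcal W_0,W_{0000})+\mathcal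 S_0\big)A_0+\big(2\mathcal B(\mathcal W_0,W_{1100})+2\mathcal B(\overline{\mathcal W_0},W_{2000})+3\mathcal C(\mathcal W_0,\mathcal W_0,\overline{\mathcal W_0})\big)|A_0|^2A_0,$$ $$\mathrm{BC}(X)=\begin{pmatrix} 0 \\ \beta^T\mu_1\,q_0(i\lambda_I)\,e_2^T\boldsymbol\phi_0 \end{pmatrix}A_0,$$ to have a solution $X$ is that $A_0(\tau)$ satisfies $$\begin{aligned} -2\pi R\,B_0(i\lambda_I)q_0(i\lambda_I)\,e_2^T\overline{\boldsymbol\phi_0^\star}\,e_2^T\boldsymbol\phi_0\,\beta^T\mu_1A_0={}&-\frac{dA_0}{d\tau}+2\langle\mathcal W_0^\star,\mathcal B(\mathcal W_0,W_{0000})\rangle A_0 \\ &+2\pi R\,e_2^T\overline{\boldsymbol\phi_0^\star}\,e_2^T\boldsymbol\phi_0\Big((B_0(i\lambda_I))^2\Omega_v^2\tfrac R2\Big(1-\Big(\tfrac{I_1(\Omega_vR)}{I_0(\Omega_vR)}\Big)^2\Big)e_2^T\mu_1-q_0(i\lambda_I)e_1^T\mu_1\Big)A_0 \\ &+\big\langle\mathcal W_0^\star,2\mathcal B(\mathcal W_0,W_{1100})+2\mathcal B(\overline{\mathcal W_0},W_{2000})+3\mathcal C(\mathcal W_0,\mathcal W_0,\overline{\mathcal W_0})\big\rangle|A_0|^2A_0. \end{aligned}$$ (2) **Pitchfork bifurcation** (critical modes $\pm n$, $n\ne0$). Put $$\mathcal T_n=-\mathcal W_n\frac{dA_n}{d\tau}+\big(2\mathcal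 B(\mathcal W_n,W_{0000})+\mathcal S_n\big)A_n+\big(2\mathcal B(\mathcal W_n,W_{0011})+2\mathcal B(\mathcal W_{-n},W_{0020})+3\mathcal C(\mathcal W_n,\mathcal W_n,\mathcal W_{-n})\big)|A_n|^2A_n,$$ $$\mathcal R_n=\big(2\mathcal B(\mathcal W_n,W_{0020})+\mathcal C(\mathcal W_n,\mathcal W_n,\mathcal W_n)\big)A_n^3.$$ A necessary condition for the system $$-\mathcal L(\mu_0;Y)=\mathcal T_n+\overline{\mathcal T_n}+\mathcal R_n+\overline{\mathcal R_n},\qquad \mathrm{BC}(Y)=\begin{pmatrix} 0 \\ \beta^T\mu_1\,q_n(0)\,e_2^T\boldsymbol\phi_n \end{pmatrix}\big(A_ne^{in\theta}+\overline{A_n}e^{-in\theta}\big),$$ to have a solution $Y$ is that $A_n(\tau)$ satisfies $$\begin{aligned} -2\pi R\,B_n(0)q_n(0)\,e_2^T\boldsymbol\phi_n^\star\,e_2^T\boldsymbol\phi_n\,\beta^T\mu_1A_n={}&-\frac{dA_n}{d\tau}+2\langle\mathcal W_n^\star,\mathcal B(\mathcal W_n,W_{0000})\rangle A_n \\ &+2\pi R\,e_2^T\boldsymbol\phi_n^\star\,e_2^T\boldsymbol\phi_n\Big((B_n(0))^2\omega_v^2\tfrac R2\Big(1-\tfrac{I_{n-1}(\omega_vR)I_{n+1}(\omega_vR)}{(I_n(\omega_vR))^2}\Big)e_2^T\mu_1-q_n(0)e_1^T\mu_1\Big)A_n \\ &+\big\langle\mathcal W_n^\star,2\mathcal B(\mathcal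 W_n,W_{0011})+2\mathcal B(\mathcal W_{-n},W_{0020})+3\mathcal C(\mathcal W_n,\mathcal W_n,\mathcal W_{-n})\big\rangle|A_n|^2A_n. \end{aligned}$$ (3) **Pitchfork-Hopf bifurcation** (critical modes $0,\pm n$, $n\neq0$). Put $$\begin{aligned} \mathcal P={}&\big(2\mathcal B(\mathcal W_0,W_{0020})+2\mathcal B(\mathcal W_n,W_{1010})+3\mathcal C(\mathcal W_0,\mathcal W_n,\mathcal W_n)\big)A_0A_n^2 \\ &+\big(2\mathcal B(\mathcal W_0,W_{0002})+2\mathcal B(\mathcal W_{-n},W_{1001})+3\mathcal C(\mathcal W_0,\mathcal W_{-n},\mathcal W_{-n})\big)A_0\overline{A_n}^2, \end{aligned}$$ $$\widetilde{\mathcal T}_n=\mathcal T_n+\big(2\mathcal B(\mathcal W_n,W_{1100})+2\mathcal B(\mathcal W_0,W_{0110})+2\mathcal B(\overline{\mathcal W_0},W_{1010})+6\mathcal C(\mathcal W_0,\overline{\mathcal W_0},\mathcal W_n)\big)|A_0|^2A_n,$$ with $\mathcal T_n,\mathcal R_n$ as in (2). A necessary condition for the two systems $$\begin{aligned} i\lambda_IX-\mathcal L(\mu_0;X)={}&-\mathcal W_0\frac{dA_0}{d\tau}+\big(2\mathcal B(\mathcal W_0,W_{0000})+\mathcal S_0\big)A_0 \\ &+\big(2\mathcal B(\mathcal W_0,W_{1100})+2\mathcal B(\overline{\mathcal W_0},W_{2000})+3\mathcal C(\mathcal W_0,\mathcal W_0,\overline{\mathcal W_0})\big)|A_0|^2A_0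 \\ &+\big(2\mathcal B(\mathcal W_0,W_{0011})+2\mathcal B(\mathcal W_n,W_{1001})+2\mathcal B(\mathcal W_{-n},W_{1010})+6\mathcal C(\mathcal W_0,\mathcal W_n,\mathcal W_{-n})\big)|A_n|^2A_0+\mathcal P, \end{aligned}$$ $$-\mathcal L(\mu_0;Y)=\widetilde{\mathcal T}_n+\overline{\widetilde{\mathcal T}_n}+\mathcal R_n+\overline{\mathcal R_n},$$ with $\mathrm{BC}(X)$ as in (1) and $\mathrm{BC}(Y)$ as in (2), to have solutions $X$ and $Y$ is that $A_0(\tau),A_n(\tau)$ satisfy the system of ODEs $$\begin{aligned} -2\pi R\,B_0(i\lambda_I)q_0(i\lambda_I)\,e_2^T\overline{\boldsymbol\phi_0^\star}\,e_2^T\boldsymbol\phi_0\,\beta^T\mu_1A_0={}&-\frac{dA_0}{d\tau}+2\langle\mathcal W_0^\star,\mathcal B(\mathcal W_0,W_{0000})\rangle A_0 \\ &+2\pi R\,e_2^T\overline{\boldsymbol\phi_0^\star}\,e_2^T\boldsymbol\phi_0\Big((B_0(i\lambda_I))^2\Omega_v^2\tfrac R2\Big(1-\Big(\tfrac{I_1(\Omega_vR)}{I_0(\Omega_vR)}\Big)^2\Big)e_2^T\mu_1-q_0(i\lambda_I)e_1^T\mu_1\Big)A_0 \\ &+\big\langle\mathcal W_0^\star,2\mathcal B(\mathcal W_0,W_{1100})+2\mathcal B(\overline{\mathcal W_0},W_{2000})+3\mathcal C(\mathcal W_0,\mathcal W_0,\overline{\mathcal W_0})\big\rangle|A_0|^2A_0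 \\ &+\big\langle\mathcal W_0^\star,2\mathcal B(\mathcal W_0,W_{0011})+2\mathcal B(\mathcal W_n,W_{1001})+2\mathcal B(\mathcal W_{-n},W_{1010})+6\mathcal C(\mathcal W_0,\mathcal W_n,\mathcal W_{-n})\big\rangle|A_n|^2A_0 \end{aligned}$$ and $$\begin{aligned} -2\pi R\,B_n(0)q_n(0)\,e_2^T\boldsymbol\phi_n^\star\,e_2^T\boldsymbol\phi_n\,\beta^T\mu_1A_n={}&-\frac{dA_n}{d\tau}+2\langle\mathcal W_n^\star,\mathcal B(\mathcal W_n,W_{0000})\rangle A_n \\ &+2\pi R\,e_2^T\boldsymbol\phi_n^\star\,e_2^T\boldsymbol\phi_n\Big((B_n(0))^2\omega_v^2\tfrac R2\Big(1-\tfrac{I_{n-1}(\omega_vR)I_{n+1}(\omega_vR)}{(I_n(\omega_vR))^2}\Big)e_2^T\mu_1-q_n(0)e_1^T\mu_1\Big)A_n \\ &+\big\langle\mathcal W_n^\star,2\mathcal B(\mathcal W_n,W_{0011})+2\mathcal B(\mathcal W_{-n},W_{0020})+3\mathcal C(\mathcal W_n,\mathcal W_n,\mathcal W_{-n})\big\rangle|A_n|^2A_n \\ &+\big\langle\mathcal W_n^\star,2\mathcal B(\mathcal W_n,W_{1100})+2\mathcal B(\mathcal W_0,W_{0110})+2\mathcal B(\overline{\mathcal W_0},W_{1010})+6\mathcal C(\mathcal W_0,\overline{\mathcal W_0},\mathcal W_n)\big\rangle|A_0|^2A_n. \end{aligned}$$ In all three cases $\mathcal W_0^\star$ and $\mathcal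 W_n^\star$ are the adjoint eigenfunctions, satisfying $\mathcal L^\star(\mu_0;\mathcal W_0^\star)=-i\lambda_I\mathcal W_0^\star$ and $\mathcal L^\star(\mu_0;\mathcal W_n^\star)=0$.
   Context: **Setting.** $\Omega=\{x\in\mathbb R^2:\|x\|<R\}$, $R>0$, with polar coordinates $(r,\theta)$. The constants $D_u,D_v,\sigma_u,\sigma_v,K_u,K_v,d_u,d_v$ are positive, and $f,g$ are smooth real functions of $(u,v)$. The bifurcation parameter is $\mu=(K_v,D_v)^T$. It is expanded as $\mu=\mu_0+\varepsilon^2\mu_1$, and everything below is evaluated at $\mu_0=(K_{v0},D_{v0})^T$, i.e. $K_v=K_{v0}$, $D_v=D_{v0}$. Vector functions are $W=(U(r,\theta),V(r,\theta),u(\theta),v(\theta))^T$, complex valued, $2\pi$-periodic in $\theta$, and smooth enough (e.g. $C^2$ up to the boundary) for all expressions to make classical sense and Green's identities to apply. The surface part of $W_j$ is written $\boldsymbol u_j=(u_j,v_j)^T$. The amplitudes $A_0(\tau),A_n(\tau)$ are complex functions of the slow time $\tau$, which enters the systems for $X,Y$ only as a parameter. (The amplitudes $A_0(\tau),A_n(\tau)$ are not to be confused with the functions $A_m(\lambda)$ below, which are always written with an argument $\lambda$, $0$ or $i\lambda_I$ etc.) **Bessel quantities.** $I_m$ denotes the modified Bessel function of the first kind ($I_{-m}=I_m$). For $m\in\mathbb Z$ and $\lambda\in\mathbb C$ let $\Omega_u(\lambda)=\sqrt{(\lambda+\sigma_u)/D_u}$, $\Omega_v(\lambda)=\sqrt{(\lambda+\sigma_v)/D_v}$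 (principal roots), $$A_m(\lambda)=\frac{K_uI_m(\Omega_uR)}{D_u\Omega_uI_m'(\Omega_uR)+K_uI_m(\Omega_uR)},\quad B_m(\lambda)=\frac{K_vI_m(\Omega_vR)}{D_v\Omega_vI_m'(\Omega_vR)+K_vI_m(\Omega_vR)},\quad p_m=1-A_m,\quad q_m=1-B_m .$$ For $\boldsymbol u=(u_1,u_2)^T\in\mathbb C^2$ define the extension $$\mathcal E_m(\lambda)\boldsymbol u=\Big(A_m(\lambda)\tfrac{I_m(\Omega_u(\lambda)r)}{I_m(\Omega_u(\lambda)R)}u_1,\;B_m(\lambda)\tfrac{I_m(\Omega_v(\lambda)r)}{I_m(\Omega_v(\lambda)R)}u_2,\;u_1,\;u_2\Big)^Te^{im\theta}.$$ **Base state.** $\boldsymbol u_e=(u_e,v_e)^T\in\mathbb R^2$ solves $K_up_0(0)u_e=f(u_e,v_e)$, $K_vq_0(0)v_e=g(u_e,v_e)$. Put $V_e(r)=B_0(0)\frac{I_0(\omega_vr)}{I_0(\omega_vR)}v_e$ with $\omega_v=\sqrt{\sigma_v/D_v}$. A superscript $e$ means evaluation at $\boldsymbol u_e$, and $J_e=\begin{pmatrix} f_u^e & f_v^e \\ g_u^e & g_v^e \end{pmatrix}$. **Operators and inner product** (in the last two rows $U,V$ mean the traces at $r=R$; $\mathcal L,\mathcal L^\star$ are differential expressions applicable to any $W$): $$\mathcal L(W)=\begin{pmatrix} D_u\Delta U-\sigma_uU \\ D_v\Delta V-\sigma_vV \\ \frac{d_u}{R^2}u_{\theta\theta}-K_u(u-U)+f_u^eu+f_v^ev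 \\ \frac{d_v}{R^2}v_{\theta\theta}-K_v(v-V)+g_u^eu+g_v^ev \end{pmatrix},\quad \mathcal L^\star(W)=\begin{pmatrix} D_u\Delta U-\sigma_uU \\ D_v\Delta V-\sigma_vV \\ \frac{d_u}{R^2}u_{\theta\theta}-K_u(u-U)+f_u^eu+g_u^ev \\ \frac{d_v}{R^2}v_{\theta\theta}-K_v(v-V)+f_v^eu+g_v^ev \end{pmatrix},$$ $$\langle W^\star,W\rangle=\int_0^{2\pi}\!\!\int_0^R[\overline{U^\star}U+\overline{V^\star}V]r\,dr\,d\theta+\int_0^{2\pi}[\overline{u^\star}u+\overline{v^\star}v]R\,d\theta .$$ $\mathcal B(W_j,W_k)=(0,0,B(\boldsymbol u_j,\boldsymbol u_k))^T$ and $\mathcal C(W_j,W_k,W_l)=(0,0,C(\boldsymbol u_j,\boldsymbol u_k,\boldsymbol u_l))^T$, where $B:\mathbb C^2\times\mathbb C^2\to\mathbb C^2$ is $\tfrac12$ times the (complex-bilinear, symmetric) second derivative of $(f,g)$ at $\boldsymbol u_e$, and $C$ is $\tfrac16$ times the (complex-trilinear, symmetric) third derivative of $(f,g)$ at $\boldsymbol u_e$. **Eigenfunctions.** Let $$\boldsymbol\Phi_m(\lambda)=J_e-\lambda I-\begin{pmatrix} K_up_m(\lambda)+\frac{m^2d_u}{R^2} & 0 \\ 0 & K_vq_m(\lambda)+\frac{m^2d_v}{R^2} \end{pmatrix}.$$ Hopf case: $\det\boldsymbol\Phi_0(i\lambda_I)=0$ for some $\lambda_I>0$. Pitchfork case: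 $\det\boldsymbol\Phi_n(0)=0$ for some $n\neq0$. Pitchfork-Hopf case: both hold at $\mu_0$. The vectors $\boldsymbol\phi_0,\boldsymbol\phi_0^\star\in\mathbb C^2\setminus\{0\}$ satisfy $\boldsymbol\Phi_0(i\lambda_I)\boldsymbol\phi_0=0$ and $\overline{\boldsymbol\Phi_0(i\lambda_I)}^T\boldsymbol\phi_0^\star=0$. The vectors $\boldsymbol\phi_n,\boldsymbol\phi_n^\star\in\mathbb R^2\setminus\{0\}$ satisfy $\boldsymbol\Phi_n(0)\boldsymbol\phi_n=0$ and $\boldsymbol\Phi_n(0)^T\boldsymbol\phi_n^\star=0$, and $\boldsymbol\phi_{-n}=\boldsymbol\phi_n$. Set $$\mathcal W_0=\mathcal E_0(i\lambda_I)\boldsymbol\phi_0,\quad \mathcal W_{\pm n}=\mathcal E_{\pm n}(0)\boldsymbol\phi_n,\quad \mathcal W_0^\star=\mathcal E_0(-i\lambda_I)\boldsymbol\phi_0^\star,\quad \mathcal W_n^\star=\mathcal E_n(0)\boldsymbol\phi_n^\star,$$ normalized so that $\langle\mathcal W_0^\star,\mathcal W_0\rangle=1$ and $\langle\mathcal W_n^\star,\mathcal W_n\rangle=1$. **Second-order terms.** It is assumed that those of the matrices $\boldsymbol\Phi_0(0),\boldsymbol\Phi_0(2i\lambda_I),\boldsymbol\Phi_{2n}(0),\boldsymbol\Phi_n(i\lambda_I)$ that are needed in the case considered are invertible. $W_{0000}=(U_{0000}(r),V_{0000}(r),u_{0000},v_{0000})^T$ is the radially symmetric solution of $$\mathcal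 L(\mu_0;W_{0000})+\begin{pmatrix} 0 \\ \omega_v^2V_e(r)e_2^T\mu_1 \\ 0 \\ -q_0(0)v_ee_1^T\mu_1 \end{pmatrix}=0,\qquad\begin{cases} D_u\partial_rU_{0000}=K_u(u_{0000}-U_{0000}) \\ D_{v0}\partial_rV_{0000}=K_{v0}(v_{0000}-V_{0000})+q_0(0)v_e\beta^T\mu_1 \end{cases}\quad (r=R).$$ The others are: $W_{2000}=\mathcal E_0(2i\lambda_I)\boldsymbol u_{2000}$ with $\boldsymbol\Phi_0(2i\lambda_I)\boldsymbol u_{2000}=-B(\boldsymbol\phi_0,\boldsymbol\phi_0)$; $W_{1100}=\mathcal E_0(0)\boldsymbol u_{1100}$ with $\boldsymbol\Phi_0(0)\boldsymbol u_{1100}=-2B(\boldsymbol\phi_0,\overline{\boldsymbol\phi_0})$; $W_{0020}=\mathcal E_{2n}(0)\boldsymbol u_{0020}$ with $\boldsymbol\Phi_{2n}(0)\boldsymbol u_{0020}=-B(\boldsymbol\phi_n,\boldsymbol\phi_n)$; $W_{0011}=\mathcal E_0(0)\boldsymbol u_{0011}$ with $\boldsymbol\Phi_0(0)\boldsymbol u_{0011}=-2B(\boldsymbol\phi_n,\boldsymbol\phi_{-n})$; $W_{1010}=\mathcal E_n(i\lambda_I)\boldsymbol u_{1010}$ and $W_{1001}=\mathcal E_{-n}(i\lambda_I)\boldsymbol u_{1010}$ with $\boldsymbol\Phi_n(i\lambda_I)\boldsymbol u_{1010}=-2B(\boldsymbol\phi_0,\boldsymbol\phi_n)$; $W_{0002}=\overline{W_{0020}}$,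 $W_{0110}=\overline{W_{1001}}$. *)

(* Defs.v *)
From Stdlib Require Import Reals ZArith.
From Coquelicot Require Import Coquelicot.
Open Scope R_scope.
Open Scope C_scope.

(* Principal square root: nonnegative real part, and positive imaginary part
   on the negative real axis. *)
Definition Csqrt (z : C) : C :=
  (sqrt ((Cmod z + Re z) / 2),
   (if Rle_dec 0 (Im z) then 1 else -1) * sqrt ((Cmod z - Re z) / 2))%R.

Definition cis (x : R) : C := (cos x, sin x).

Definition CSeries (a : nat -> C) : C :=
  (Series (fun k => Re (a k)), Series (fun k => Im (a k))).

Definition CDerive (h : R -> C) (t : R) : C :=
  (Derive (fun s => Re (h s)) t, Derive (fun s => Im (h s)) t).

Definition CInt (h : R -> C) (a b : R) : C :=
  RInt (V := C_R_CompleteNormedModule) h a b.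

(* Modified Bessel function of the first kind of integer order, by its power
   series; the order enters through its absolute value, as I_{-m} = I_m. *)
Definition BesselI (m : Z) (z : C) : C :=
  CSeries (fun k => (z / 2) ^ (2 * k + Z.abs_nat m)
                    / RtoC (INR (fact k * fact (k + Z.abs_nat m)))).

Definition BesselI' (m : Z) : C -> C := C_derive (BesselI m).

Definition vec2 : Type := (C * C)%type.

Definition vscal (c : C) (x : vec2) : vec2 := (c * fst x, c * snd x).
Definition vconj (x : vec2) : vec2 := (Cconj (fst x), Cconj (snd x)).
Definition vzero : vec2 := (RtoC 0, RtoC 0).

Definition vreal (x : R * R) : vec2 := (RtoC (fst x), RtoC (snd x)).

Record mat2 : Type := Mat2 { m11 : C; m12 : C; m21 : C; m22 : C }.

Definition mdet (M : mat2) : C := m11 M * m22 M - m12 M * m21 M.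
Definition mtr (M : mat2) : mat2 := Mat2 (m11 M) (m21 M) (m12 M) (m22 M).
Definition mconj (M : mat2) : mat2 :=
  Mat2 (Cconj (m11 M)) (Cconj (m12 M)) (Cconj (m21 M)) (Cconj (m22 M)).
Definition mapply (M : mat2) (x : vec2) : vec2 :=
  (m11 M * fst x + m12 M * snd x, m21 M * fst x + m22 M * snd x).
Definition mmul (M N : mat2) : mat2 :=
  Mat2 (m11 M * m11 N + m12 M * m21 N) (m11 M * m12 N + m12 M * m22 N)
       (m21 M * m11 N + m22 M * m21 N) (m21 M * m12 N + m22 M * m22 N).
Definition mid : mat2 := Mat2 (RtoC 1) (RtoC 0) (RtoC 0) (RtoC 1).
Definition minvertible (M : mat2) : Prop :=
  exists N : mat2, mmul M N = mid /\ mmul N M = mid.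

(* [Kv] and [Dv] are the components of the critical parameter mu_0. *)
Record model : Type := Model {
  rad : R;
  Du : R; Dv : R; sigu : R; sigv : R; Ku : R; Kv : R; du : R; dv : R;
  f : R -> R -> R; g : R -> R -> R;
  ue : R; ve : R }.

Definition smooth2 (h : R -> R -> R) : Prop :=
  forall (k : nat) (x y : R), ex_diff_n h k x y.

Definition Omu (P : model) (lam : C) : C := Csqrt ((lam + sigu P) / Du P).
Definition Omv (P : model) (lam : C) : C := Csqrt ((lam + sigv P) / Dv P).

Definition Am (P : model) (m : Z) (lam : C) : C :=
  Ku P * BesselI m (Omu P lam * rad P)
  / (Du P * Omu P lam * BesselI' m (Omu P lam * rad P)
     + Ku P * BesselI m (Omu P lam * rad P)).
Definition Bm (P : model) (m : Z) (lam : C) : C :=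
  Kv P * BesselI m (Omv P lam * rad P)
  / (Dv P * Omv P lam * BesselI' m (Omv P lam * rad P)
     + Kv P * BesselI m (Omv P lam * rad P)).
Definition pm (P : model) (m : Z) (lam : C) : C := 1 - Am P m lam.
Definition qm (P : model) (m : Z) (lam : C) : C := 1 - Bm P m lam.

Definition admissible (P : model) : Prop :=
  (0 < rad P /\ 0 < Du P /\ 0 < Dv P /\ 0 < sigu P /\ 0 < sigv P /\
   0 < Ku P /\ 0 < Kv P /\ 0 < du P /\ 0 < dv P)%R /\
  smooth2 (f P) /\ smooth2 (g P) /\
  Ku P * pm P 0 0 * ue P = f P (ue P) (ve P) /\
  Kv P * qm P 0 0 * ve P = g P (ue P) (ve P).

Definition fu (P : model) : R := partial_derive 1 0 (f P) (ue P) (ve P).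
Definition fv (P : model) : R := partial_derive 0 1 (f P) (ue P) (ve P).
Definition gu (P : model) : R := partial_derive 1 0 (g P) (ue P) (ve P).
Definition gv (P : model) : R := partial_derive 0 1 (g P) (ue P) (ve P).

Definition Phi (P : model) (m : Z) (lam : C) : mat2 :=
  Mat2 (fu P - lam - (Ku P * pm P m lam + IZR m ^ 2 * du P / rad P ^ 2)) (fv P)
       (gu P) (gv P - lam - (Kv P * qm P m lam + IZR m ^ 2 * dv P / rad P ^ 2)).

(* Second and third derivatives at (x, y), extended complex-multilinearly. *)
Definition D2 (h : R -> R -> R) (x y : R) (a b : vec2) : C :=
  partial_derive 2 0 h x y * (fst a * fst b)
  + partial_derive 1 1 h x y * (fst a * snd b + snd a * fst b)
  + partial_derive 0 2 h x y * (snd a * snd b).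
Definition D3 (h : R -> R -> R) (x y : R) (a b c : vec2) : C :=
  partial_derive 3 0 h x y * (fst a * fst b * fst c)
  + partial_derive 2 1 h x y
    * (fst a * fst b * snd c + fst a * snd b * fst c + snd a * fst b * fst c)
  + partial_derive 1 2 h x y
    * (fst a * snd b * snd c + snd a * fst b * snd c + snd a * snd b * fst c)
  + partial_derive 0 3 h x y * (snd a * snd b * snd c).

Definition B2 (P : model) (a b : vec2) : vec2 :=
  (D2 (f P) (ue P) (ve P) a b / 2, D2 (g P) (ue P) (ve P) a b / 2).
Definition C3 (P : model) (a b c : vec2) : vec2 :=
  (D3 (f P) (ue P) (ve P) a b c / 6, D3 (g P) (ue P) (ve P) a b c / 6).

(* Vector functions (U(r,theta), V(r,theta), u(theta), v(theta)) *)

Record field : Type := Field {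
  bU : R -> R -> C; bV : R -> R -> C; su : R -> C; sv : R -> C }.

Definition fzero : field :=
  Field (fun _ _ => RtoC 0) (fun _ _ => RtoC 0) (fun _ => RtoC 0) (fun _ => RtoC 0).
Definition fplus (W Z : field) : field :=
  Field (fun r t => bU W r t + bU Z r t) (fun r t => bV W r t + bV Z r t)
        (fun t => su W t + su Z t) (fun t => sv W t + sv Z t).
Definition fscal (c : C) (W : field) : field :=
  Field (fun r t => c * bU W r t) (fun r t => c * bV W r t)
        (fun t => c * su W t) (fun t => c * sv W t).
Definition fopp (W : field) : field := fscal (- RtoC 1) W.
Definition fconj (W : field) : field :=
  Field (fun r t => Cconj (bU W r t)) (fun r t => Cconj (bV W r t))
        (fun t => Cconj (su W t)) (fun t => Cconj (sv W t)).

Declare Scope field_scope.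
Delimit Scope field_scope with fld.
Bind Scope field_scope with field.
Notation "W + Z" := (fplus W Z) : field_scope.
Notation "- W" := (fopp W) : field_scope.
Notation "W - Z" := (fplus W (fopp Z)) : field_scope.
Notation "c *: W" := (fscal c%C W) (at level 40, W at level 35) : field_scope.

(* Equality of the four rows: the bulk rows in the punctured open disc (where
   the polar form of the Laplacian makes sense), the surface rows on the circle. *)
Definition field_eq (P : model) (W Z : field) : Prop :=
  (forall r t : R, (0 < r < rad P)%R -> bU W r t = bU Z r t /\ bV W r t = bV Z r t) /\
  (forall t : R, su W t = su Z t /\ sv W t = sv Z t).

(* Regularity up to the boundary: C^2 in (r,theta) on a neighbourhood of the
   closed rectangle [0,a] x R. Every function of class C^2 on the closed disc is
   of this form, after extension across r = a and with
   U(r,theta) = F(r cos theta, r sin theta) for r of either sign; only the values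
   for 0 <= r <= a enter the equations. *)
Definition C2_disc (a : R) (U : R -> R -> C) : Prop :=
  (forall r t : R, (0 <= r <= a)%R -> U r (t + 2 * PI)%R = U r t) /\
  (forall t : R, U 0%R t = U 0%R 0%R) /\
  exists delta : R, (0 < delta)%R /\
    forall r t : R, (- delta < r < a + delta)%R ->
      ex_diff_n (fun x y => Re (U x y)) 2 r t /\
      ex_diff_n (fun x y => Im (U x y)) 2 r t.

Definition C2_real (h : R -> R) : Prop :=
  forall t : R, (forall k : nat, (k <= 2)%nat -> ex_derive_n h k t) /\
                continuous (Derive_n h 2) t.
Definition C2_circle (u : R -> C) : Prop :=
  (forall t : R, u (t + 2 * PI)%R = u t) /\
  C2_real (fun t => Re (u t)) /\ C2_real (fun t => Im (u t)).

Definition smooth_field (P : model) (W : field) : Prop :=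
  C2_disc (rad P) (bU W) /\ C2_disc (rad P) (bV W) /\
  C2_circle (su W) /\ C2_circle (sv W).

Definition radial_field (P : model) (W : field) : Prop :=
  (forall r t : R, (0 <= r <= rad P)%R ->
     bU W r t = bU W r 0%R /\ bV W r t = bV W r 0%R) /\
  (forall t : R, su W t = su W 0%R /\ sv W t = sv W 0%R).

Definition d_r (U : R -> R -> C) (r t : R) : C := CDerive (fun s => U s t) r.
Definition d_t (U : R -> R -> C) (r t : R) : C := CDerive (fun s => U r s) t.
Definition laplacian (U : R -> R -> C) (r t : R) : C :=
  d_r (d_r U) r t + d_r U r t / r + d_t (d_t U) r t / r ^ 2.
Definition d_tt (u : R -> C) (t : R) : C := CDerive (CDerive u) t.

Definition Lop (P : model) (W : field) : field :=
  Field
    (fun r t => Du P * laplacian (bU W) r t - sigu P * bU W r t)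
    (fun r t => Dv P * laplacian (bV W) r t - sigv P * bV W r t)
    (fun t => du P / rad P ^ 2 * d_tt (su W) t - Ku P * (su W t - bU W (rad P) t)
              + fu P * su W t + fv P * sv W t)
    (fun t => dv P / rad P ^ 2 * d_tt (sv W) t - Kv P * (sv W t - bV W (rad P) t)
              + gu P * su W t + gv P * sv W t).

Definition Lstar (P : model) (W : field) : field :=
  Field
    (fun r t => Du P * laplacian (bU W) r t - sigu P * bU W r t)
    (fun r t => Dv P * laplacian (bV W) r t - sigv P * bV W r t)
    (fun t => du P / rad P ^ 2 * d_tt (su W) t - Ku P * (su W t - bU W (rad P) t)
              + fu P * su W t + gu P * sv W t)
    (fun t => dv P / rad P ^ 2 * d_tt (sv W) t - Kv P * (sv W t - bV W (rad P) t)
              + fv P * su W t + gv P * sv W t).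

Definition inner (P : model) (Ws W : field) : C :=
  CInt (fun t => CInt (fun r =>
      (Cconj (bU Ws r t) * bU W r t + Cconj (bV Ws r t) * bV W r t) * r)
      0 (rad P)) 0 (2 * PI)
  + CInt (fun t =>
      (Cconj (su Ws t) * su W t + Cconj (sv Ws t) * sv W t) * rad P) 0 (2 * PI).

Definition BC (P : model) (Z : field) (t : R) : vec2 :=
  (Du P * d_r (bU Z) (rad P) t - Ku P * (su Z t - bU Z (rad P) t),
   Dv P * d_r (bV Z) (rad P) t - Kv P * (sv Z t - bV Z (rad P) t)).

Definition Bop (P : model) (W Z : field) : field :=
  Field (fun _ _ => RtoC 0) (fun _ _ => RtoC 0)
    (fun t => fst (B2 P (su W t, sv W t) (su Z t, sv Z t)))
    (fun t => snd (B2 P (su W t, sv W t) (su Z t, sv Z t))).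
Definition Cop (P : model) (W Y Z : field) : field :=
  Field (fun _ _ => RtoC 0) (fun _ _ => RtoC 0)
    (fun t => fst (C3 P (su W t, sv W t) (su Y t, sv Y t) (su Z t, sv Z t)))
    (fun t => snd (C3 P (su W t, sv W t) (su Y t, sv Y t) (su Z t, sv Z t))).

Definition Ext (P : model) (m : Z) (lam : C) (x : vec2) : field :=
  Field
    (fun r t => Am P m lam * (BesselI m (Omu P lam * r)
                              / BesselI m (Omu P lam * rad P))
                * fst x * cis (IZR m * t))
    (fun r t => Bm P m lam * (BesselI m (Omv P lam * r)
                              / BesselI m (Omv P lam * rad P))
                * snd x * cis (IZR m * t))
    (fun t => fst x * cis (IZR m * t))
    (fun t => snd x * cis (IZR m * t)).

(* mu1 lists the increments of K_v and of D_v, in this order. *)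

Definition beta_mu (P : model) (mu1 : R * R) : R :=
  (fst mu1 - Kv P / Dv P * snd mu1)%R.

Definition Ve (P : model) (r : R) : C :=
  Bm P 0 0 * (BesselI 0 (Omv P 0 * r) / BesselI 0 (Omv P 0 * rad P)) * ve P.

Definition base_forcing (P : model) (mu1 : R * R) : field :=
  Field (fun _ _ => RtoC 0)
    (fun r _ => Omv P 0 ^ 2 * Ve P r * snd mu1)
    (fun _ => RtoC 0)
    (fun _ => - qm P 0 0 * ve P * fst mu1).

Definition is_W0000 (P : model) (mu1 : R * R) (W : field) : Prop :=
  smooth_field P W /\ radial_field P W /\
  field_eq P (Lop P W + base_forcing P mu1)%fld fzero /\
  forall t : R, BC P W t = (RtoC 0, qm P 0 0 * ve P * beta_mu P mu1).

(* S_0 is [Sfield P mu1 0 (i lam_I) phi_0] and S_n is [Sfield P mu1 n 0 phi_n]. *)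
Definition Sfield (P : model) (mu1 : R * R) (m : Z) (lam : C) (x : vec2) : field :=
  Field (fun _ _ => RtoC 0)
    (fun r t => snd mu1 * Omv P lam ^ 2 * Bm P m lam
                * (BesselI m (Omv P lam * r) / BesselI m (Omv P lam * rad P))
                * snd x * cis (IZR m * t))
    (fun _ => RtoC 0)
    (fun t => - fst mu1 * qm P m lam * snd x * cis (IZR m * t)).

Definition sqmod (A : C) : C := RtoC (Cmod A ^ 2).

Definition W0 (P : model) (lamI : R) (phi0 : vec2) : field :=
  Ext P 0 (Ci * lamI) phi0.
Definition W0s (P : model) (lamI : R) (phi0s : vec2) : field :=
  Ext P 0 (- (Ci * lamI)) phi0s.
Definition Wn (P : model) (n : Z) (phin : R * R) : field := Ext P n 0 (vreal phin).
(* W_{-n} uses phi_{-n} = phi_n. *)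
Definition Wmn (P : model) (n : Z) (phin : R * R) : field :=
  Ext P (- n) 0 (vreal phin).
Definition Wns (P : model) (n : Z) (phins : R * R) : field := Ext P n 0 (vreal phins).

Definition hopf_data (P : model) (lamI : R) (phi0 phi0s : vec2) : Prop :=
  (0 < lamI)%R /\
  mdet (Phi P 0 (Ci * lamI)) = 0 /\
  phi0 <> vzero /\ phi0s <> vzero /\
  mapply (Phi P 0 (Ci * lamI)) phi0 = vzero /\
  mapply (mtr (mconj (Phi P 0 (Ci * lamI)))) phi0s = vzero /\
  inner P (W0s P lamI phi0s) (W0 P lamI phi0) = 1.

Definition pitchfork_data (P : model) (n : Z) (phin phins : R * R) : Prop :=
  n <> 0%Z /\
  mdet (Phi P n 0) = 0 /\
  phin <> (0, 0)%R /\ phins <> (0, 0)%R /\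
  mapply (Phi P n 0) (vreal phin) = vzero /\
  mapply (mtr (Phi P n 0)) (vreal phins) = vzero /\
  inner P (Wns P n phins) (Wn P n phin) = 1.

Definition hopf_second (P : model) (lamI : R) (phi0 u2000 u1100 : vec2) : Prop :=
  minvertible (Phi P 0 0) /\ minvertible (Phi P 0 (2 * (Ci * lamI))) /\
  mapply (Phi P 0 (2 * (Ci * lamI))) u2000 = vscal (- RtoC 1) (B2 P phi0 phi0) /\
  mapply (Phi P 0 0) u1100 = vscal (- RtoC 2) (B2 P phi0 (vconj phi0)).

Definition pitchfork_second (P : model) (n : Z) (phin : R * R)
    (u0020 u0011 : vec2) : Prop :=
  minvertible (Phi P 0 0) /\ minvertible (Phi P (2 * n) 0) /\
  mapply (Phi P (2 * n) 0) u0020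
    = vscal (- RtoC 1) (B2 P (vreal phin) (vreal phin)) /\
  mapply (Phi P 0 0) u0011 = vscal (- RtoC 2) (B2 P (vreal phin) (vreal phin)).

Definition mixed_second (P : model) (lamI : R) (n : Z) (phi0 : vec2) (phin : R * R)
    (u1010 : vec2) : Prop :=
  minvertible (Phi P n (Ci * lamI)) /\
  mapply (Phi P n (Ci * lamI)) u1010 = vscal (- RtoC 2) (B2 P phi0 (vreal phin)).

Definition W2000 (P : model) (lamI : R) (u2000 : vec2) : field :=
  Ext P 0 (2 * (Ci * lamI)) u2000.
Definition W1100 (P : model) (u1100 : vec2) : field := Ext P 0 0 u1100.
Definition W0020 (P : model) (n : Z) (u0020 : vec2) : field := Ext P (2 * n) 0 u0020.
Definition W0011 (P : model) (u0011 : vec2) : field := Ext P 0 0 u0011.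
Definition W1010 (P : model) (lamI : R) (n : Z) (u1010 : vec2) : field :=
  Ext P n (Ci * lamI) u1010.
Definition W1001 (P : model) (lamI : R) (n : Z) (u1010 : vec2) : field :=
  Ext P (- n) (Ci * lamI) u1010.
Definition W0002 (P : model) (n : Z) (u0020 : vec2) : field :=
  fconj (W0020 P n u0020).
Definition W0110 (P : model) (lamI : R) (n : Z) (u1010 : vec2) : field :=
  fconj (W1001 P lamI n u1010).

Definition cub0 (P : model) (w0 w1100 w2000 : field) : field :=
  (2 *: Bop P w0 w1100 + 2 *: Bop P (fconj w0) w2000 + 3 *: Cop P w0 w0 (fconj w0))%fld.
Definition cub0n (P : model) (w0 wn wmn w0011 w1001 w1010 : field) : field :=
  (2 *: Bop P w0 w0011 + 2 *: Bop P wn w1001 + 2 *: Bop P wmn w1010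
   + 6 *: Cop P w0 wn wmn)%fld.
Definition cubn (P : model) (wn wmn w0011 w0020 : field) : field :=
  (2 *: Bop P wn w0011 + 2 *: Bop P wmn w0020 + 3 *: Cop P wn wn wmn)%fld.
Definition cubn0 (P : model) (w0 wn w1100 w0110 w1010 : field) : field :=
  (2 *: Bop P wn w1100 + 2 *: Bop P w0 w0110 + 2 *: Bop P (fconj w0) w1010
   + 6 *: Cop P w0 (fconj w0) wn)%fld.

(* T_n, R_n and P of the third-order systems are [Tres], [Rres] and [Pmix];
   A, dA are the values of an amplitude and its derivative at a given slow time. *)

Definition rhs0 (P : model) (mu1 : R * R) (lamI : R) (phi0 : vec2)
    (w0000 w1100 w2000 : field) (A dA : C) : field :=
  let w0 := W0 P lamI phi0 in
  (- (dA *: w0)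
   + A *: (2 *: Bop P w0 w0000 + Sfield P mu1 0 (Ci * lamI) phi0)
   + (sqmod A * A) *: cub0 P w0 w1100 w2000)%fld.

Definition Tres (P : model) (mu1 : R * R) (n : Z) (phin : R * R)
    (w0000 w0011 w0020 : field) (A dA : C) : field :=
  let wn := Wn P n phin in
  (- (dA *: wn)
   + A *: (2 *: Bop P wn w0000 + Sfield P mu1 n 0 (vreal phin))
   + (sqmod A * A) *: cubn P wn (Wmn P n phin) w0011 w0020)%fld.

Definition Rres (P : model) (n : Z) (phin : R * R) (w0020 : field) (A : C) : field :=
  let wn := Wn P n phin in
  ((A ^ 3) *: (2 *: Bop P wn w0020 + Cop P wn wn wn))%fld.

Definition Pmix (P : model) (w0 wn wmn w0020 w0002 w1010 w1001 : field)
    (A0 An : C) : field :=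
  ((A0 * An ^ 2) *: (2 *: Bop P w0 w0020 + 2 *: Bop P wn w1010
                     + 3 *: Cop P w0 wn wn)
   + (A0 * Cconj An ^ 2) *: (2 *: Bop P w0 w0002 + 2 *: Bop P wmn w1001
                             + 3 *: Cop P w0 wmn wmn))%fld.

Definition solvesX (P : model) (mu1 : R * R) (lamI : R) (phi0 : vec2)
    (A0 : C) (rhs X : field) : Prop :=
  field_eq P ((Ci * lamI) *: X - Lop P X)%fld rhs /\
  forall t : R, BC P X t =
    (RtoC 0, beta_mu P mu1 * qm P 0 (Ci * lamI) * snd phi0 * A0).

Definition solvesY (P : model) (mu1 : R * R) (n : Z) (phin : R * R)
    (An : C) (T Rr Y : field) : Prop :=
  field_eq P (- Lop P Y)%fld (T + fconj T + Rr + fconj Rr)%fld /\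
  forall t : R, BC P Y t =
    (RtoC 0, beta_mu P mu1 * qm P n 0 * snd phin
             * (An * cis (IZR n * t) + Cconj An * cis (- (IZR n * t)))).

Definition ode0_lhs (P : model) (mu1 : R * R) (lamI : R) (phi0 phi0s : vec2)
    (A : C) : C :=
  - RtoC (2 * PI * rad P) * Bm P 0 (Ci * lamI) * qm P 0 (Ci * lamI)
  * Cconj (snd phi0s) * snd phi0 * beta_mu P mu1 * A.

Definition ode0_rhs (P : model) (mu1 : R * R) (lamI : R) (phi0 phi0s : vec2)
    (w0000 w1100 w2000 : field) (A dA : C) : C :=
  let w0 := W0 P lamI phi0 in
  let w0s := W0s P lamI phi0s in
  let Om := Omv P (Ci * lamI) in
  - dA
  + 2 * inner P w0s (Bop P w0 w0000) * A
  + RtoC (2 * PI * rad P) * Cconj (snd phi0s) * snd phi0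
    * (Bm P 0 (Ci * lamI) ^ 2 * Om ^ 2 * (rad P / 2)
         * (1 - (BesselI 1 (Om * rad P) / BesselI 0 (Om * rad P)) ^ 2) * snd mu1
       - qm P 0 (Ci * lamI) * fst mu1) * A
  + inner P w0s (cub0 P w0 w1100 w2000) * sqmod A * A.

Definition oden_lhs (P : model) (mu1 : R * R) (n : Z) (phin phins : R * R)
    (A : C) : C :=
  - RtoC (2 * PI * rad P) * Bm P n 0 * qm P n 0
  * snd phins * snd phin * beta_mu P mu1 * A.

Definition oden_rhs (P : model) (mu1 : R * R) (n : Z) (phin phins : R * R)
    (w0000 w0011 w0020 : field) (A dA : C) : C :=
  let wn := Wn P n phin in
  let wns := Wns P n phins in
  let om := Omv P 0 in
  - dA
  + 2 * inner P wns (Bop P wn w0000) * A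
  + RtoC (2 * PI * rad P) * snd phins * snd phin
    * (Bm P n 0 ^ 2 * om ^ 2 * (rad P / 2)
         * (1 - BesselI (n - 1) (om * rad P) * BesselI (n + 1) (om * rad P)
                / BesselI n (om * rad P) ^ 2) * snd mu1
       - qm P n 0 * fst mu1) * A
  + inner P wns (cubn P wn (Wmn P n phin) w0011 w0020) * sqmod A * A.

(* Main.v *)
Require Import Defs.
From Stdlib Require Import Reals ZArith Lra Lia FunctionalExtensionality.
From Coquelicot Require Import Coquelicot.
Open Scope R_scope.
Open Scope C_scope.

(* Fix a mode [m] and put [lam = i lam_I] or [lam = 0]. Multiplying the system by
   [exp (-i m theta)] and integrating over the angle leaves a radial Bessel-type
   equation for the Fourier coefficients of the unknown, coupled to two scalar
   surface equations. Green's identity on [[0, R]] against the adjoint profile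
   [A_m I_m (Omega r) / I_m (Omega R)], which satisfies the homogeneous Robin
   condition, replaces the bulk unknowns by their boundary terms; pairing the
   surface rows with the left null vector of [Phi_m] then eliminates every unknown,
   and what remains is [<W*, F> = - 2 pi R B_m conj(phi*_2) bc], where [F] is the part
   of the forcing on mode [m] (all other modes integrate to zero). The coefficient of
   [e_2^T mu_1] is Lommel's integral of [r I_m(Omega r)^2]. The Robin denominators and
   [I_m (Omega R)] do not vanish, since [Re (r y' conj y)] increases along
   [y = I_m (Omega r)] when [Re Omega^2 > 0]. *)

(** * Componentwise calculus for complex-valued functions of a real variable *)

(** Pairing the unknown with the adjoint eigenfunction over the disc would need Green's theorem in
    the plane and an exchange of integrals. Projecting on one angular mode first avoids both:
    [inner] is only evaluated on fields carried by a single mode, where the angular integrand is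
    constant. The price is differentiation under the angular integral and a radial equation that is
    singular at r = 0 and holds on the open interval only. The adjoint eigenfunction lives at the
    conjugate eigenvalue because the inner product conjugates its first slot: this restores the
    profile at [lam], so the integrands contain I_m(Omega r)^2 instead of a squared modulus.
    Conjugation commutes with the principal root since (lam + sigma) / D has positive real part for
    Re lam >= 0, the same fact that excludes zeros of I_m and of the Robin denominators. The Bessel
    identities are read off from coefficients: the Euler operator z d/dz keeps exponents, so they
    reduce to recurrences for [bcoef]. *)

Definition is_Cseries (a : nat -> C) (l : C) : Prop :=
  is_series (fun k => Re (a k)) (Re l) /\ is_series (fun k => Im (a k)) (Im l).
Definition is_Cderive (h : R -> C) (t : R) (l : C) : Prop :=
  is_derive (fun s => Re (h s)) t (Re l) /\ is_derive (fun s => Im (h s)) t (Im l).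
Definition is_CInt (h : R -> C) (a b : R) (l : C) : Prop :=
  is_RInt (fun s => Re (h s)) a b (Re l) /\ is_RInt (fun s => Im (h s)) a b (Im l).
Definition Ccontinuous (h : R -> C) (t : R) : Prop :=
  continuous (fun s => Re (h s)) t /\ continuous (fun s => Im (h s)) t.

Lemma C_ext (z w : C) : Re z = Re w -> Im z = Im w -> z = w.
Proof. destruct z, w; unfold Re, Im; simpl; intros -> ->; reflexivity. Qed.

Lemma Re_plus (z w : C) : Re (z + w) = (Re z + Re w)%R.
Proof. reflexivity. Qed.
Lemma Im_plus (z w : C) : Im (z + w) = (Im z + Im w)%R.
Proof. reflexivity. Qed.
Lemma Re_mult (z w : C) : Re (z * w) = (Re z * Re w - Im z * Im w)%R.
Proof. reflexivity. Qed.
Lemma Im_mult (z w : C) : Im (z * w) = (Re z * Im w + Im z * Re w)%R.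
Proof. reflexivity. Qed.
Lemma Re_RtoC (x : R) : Re (RtoC x) = x.
Proof. reflexivity. Qed.
Lemma Im_RtoC (x : R) : Im (RtoC x) = 0%R.
Proof. reflexivity. Qed.
Lemma Re_conj (z : C) : Re (Cconj z) = Re z.
Proof. reflexivity. Qed.
Lemma Im_conj (z : C) : Im (Cconj z) = (- Im z)%R.
Proof. reflexivity. Qed.
Lemma Re_opp (z : C) : Re (- z) = (- Re z)%R.
Proof. reflexivity. Qed.
Lemma Im_opp (z : C) : Im (- z) = (- Im z)%R.
Proof. reflexivity. Qed.

Ltac csplit := repeat first [rewrite Re_plus | rewrite Im_plus | rewrite Re_mult
  | rewrite Im_mult | rewrite Re_RtoC | rewrite Im_RtoC | rewrite Re_conj
  | rewrite Im_conj | rewrite Re_opp | rewrite Im_opp].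
Ltac pushC := repeat first [rewrite RtoC_plus | rewrite RtoC_minus | rewrite RtoC_opp
  | rewrite RtoC_mult].
Ltac Cext := apply C_ext; unfold Cminus; csplit.

Lemma Cconj_plus (z w : C) : Cconj (z + w) = Cconj z + Cconj w.
Proof. Cext; ring. Qed.
Lemma Cconj_mult (z w : C) : Cconj (z * w) = Cconj z * Cconj w.
Proof. Cext; ring. Qed.
Lemma Cconj_minus (z w : C) : Cconj (z - w) = Cconj z - Cconj w.
Proof. Cext; ring. Qed.
Lemma Cconj_RtoC (x : R) : Cconj x = x.
Proof. Cext; ring. Qed.
Lemma Cconj_conj (z : C) : Cconj (Cconj z) = z.
Proof. Cext; ring. Qed.
Lemma Cconj_inv (z : C) : Cconj (/ z) = / Cconj z.
Proof.
  destruct z as [x y]; unfold Cconj, Cinv; simpl.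
  replace ((- y) * ((- y) * 1))%R with (y * (y * 1))%R by ring.
  unfold Rdiv; f_equal; ring.
Qed.
Lemma Cconj_div (z w : C) : Cconj (z / w) = Cconj z / Cconj w.
Proof. unfold Cdiv; rewrite Cconj_mult, Cconj_inv; reflexivity. Qed.
Lemma Cconj_pow (z : C) (n : nat) : Cconj (z ^ n) = Cconj z ^ n.
Proof.
  induction n as [|n IH]; simpl.
  - apply Cconj_RtoC.
  - rewrite Cconj_mult, IH; reflexivity.
Qed.

Lemma RtoC_pow (x : R) (n : nat) : RtoC (x ^ n) = RtoC x ^ n.
Proof. induction n as [|n IH]; simpl; [reflexivity|]. now rewrite RtoC_mult, IH. Qed.

Lemma Cmod_le_abs (z : C) : (Cmod z <= Rabs (Re z) + Rabs (Im z))%R.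
Proof.
  replace z with (RtoC (Re z) + Ci * RtoC (Im z)) at 1.
  - eapply Rle_trans; [apply Cmod_triangle|].
    rewrite Cmod_mult, Cmod_Ci, !Cmod_R; lra.
  - destruct z; Cext; simpl; ring.
Qed.

Lemma abs_Re_le (z : C) : (Rabs (Re z) <= Cmod z)%R.
Proof. eapply Rle_trans; [|apply Rmax_Cmod]; apply Rmax_l. Qed.
Lemma abs_Im_le (z : C) : (Rabs (Im z) <= Cmod z)%R.
Proof. eapply Rle_trans; [|apply Rmax_Cmod]; apply Rmax_r. Qed.

Lemma Cmod_sqr (z : C) : (Cmod z ^ 2 = Re z ^ 2 + Im z ^ 2)%R.
Proof.
  unfold Cmod. rewrite pow2_sqrt; [reflexivity|].
  generalize (pow2_ge_0 (fst z)) (pow2_ge_0 (snd z)); lra.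
Qed.

Lemma Cmult_conj (z : C) : z * Cconj z = RtoC (Cmod z ^ 2).
Proof. rewrite Cmod_sqr; Cext; ring. Qed.

Lemma Cseries_unique (a : nat -> C) (l : C) : is_Cseries a l -> CSeries a = l.
Proof.
  intros [H1 H2]; unfold CSeries.
  rewrite (is_series_unique _ _ H1), (is_series_unique _ _ H2); now destruct l.
Qed.

Lemma Cseries_ext (a b : nat -> C) (l : C) :
  (forall k, a k = b k) -> is_Cseries a l -> is_Cseries b l.
Proof.
  intros E [H1 H2]; split; eapply is_series_ext; try eassumption;
    intros k; simpl; now rewrite E.
Qed.

Lemma Cseries_plus (a b : nat -> C) (la lb : C) :
  is_Cseries a la -> is_Cseries b lb -> is_Cseries (fun k => a k + b k) (la + lb).
Proof.
  intros [H1 H2] [H3 H4]; split.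
  - exact (is_series_plus _ _ _ _ H1 H3).
  - exact (is_series_plus _ _ _ _ H2 H4).
Qed.

Lemma Cseries_scal (c : C) (a : nat -> C) (l : C) :
  is_Cseries a l -> is_Cseries (fun k => c * a k) (c * l).
Proof.
  intros [H1 H2]; split.
  - refine (is_series_minus _ _ _ _ (is_series_scal (Re c) _ _ H1)
             (is_series_scal (Im c) _ _ H2)).
  - refine (is_series_plus _ _ _ _ (is_series_scal (Re c) _ _ H2)
             (is_series_scal (Im c) _ _ H1)).
Qed.

Lemma Cseries_conj (a : nat -> C) (l : C) :
  is_Cseries a l -> is_Cseries (fun k => Cconj (a k)) (Cconj l).
Proof.
  intros [H1 H2]; split; [exact H1|].
  exact (is_series_opp _ _ H2).
Qed.

Lemma Cseries_shift (a : nat -> C) (l : C) :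
  is_Cseries (fun k => a (S k)) l -> is_Cseries a (a 0%nat + l).
Proof.
  intros [H1 H2]; split; apply is_series_decr_1.
  - match goal with |- is_series _ ?x => replace x with (Re l) end; [exact H1|].
    csplit; unfold plus, opp; simpl; ring.
  - match goal with |- is_series _ ?x => replace x with (Im l) end; [exact H2|].
    csplit; unfold plus, opp; simpl; ring.
Qed.

(** Real and imaginary parts are each bounded by the majorant, which costs the factor 2; later uses
    need only some explicit multiple of [Series b]. *)
Lemma Cseries_dominated (a : nat -> C) (b : nat -> R) :
  (forall k, (Cmod (a k) <= b k)%R) -> ex_series b ->
  exists l, is_Cseries a l /\ (Cmod l <= 2 * Series b)%R.
Proof.
  intros Hab Hb.
  assert (HR : forall k, (Rabs (Re (a k)) <= b k)%R)
    by (intros k; eapply Rle_trans; [apply abs_Re_le|apply Hab]).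
  assert (HI : forall k, (Rabs (Im (a k)) <= b k)%R)
    by (intros k; eapply Rle_trans; [apply abs_Im_le|apply Hab]).
  assert (ER : ex_series (fun k => Rabs (Re (a k)))).
  { apply (ex_series_le (V := R_CompleteNormedModule) _ b); [|exact Hb].
    intros k; unfold norm; simpl; unfold abs; simpl; rewrite Rabs_Rabsolu; apply HR. }
  assert (EI : ex_series (fun k => Rabs (Im (a k)))).
  { apply (ex_series_le (V := R_CompleteNormedModule) _ b); [|exact Hb].
    intros k; unfold norm; simpl; unfold abs; simpl; rewrite Rabs_Rabsolu; apply HI. }
  exists (CSeries a); split.
  - split; unfold CSeries; simpl; apply Series_correct; now apply ex_series_Rabs.
  - eapply Rle_trans; [apply Cmod_le_abs|].
    assert (H1 : (Rabs (Series (fun k => Re (a k))) <= Series b)%R).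
    { eapply Rle_trans; [now apply Series_Rabs|].
      apply Series_le; [|exact Hb]. intros k; split; [apply Rabs_pos|apply HR]. }
    assert (H2 : (Rabs (Series (fun k => Im (a k))) <= Series b)%R).
    { eapply Rle_trans; [now apply Series_Rabs|].
      apply Series_le; [|exact Hb]. intros k; split; [apply Rabs_pos|apply HI]. }
    unfold CSeries, Re, Im in *; simpl in *; lra.
Qed.

Lemma Cderive_unique (h : R -> C) (t : R) (l : C) : is_Cderive h t l -> CDerive h t = l.
Proof.
  intros [H1 H2]; apply C_ext.
  - exact (is_derive_unique _ _ _ H1).
  - exact (is_derive_unique _ _ _ H2).
Qed.

Lemma Cderive_eq (h : R -> C) (t : R) (l l' : C) :
  is_Cderive h t l -> l = l' -> is_Cderive h t l'.
Proof. now intros ? <-. Qed.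

Lemma Cderive_ext (h k : R -> C) (t : R) (l : C) :
  (forall s, h s = k s) -> is_Cderive h t l -> is_Cderive k t l.
Proof.
  intros E [H1 H2]; split; eapply is_derive_ext; try eassumption;
    intros s; simpl; now rewrite E.
Qed.

Lemma Cderive_const (c : C) (t : R) : is_Cderive (fun _ => c) t 0.
Proof. split; exact (is_derive_const _ _). Qed.

Lemma Cderive_RtoC (t : R) : is_Cderive RtoC t 1.
Proof. split; [exact (is_derive_id _)|exact (is_derive_const _ _)]. Qed.

Lemma Cderive_plus (h k : R -> C) (t : R) (l m : C) :
  is_Cderive h t l -> is_Cderive k t m -> is_Cderive (fun s => h s + k s) t (l + m).
Proof.
  intros [H1 H2] [H3 H4]; split.
  - exact (is_derive_plus _ _ _ _ _ H1 H3).
  - exact (is_derive_plus _ _ _ _ _ H2 H4).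
Qed.

Lemma Rderive_mult (h k : R -> R) (t l m : R) :
  is_derive h t l -> is_derive k t m ->
  is_derive (fun s => (h s * k s)%R) t (l * k t + h t * m)%R.
Proof.
  intros H1 H2.
  exact (is_derive_mult h k t l m H1 H2 Rmult_comm).
Qed.

Lemma Cderive_mult (h k : R -> C) (t : R) (l m : C) :
  is_Cderive h t l -> is_Cderive k t m ->
  is_Cderive (fun s => h s * k s) t (l * k t + h t * m).
Proof.
  intros [H1 H2] [H3 H4]; split.
  - replace (Re (l * k t + h t * m)) with
      (minus (Re l * Re (k t) + Re (h t) * Re m)%R
             (Im l * Im (k t) + Im (h t) * Im m)%R)
      by (csplit; unfold minus, plus, opp; simpl; ring).
    exact (is_derive_minus _ _ _ _ _ (Rderive_mult _ _ _ _ _ H1 H3)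
                                     (Rderive_mult _ _ _ _ _ H2 H4)).
  - replace (Im (l * k t + h t * m)) with
      (plus (Re l * Im (k t) + Re (h t) * Im m)%R
            (Im l * Re (k t) + Im (h t) * Re m)%R)
      by (csplit; unfold plus; simpl; ring).
    exact (is_derive_plus _ _ _ _ _ (Rderive_mult _ _ _ _ _ H1 H4)
                                    (Rderive_mult _ _ _ _ _ H2 H3)).
Qed.

Lemma Cderive_scal (c : C) (h : R -> C) (t : R) (l : C) :
  is_Cderive h t l -> is_Cderive (fun s => c * h s) t (c * l).
Proof.
  intros H; eapply Cderive_eq; [apply Cderive_mult; [apply Cderive_const|exact H]|].
  cbv beta; ring.
Qed.

Lemma Cderive_minus (h k : R -> C) (t : R) (l m : C) :
  is_Cderive h t l -> is_Cderive k t m -> is_Cderive (fun s => h s - k s) t (l - m).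
Proof.
  intros [H1 H2] [H3 H4]; split.
  - exact (is_derive_minus _ _ _ _ _ H1 H3).
  - exact (is_derive_minus _ _ _ _ _ H2 H4).
Qed.

Lemma Cderive_conj (h : R -> C) (t : R) (l : C) :
  is_Cderive h t l -> is_Cderive (fun s => Cconj (h s)) t (Cconj l).
Proof. intros [H1 H2]; split; [exact H1|exact (is_derive_opp _ _ _ H2)]. Qed.

Lemma Cderive_cis (k t : R) : is_Cderive (fun s => cis (k * s)) t (Ci * k * cis (k * t)).
Proof.
  split; unfold cis, Ci, RtoC, Cmult, Re, Im; simpl.
  - auto_derive; [exact I|]. ring.
  - auto_derive; [exact I|]. ring.
Qed.

Lemma Cderive_continuous (h : R -> C) (t : R) (l : C) : is_Cderive h t l -> Ccontinuous h t.
Proof.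
  intros [H1 H2]; split.
  - apply (ex_derive_continuous (fun s => Re (h s))); now exists (Re l).
  - apply (ex_derive_continuous (fun s => Im (h s))); now exists (Im l).
Qed.

Lemma Ccontinuous_ext (h k : R -> C) (t : R) :
  (forall s, h s = k s) -> Ccontinuous h t -> Ccontinuous k t.
Proof. intros E; apply functional_extensionality in E; now rewrite E. Qed.

Lemma Ccontinuous_const (c : C) (t : R) : Ccontinuous (fun _ => c) t.
Proof. split; exact (continuous_const _ _). Qed.

Lemma Ccontinuous_plus (h k : R -> C) (t : R) :
  Ccontinuous h t -> Ccontinuous k t -> Ccontinuous (fun s => h s + k s) t.
Proof.
  intros [H1 H2] [H3 H4]; split.
  - exact (continuous_plus _ _ _ H1 H3).
  - exact (continuous_plus _ _ _ H2 H4).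
Qed.

Lemma Ccontinuous_mult (h k : R -> C) (t : R) :
  Ccontinuous h t -> Ccontinuous k t -> Ccontinuous (fun s => h s * k s) t.
Proof.
  intros [H1 H2] [H3 H4]; split.
  - exact (continuous_minus _ _ _ (continuous_mult _ _ _ H1 H3)
                                  (continuous_mult _ _ _ H2 H4)).
  - exact (continuous_plus _ _ _ (continuous_mult _ _ _ H1 H4)
                                 (continuous_mult _ _ _ H2 H3)).
Qed.

Lemma Ccontinuous_conj (h : R -> C) (t : R) :
  Ccontinuous h t -> Ccontinuous (fun s => Cconj (h s)) t.
Proof. intros [H1 H2]; split; [exact H1|exact (continuous_opp _ _ H2)]. Qed.

Lemma CInt_unique (h : R -> C) (a b : R) (l : C) : is_CInt h a b l -> CInt h a b = l.
Proof.
  intros [H1 H2]; unfold CInt.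
  apply (is_RInt_unique (V := C_R_CompleteNormedModule)).
  replace l with (Re l, Im l) by now destruct l.
  exact (is_RInt_fct_extend_pair (U := R_NormedModule) (V := R_NormedModule)
           h a b _ _ H1 H2).
Qed.

Lemma is_CInt_eq (h : R -> C) (a b : R) (l l' : C) :
  is_CInt h a b l -> l = l' -> is_CInt h a b l'.
Proof. now intros ? <-. Qed.

Lemma is_CInt_inj (h : R -> C) (a b : R) (l l' : C) :
  is_CInt h a b l -> is_CInt h a b l' -> l = l'.
Proof. intros H H'; now rewrite <- (CInt_unique _ _ _ _ H), (CInt_unique _ _ _ _ H'). Qed.

Lemma is_CInt_ext (h k : R -> C) (a b : R) (l : C) :
  (forall s, (Rmin a b < s < Rmax a b)%R -> h s = k s) -> is_CInt h a b l -> is_CInt k a b l.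
Proof.
  intros E [H1 H2]; split; eapply is_RInt_ext; try eassumption;
    intros s Hs; simpl; now rewrite E.
Qed.

Lemma is_CInt_plus (h k : R -> C) (a b : R) (l m : C) :
  is_CInt h a b l -> is_CInt k a b m -> is_CInt (fun s => h s + k s) a b (l + m).
Proof.
  intros [H1 H2] [H3 H4]; split.
  - exact (is_RInt_plus _ _ _ _ _ _ H1 H3).
  - exact (is_RInt_plus _ _ _ _ _ _ H2 H4).
Qed.

Lemma is_CInt_scal (c : C) (h : R -> C) (a b : R) (l : C) :
  is_CInt h a b l -> is_CInt (fun s => c * h s) a b (c * l).
Proof.
  intros [H1 H2]; split.
  - exact (is_RInt_minus _ _ _ _ _ _ (is_RInt_scal _ _ _ (Re c) _ H1)
                                     (is_RInt_scal _ _ _ (Im c) _ H2)).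
  - exact (is_RInt_plus _ _ _ _ _ _ (is_RInt_scal _ _ _ (Re c) _ H2)
                                     (is_RInt_scal _ _ _ (Im c) _ H1)).
Qed.

Lemma is_CInt_const (c : C) (a b : R) : is_CInt (fun _ => c) a b ((b - a)%R * c).
Proof.
  split.
  - replace (Re ((b - a)%R * c)) with (scal (b - a)%R (Re c))
      by (csplit; unfold scal; simpl; unfold mult; simpl; ring).
    exact (is_RInt_const a b (Re c)).
  - replace (Im ((b - a)%R * c)) with (scal (b - a)%R (Im c))
      by (csplit; unfold scal; simpl; unfold mult; simpl; ring).
    exact (is_RInt_const a b (Im c)).
Qed.

Lemma is_CInt_continuous (h : R -> C) (a b : R) :
  (forall s, (Rmin a b <= s <= Rmax a b)%R -> Ccontinuous h s) ->
  is_CInt h a b (CInt h a b).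
Proof.
  intros Hc.
  assert (E1 : ex_RInt (fun s => Re (h s)) a b)
    by (apply (ex_RInt_continuous (V := R_CompleteNormedModule)); intros s Hs;
        exact (proj1 (Hc s Hs))).
  assert (E2 : ex_RInt (fun s => Im (h s)) a b)
    by (apply (ex_RInt_continuous (V := R_CompleteNormedModule)); intros s Hs;
        exact (proj2 (Hc s Hs))).
  destruct E1 as [x Hx], E2 as [y Hy].
  assert (H : is_CInt h a b (x, y)) by (split; assumption).
  now rewrite (CInt_unique _ _ _ _ H).
Qed.

Lemma is_CInt_derive (h dh : R -> C) (a b : R) :
  (forall s, (Rmin a b <= s <= Rmax a b)%R -> is_Cderive h s (dh s)) ->
  (forall s, (Rmin a b <= s <= Rmax a b)%R -> Ccontinuous dh s) ->
  is_CInt dh a b (h b - h a).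
Proof.
  intros H1 H2; split.
  - exact (is_RInt_derive (V := R_CompleteNormedModule)
             (fun s => Re (h s)) (fun s => Re (dh s)) a b
             (fun s Hs => proj1 (H1 s Hs)) (fun s Hs => proj1 (H2 s Hs))).
  - exact (is_RInt_derive (V := R_CompleteNormedModule)
             (fun s => Im (h s)) (fun s => Im (dh s)) a b
             (fun s Hs => proj2 (H1 s Hs)) (fun s Hs => proj2 (H2 s Hs))).
Qed.

(** * Entire power series and modified Bessel functions *)

(** The series sum c_k z^(e_k) keeps its own exponents, so that the sparse Bessel series and its
    derivatives require no interleaved zero coefficients. Smaller radii are dominated by larger
    ones, so [1 <= rho] covers the whole plane. *)
Definition entire (c : nat -> R) (e : nat -> nat) : Prop :=
  (forall k, (0 <= c k)%R) /\
  forall rho : R, (1 <= rho)%R -> ex_series (fun k => c k * rho ^ e k)%R.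
Definition gsum (c : nat -> R) (e : nat -> nat) (z : C) : C :=
  CSeries (fun k => c k * z ^ e k).
(** Termwise differentiation. The truncated predecessor in [dexp] is harmless at exponent 0, where
    the factor [INR (e k)] vanishes. *)
Definition dcoef (c : nat -> R) (e : nat -> nat) (k : nat) : R := (c k * INR (e k))%R.
Definition dexp (e : nat -> nat) (k : nat) : nat := Nat.pred (e k).

Lemma gsum_correct (c : nat -> R) (e : nat -> nat) (z : C) :
  entire c e -> is_Cseries (fun k => c k * z ^ e k) (gsum c e z).
Proof.
  intros [Hc He].
  destruct (Cseries_dominated (fun k => c k * z ^ e k)
    (fun k => c k * (Cmod z + 1) ^ e k)%R) as (l & Hl & _).
  - intros k; rewrite Cmod_mult, Cmod_R, Cmod_pow, Rabs_pos_eq by apply Hc.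
    apply Rmult_le_compat_l; [apply Hc|]. apply pow_incr.
    generalize (Cmod_ge_0 z); lra.
  - apply He; generalize (Cmod_ge_0 z); lra.
  - unfold gsum; now rewrite (Cseries_unique _ _ Hl).
Qed.

(** From e <= 2^e, each differentiated term e rho^(e-1) is at most (2 rho)^e, so convergence at
    radius [2 * rho] suffices. *)
Lemma entire_dcoef (c : nat -> R) (e : nat -> nat) :
  entire c e -> entire (dcoef c e) (dexp e).
Proof.
  intros [Hc He]; split.
  - intros k; apply Rmult_le_pos; [apply Hc|apply pos_INR].
  - intros rho Hrho.
    apply (ex_series_le (V := R_CompleteNormedModule) _
      (fun k => c k * (2 * rho) ^ e k)%R); [|apply He; lra].
    intros k; unfold norm; simpl; unfold abs; simpl.
    unfold dcoef, dexp.
    assert (Hp : (0 <= rho ^ Nat.pred (e k))%R) by (apply pow_le; lra).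
    rewrite Rabs_pos_eq
      by (apply Rmult_le_pos; [apply Rmult_le_pos; [apply Hc|apply pos_INR]|exact Hp]).
    rewrite Rmult_assoc; apply Rmult_le_compat_l; [apply Hc|].
    rewrite Rpow_mult_distr.
    apply Rmult_le_compat; [apply pos_INR|exact Hp| |].
      replace 2%R with (INR 2) by (simpl; lra).
      rewrite <- pow_INR; apply le_INR.
      generalize (Nat.pow_gt_lin_r 2 (e k) ltac:(lia)); lia.
    + apply Rle_pow; [exact Hrho|lia].
Qed.

Lemma Cpow_diff_bound (z h : C) (n : nat) : (Cmod h <= 1)%R ->
  (Cmod ((z + h) ^ n - z ^ n) <= Cmod h * (Cmod z + 1) ^ n)%R.
Proof.
  intros Hh; generalize (Cmod_ge_0 h) (Cmod_ge_0 z); intros Hh0 Hz0.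
  induction n as [|n IH].
  - replace ((z + h) ^ 0 - z ^ 0) with (RtoC 0) by (simpl; ring).
    rewrite Cmod_0; simpl; lra.
  - replace ((z + h) ^ S n - z ^ S n) with (z * ((z + h) ^ n - z ^ n) + h * (z + h) ^ n)
      by (simpl; ring).
    eapply Rle_trans; [apply Cmod_triangle|].
    rewrite !Cmod_mult, Cmod_pow.
    assert (H : (Cmod (z + h) ^ n <= (Cmod z + 1) ^ n)%R).
    { apply pow_incr; split; [apply Cmod_ge_0|].
      eapply Rle_trans; [apply Cmod_triangle|lra]. }
    apply (Rmult_le_compat_l _ _ _ Hz0) in IH.
    apply (Rmult_le_compat_l _ _ _ Hh0) in H.
    simpl; lra.
Qed.

(** Induction: the remainder for n + 1 is z times the remainder for n plus h times the first
    difference, which [Cpow_diff_bound] controls. A bound geometric in n can be summed against the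
    coefficients of an entire series. *)
Lemma Cpow_taylor_bound (z h : C) (n : nat) : (Cmod h <= 1)%R ->
  (Cmod ((z + h) ^ n - z ^ n - h * (RtoC (INR n) * z ^ Nat.pred n))
    <= Cmod h ^ 2 * (Cmod z + 1) ^ n)%R.
Proof.
  intros Hh; generalize (Cmod_ge_0 h) (Cmod_ge_0 z); intros Hh0 Hz0.
  induction n as [|n IH].
  - replace ((z + h) ^ 0 - z ^ 0 - h * (RtoC (INR 0) * z ^ Nat.pred 0)) with (RtoC 0)
      by (simpl; ring).
    rewrite Cmod_0; simpl; nra.
  - replace ((z + h) ^ S n - z ^ S n - h * (RtoC (INR (S n)) * z ^ Nat.pred (S n)))
      with (z * ((z + h) ^ n - z ^ n - h * (RtoC (INR n) * z ^ Nat.pred n))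
            + h * ((z + h) ^ n - z ^ n)).
    + eapply Rle_trans; [apply Cmod_triangle|].
      rewrite !Cmod_mult.
      generalize (Cpow_diff_bound z h n Hh); intros H.
      apply (Rmult_le_compat_l _ _ _ Hz0) in IH.
      apply (Rmult_le_compat_l _ _ _ Hh0) in H.
      simpl in *; lra.
    + rewrite S_INR, RtoC_plus; destruct n as [|n]; simpl; ring.
Qed.

(** A quadratic remainder on the unit disc is stronger than differentiability: it survives summation
    of the series and yields both the complex derivative and the real derivative along every ray. *)
Definition quad_diff (F : C -> C) (z d : C) : Prop :=
  exists M : R, (0 <= M)%R /\ forall h : C, (Cmod h <= 1)%R ->
    (Cmod (F (z + h)%C - F z - h * d) <= M * Cmod h ^ 2)%R.

Lemma gsum_quad (c : nat -> R) (e : nat -> nat) (z : C) :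
  entire c e -> quad_diff (gsum c e) z (gsum (dcoef c e) (dexp e) z).
Proof.
  intros H.
  assert (Hz := Cmod_ge_0 z).
  assert (Hs : ex_series (fun k => c k * (Cmod z + 1) ^ e k)%R)
    by (apply H; lra).
  assert (Hterm : forall k, (0 <= c k * (Cmod z + 1) ^ e k)%R)
    by (intros k; apply Rmult_le_pos; [apply H|apply pow_le; lra]).
  exists (2 * Series (fun k => c k * (Cmod z + 1) ^ e k))%R; split.
  { assert (0 <= Series (fun k => c k * (Cmod z + 1) ^ e k))%R; [|lra].
    replace 0%R with (Series (fun k => 0 * (c k * (Cmod z + 1) ^ e k))%R)
      by (rewrite Series_scal_l; ring).
    apply Series_le; [|exact Hs]. intros k; specialize (Hterm k); split; lra. }
  intros h Hh.
  assert (Hl := Cseries_plus _ _ _ _ (Cseries_plus _ _ _ _ (gsum_correct c e (z + h) H)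
     (Cseries_scal (- RtoC 1) _ _ (gsum_correct c e z H)))
     (Cseries_scal (- h) _ _ (gsum_correct _ _ z (entire_dcoef c e H)))).
  destruct (Cseries_dominated (fun k => c k * ((z + h) ^ e k - z ^ e k
        - h * (RtoC (INR (e k)) * z ^ Nat.pred (e k))))
    (fun k => Cmod h ^ 2 * (c k * (Cmod z + 1) ^ e k))%R) as (l & Hl' & Hb).
  - intros k; rewrite Cmod_mult, Cmod_R, Rabs_pos_eq by apply H.
    generalize (Cpow_taylor_bound z h (e k) Hh); intros Ht.
    apply (Rmult_le_compat_l (c k)) in Ht; [|apply H]. lra.
  - apply (ex_series_scal (V := R_NormedModule) (Cmod h ^ 2)%R _ Hs).
  - replace (gsum c e (z + h) - gsum c e z - h * gsum (dcoef c e) (dexp e) z) with l.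
    { rewrite Series_scal_l in Hb; lra. }
    rewrite <- (Cseries_unique _ _ Hl').
    apply (Cseries_ext _ (fun k => c k * ((z + h) ^ e k - z ^ e k
        - h * (RtoC (INR (e k)) * z ^ Nat.pred (e k))))) in Hl.
    + rewrite (Cseries_unique _ _ Hl); ring.
    + intros k; unfold dcoef, dexp; rewrite RtoC_mult; ring.
Qed.

Lemma quad_C_derive (F : C -> C) (z d : C) : quad_diff F z d -> C_derive F z = d.
Proof.
  intros (M & HM & HF); apply is_C_derive_unique; split.
  - apply is_linear_scal_l.
  - intros x Hx.
    rewrite <- (is_filter_lim_locally_unique (V := AbsRing_NormedModule C_AbsRing) z x Hx).
    intros eps.
    (* Dividing by [M + 1] covers the case [M = 0]. *)
    assert (Hd : (0 < Rmin 1 (eps / (M + 1)))%R).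
    { apply Rmin_pos; [lra|]. apply Rdiv_lt_0_compat; [apply cond_pos|lra]. }
    exists (mkposreal _ Hd); intros y0 Hy; pose (y := y0 : C); fold y in Hy |- *; clearbody y.
    change (Cmod (y - z) < Rmin 1 (eps / (M + 1)))%R in Hy.
    change (Cmod (F y - F z - (y - z) * d) <= eps * Cmod (y - z))%R.
    assert (H1 : (Cmod (y - z) <= 1)%R)
      by (generalize (Rmin_l 1 (eps / (M + 1))); lra).
    assert (H2 : (Cmod (y - z) < eps / (M + 1))%R)
      by (generalize (Rmin_r 1 (eps / (M + 1))); lra).
    specialize (HF (y - z) H1).
    replace (z + (y - z)) with y in HF by ring.
    eapply Rle_trans; [exact HF|].
    assert (H0 := Cmod_ge_0 (y - z)).
    assert (H3 : ((M + 1) * Cmod (y - z) <= eps)%R).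
    { replace (pos eps) with ((M + 1) * (eps / (M + 1)))%R by (field; lra).
      apply Rmult_le_compat_l; lra. }
    nra.
Qed.

Lemma quad_is_derive (h : R -> R) (r l M : R) (delta : posreal) : (0 <= M)%R ->
  (forall s, (Rabs s < delta)%R -> (Rabs (h (r + s) - h r - s * l) <= M * s ^ 2)%R) ->
  is_derive h r l.
Proof.
  intros HM H; apply is_derive_Reals; intros eps Heps.
  assert (Hd : (0 < Rmin delta (eps / (M + 1)))%R).
  { apply Rmin_pos; [apply cond_pos|]. apply Rdiv_lt_0_compat; lra. }
  exists (mkposreal _ Hd); intros s Hs0 Hs; simpl in Hs.
  assert (H1 : (Rabs s < delta)%R) by (generalize (Rmin_l delta (eps / (M + 1))); lra).
  assert (H2 : (Rabs s < eps / (M + 1))%R)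
    by (generalize (Rmin_r delta (eps / (M + 1))); lra).
  specialize (H s H1).
  assert (Hp : (0 < Rabs s)%R) by now apply Rabs_pos_lt.
  replace ((h (r + s) - h r) / s - l)%R with ((h (r + s) - h r - s * l) / s)%R
    by (field; exact Hs0).
  unfold Rdiv; rewrite Rabs_mult, Rabs_inv.
  apply Rmult_lt_reg_r with (Rabs s); [exact Hp|].
  rewrite Rmult_assoc, Rinv_l, Rmult_1_r by lra.
  eapply Rle_lt_trans; [exact H|].
  rewrite <- (pow2_abs s).
  assert (H3 : ((M + 1) * Rabs s < eps)%R).
  { replace eps with ((M + 1) * (eps / (M + 1)))%R by (field; lra).
    apply Rmult_lt_compat_l; lra. }
  nra.
Qed.

Lemma quad_Cderive_ray (F : C -> C) (w d : C) (r : R) :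
  quad_diff F (w * r) d -> is_Cderive (fun s => F (w * s)) r (w * d).
Proof.
  intros (M & HM & HF).
  assert (Hw := Cmod_ge_0 w).
  (* Within this radius [w * s] stays in the unit disc, where the remainder bound is available. *)
  assert (Hd : (0 < / (Cmod w + 1))%R) by (apply Rinv_0_lt_compat; lra).
  assert (HQ : forall s : R, (Rabs s < mkposreal _ Hd)%R ->
    (Cmod (F (w * (r + s)%R)%C - F (w * r)%C - s * (w * d)) <= (M * Cmod w ^ 2) * s ^ 2)%R).
  { intros s Hs; simpl in Hs.
    assert (Hws : (Cmod (w * s) <= 1)%R).
    { rewrite Cmod_mult, Cmod_R.
      apply (Rmult_lt_compat_l (Cmod w + 1)) in Hs; [|lra].
      rewrite Rinv_r in Hs by lra. generalize (Rabs_pos s); nra. }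
    specialize (HF _ Hws).
    replace (w * r + w * s) with (w * (r + s)%R) in HF by (rewrite RtoC_plus; ring).
    replace (s * (w * d)) with (w * s * d) by ring.
    eapply Rle_trans; [exact HF|].
    rewrite Cmod_mult, Cmod_R, Rpow_mult_distr, pow2_abs; lra. }
  assert (HM' : (0 <= M * Cmod w ^ 2)%R)
    by (apply Rmult_le_pos; [exact HM|apply pow2_ge_0]).
  split; apply quad_is_derive with (M := (M * Cmod w ^ 2)%R) (delta := mkposreal _ Hd);
    try exact HM'; intros s Hs; eapply Rle_trans; try apply (HQ s Hs).
  - eapply Rle_trans; [|apply abs_Re_le]. right; f_equal.
    unfold Cminus; csplit; ring.
  - eapply Rle_trans; [|apply abs_Im_le]. right; f_equal.
    unfold Cminus; csplit; ring.
Qed.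

(** * Coefficients, differential equation and recurrences of the modified Bessel functions *)

Definition bcoef (n k : nat) : R := (/ (2 ^ (2 * k + n) * INR (fact k * fact (k + n))))%R.
Definition bexp (n k : nat) : nat := (2 * k + n)%nat.

Lemma fact_INR_pos (k : nat) : (0 < INR (fact k))%R.
Proof. apply lt_0_INR, lt_O_fact. Qed.

Lemma bcoef_pos (n k : nat) : (0 < bcoef n k)%R.
Proof.
  apply Rinv_0_lt_compat, Rmult_lt_0_compat; [apply pow_lt; lra|].
  rewrite mult_INR; apply Rmult_lt_0_compat; apply fact_INR_pos.
Qed.

(** The power of 2 and the factorial of k + n are at least 1, so [bcoef n k] is at most 1 / k! and
    rho^n exp(rho^2) is a majorant. *)
Lemma entire_bessel (n : nat) : entire (bcoef n) (bexp n).
Proof.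
  split; [intros k; left; apply bcoef_pos|].
  intros rho Hrho.
  assert (Hexp : ex_series (fun k => / INR (fact k) * (rho ^ 2) ^ k)%R).
  { exists (exp (rho ^ 2)). exact (proj1 (is_pseries_R _ _ _) (is_exp_Reals (rho ^ 2))). }
  apply (ex_series_le (V := R_CompleteNormedModule) _
    (fun k => rho ^ n * (/ INR (fact k) * (rho ^ 2) ^ k))%R);
    [|exact (ex_series_scal (V := R_NormedModule) (rho ^ n)%R _ Hexp)].
  intros k; unfold norm; simpl; unfold abs; simpl.
  assert (Hp : forall m, (0 < rho ^ m)%R) by (intros m; apply pow_lt; lra).
  rewrite Rabs_pos_eq
    by (apply Rmult_le_pos; left; [apply bcoef_pos|apply Hp]).
  unfold bexp; rewrite pow_add, pow_mult.
  replace (rho * (rho * 1))%R with (rho ^ 2)%R by ring.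
  replace (rho ^ n * (/ INR (fact k) * (rho ^ 2) ^ k))%R
    with (/ INR (fact k) * ((rho ^ 2) ^ k * rho ^ n))%R by ring.
  apply Rmult_le_compat_r.
  { apply Rmult_le_pos; [apply pow_le, pow_le; lra|left; apply Hp]. }
  unfold bcoef; apply Rinv_le_contravar; [apply fact_INR_pos|].
  rewrite mult_INR.
  assert (H1 : (1 <= 2 ^ (2 * k + n))%R) by (apply pow_R1_Rle; lra).
  assert (H2 : (1 <= INR (fact (k + n)))%R)
    by (replace 1%R with (INR 1) by reflexivity; apply le_INR, lt_O_fact).
  generalize (fact_INR_pos k); intros H3.
  rewrite <- (Rmult_1_l (INR (fact k))) at 1.
  apply Rmult_le_compat; [lra|lra|exact H1|].
  rewrite <- (Rmult_1_r (INR (fact k))) at 1.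
  apply Rmult_le_compat_l; lra.
Qed.

Lemma BesselI_gsum (m : Z) (z : C) :
  BesselI m z = gsum (bcoef (Z.abs_nat m)) (bexp (Z.abs_nat m)) z.
Proof.
  unfold BesselI, gsum; f_equal; apply functional_extensionality; intros k.
  unfold bcoef, bexp; set (N := (2 * k + Z.abs_nat m)%nat).
  assert (Hf : INR (fact k * fact (k + Z.abs_nat m)) <> 0%R)
    by (rewrite mult_INR; apply Rmult_integral_contrapositive_currified;
        apply INR_fact_neq_0).
  assert (H2 : (2 ^ N <> 0)%R) by (apply pow_nonzero; lra).
  assert (Hp : forall p, RtoC (/ 2) ^ p = RtoC (/ 2 ^ p)%R).
  { intros p; now rewrite <- pow_inv, RtoC_pow. }
  unfold Cdiv; rewrite Cpow_mult_l, <- RtoC_inv, Hp by lra.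
  rewrite <- RtoC_inv by exact Hf.
  rewrite Rinv_mult, RtoC_mult; ring.
Qed.

(** The termwise first and second derivatives; [BesselI'_DI] identifies the first with the complex
    derivative. *)
Definition DI (m : Z) (z : C) : C :=
  gsum (dcoef (bcoef (Z.abs_nat m)) (bexp (Z.abs_nat m))) (dexp (bexp (Z.abs_nat m))) z.
Definition DDI (m : Z) (z : C) : C :=
  gsum (dcoef (dcoef (bcoef (Z.abs_nat m)) (bexp (Z.abs_nat m)))
          (dexp (bexp (Z.abs_nat m)))) (dexp (dexp (bexp (Z.abs_nat m)))) z.

Lemma BesselI_quad (m : Z) (z : C) : quad_diff (BesselI m) z (DI m z).
Proof.
  destruct (gsum_quad _ _ z (entire_bessel (Z.abs_nat m))) as (M & HM & H).
  exists M; split; [exact HM|]; intros h Hh; rewrite !BesselI_gsum; now apply H.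
Qed.

Lemma BesselI'_DI (m : Z) (z : C) : BesselI' m z = DI m z.
Proof. apply quad_C_derive, BesselI_quad. Qed.

Lemma BesselI_ray (m : Z) (w : C) (r : R) :
  is_Cderive (fun s => BesselI m (w * s)) r (w * DI m (w * r)).
Proof. apply quad_Cderive_ray, BesselI_quad. Qed.

Lemma DI_ray (m : Z) (w : C) (r : R) :
  is_Cderive (fun s => DI m (w * s)) r (w * DDI m (w * r)).
Proof.
  exact (quad_Cderive_ray _ _ _ _
           (gsum_quad _ _ _ (entire_dcoef _ _ (entire_bessel (Z.abs_nat m))))).
Qed.

Lemma Cseries_inj (a : nat -> C) (l m : C) : is_Cseries a l -> is_Cseries a m -> l = m.
Proof. intros H K; now rewrite <- (Cseries_unique _ _ H), (Cseries_unique _ _ K). Qed.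

Lemma RtoC_neq_0 (x : R) : x <> 0%R -> RtoC x <> 0.
Proof. intros H E; apply H, RtoC_inj, E. Qed.

(** Multiplying by z restores the exponent lowered by differentiation, so the Euler operator acts as
    multiplication by [e k] and series can be compared term by term. At exponent 0 both sides
    vanish. *)
Lemma euler_gsum (c : nat -> R) (e : nat -> nat) (z : C) : entire c e ->
  is_Cseries (fun k => (c k * INR (e k))%R * z ^ e k) (z * gsum (dcoef c e) (dexp e) z).
Proof.
  intros H; eapply Cseries_ext; [|apply Cseries_scal, gsum_correct, entire_dcoef, H].
  intros k; unfold dcoef, dexp; cbv beta.
  destruct (e k) as [|p]; simpl Nat.pred; [|simpl Cpow; ring].
  simpl INR; rewrite Rmult_0_r; ring.
Qed.

Lemma euler2_gsum (c : nat -> R) (e : nat -> nat) (z : C) : entire c e ->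
  is_Cseries (fun k => (c k * (INR (e k) * (INR (e k) - 1)))%R * z ^ e k)
    (z ^ 2 * gsum (dcoef (dcoef c e) (dexp e)) (dexp (dexp e)) z).
Proof.
  intros H; eapply Cseries_ext;
    [|apply Cseries_scal, gsum_correct, entire_dcoef, entire_dcoef, H].
  intros k; unfold dcoef, dexp; cbv beta.
  destruct (e k) as [|[|p]]; simpl Nat.pred.
  - simpl INR; rewrite ?Rmult_0_l, ?Rmult_0_r, ?Rmult_0_l; ring.
  - simpl INR; rewrite Rminus_diag, ?Rmult_0_r; ring.
  - rewrite !S_INR; simpl Cpow.
    replace (INR p + 1 + 1 - 1)%R with (INR p + 1)%R by ring.
    rewrite !RtoC_mult; ring.
Qed.

(** The Bessel equation on coefficients: 4 (k+1) (k+n+1) = (2k+2+n)^2 - n^2. *)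
Lemma bcoef_S (n k : nat) :
  (bcoef n k = bcoef n (S k) * (4 * (INR k + 1) * (INR k + INR n + 1)))%R.
Proof.
  unfold bcoef.
  replace (2 * S k + n)%nat with (S (S (2 * k + n))) by lia.
  replace (S k + n)%nat with (S (k + n)) by lia.
  change (fact (S k)) with (S k * fact k)%nat.
  change (fact (S (k + n))) with (S (k + n) * fact (k + n))%nat.
  rewrite !mult_INR, !S_INR, plus_INR.
  change (2 ^ S (S (2 * k + n)))%R with (2 * (2 * 2 ^ (2 * k + n)))%R.
  generalize (pos_INR k) (pos_INR n) (INR_fact_neq_0 k) (INR_fact_neq_0 (k + n)); intros.
  assert ((2 ^ (2 * k + n) <> 0)%R) by (apply pow_nonzero; lra).
  field; repeat split; try assumption; lra.
Qed.

(** Coefficient form of z I_(n+1) = z I_n' - n I_n. *)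
Lemma bcoef_up (n k : nat) : (bcoef (S n) k = bcoef n (S k) * (2 * (INR k + 1)))%R.
Proof.
  unfold bcoef.
  replace (2 * S k + n)%nat with (S (S (2 * k + n))) by lia.
  replace (2 * k + S n)%nat with (S (2 * k + n)) by lia.
  replace (S k + n)%nat with (k + S n)%nat by lia.
  change (fact (S k)) with (S k * fact k)%nat.
  rewrite !mult_INR, !S_INR.
  change (2 ^ S (S (2 * k + n)))%R with (2 * (2 * 2 ^ (2 * k + n)))%R.
  change (2 ^ S (2 * k + n))%R with (2 * 2 ^ (2 * k + n))%R.
  generalize (pos_INR k) (pos_INR n) (INR_fact_neq_0 k) (INR_fact_neq_0 (k + S n)); intros.
  assert ((2 ^ (2 * k + n) <> 0)%R) by (apply pow_nonzero; lra).
  field; repeat split; try assumption; lra.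
Qed.

(** Coefficient form of z I_n = z I_(n+1)' + (n+1) I_(n+1). *)
Lemma bcoef_down (n k : nat) :
  (bcoef n k = bcoef (S n) k * (2 * (INR k + INR n + 1)))%R.
Proof.
  unfold bcoef.
  replace (2 * k + S n)%nat with (S (2 * k + n)) by lia.
  replace (k + S n)%nat with (S (k + n)) by lia.
  change (fact (S (k + n))) with (S (k + n) * fact (k + n))%nat.
  rewrite !mult_INR, !S_INR, plus_INR.
  change (2 ^ S (2 * k + n))%R with (2 * 2 ^ (2 * k + n))%R.
  generalize (pos_INR k) (pos_INR n) (INR_fact_neq_0 k) (INR_fact_neq_0 (k + n)); intros.
  assert ((2 ^ (2 * k + n) <> 0)%R) by (apply pow_nonzero; lra).
  field; repeat split; try assumption; lra.
Qed.

Lemma INR_bexp (n k : nat) : INR (bexp n k) = (2 * INR k + INR n)%R.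
Proof. unfold bexp; rewrite plus_INR, mult_INR; simpl; ring. Qed.

Lemma abs_nat_sqr (m : Z) : (INR (Z.abs_nat m) ^ 2 = IZR m ^ 2)%R.
Proof. rewrite INR_IZR_INZ, Zabs2Nat.id_abs, abs_IZR; apply pow2_abs. Qed.

(** With m^2 I_m moved to the left, the term of index k carries the factor (2k+n)^2 - n^2, where n =
    |m|. It vanishes at k = 0, and after a shift of the index [bcoef_S] matches the rest with z^2
    I_m. *)
Lemma bessel_ode (m : Z) (z : C) :
  z ^ 2 * DDI m z + z * DI m z = (z ^ 2 + RtoC (IZR m ^ 2)) * BesselI m z.
Proof.
  rewrite BesselI_gsum, <- abs_nat_sqr; unfold DI, DDI; set (n := Z.abs_nat m).
  assert (HE := entire_bessel n).
  assert (H := Cseries_plus _ _ _ _ (Cseries_plus _ _ _ _ (euler2_gsum _ _ z HE)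
     (euler_gsum _ _ z HE))
     (Cseries_scal (- RtoC (INR n ^ 2)) _ _ (gsum_correct _ _ z HE))).
  assert (K := Cseries_scal (z ^ 2) _ _ (gsum_correct _ _ z HE)).
  set (a := fun k => (bcoef n k * (INR (bexp n k) ^ 2 - INR n ^ 2))%R * z ^ bexp n k).
  apply (Cseries_ext _ a) in H.
  2:{ intros k; unfold a; simpl pow; pushC; ring. }
  apply (Cseries_ext _ (fun k => a (S k))) in K.
  - apply Cseries_shift in K. assert (E := Cseries_inj _ _ _ H K).
    assert (E0 : a 0%nat = 0).
    { unfold a; rewrite INR_bexp; simpl INR.
      replace (_ * _)%R with 0%R by ring. ring. }
    rewrite E0 in E.
    transitivity (RtoC (INR n ^ 2) * gsum (bcoef n) (bexp n) z
      + (0 + z ^ 2 * gsum (bcoef n) (bexp n) z)); [rewrite <- E; ring|ring].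
  - intros k; unfold a; rewrite INR_bexp, S_INR, (bcoef_S n k).
    unfold bexp; replace (2 * S k + n)%nat with (S (S (2 * k + n))) by lia.
    replace ((2 * (INR k + 1) + INR n) ^ 2 - INR n ^ 2)%R
      with (4 * (INR k + 1) * (INR k + INR n + 1))%R by ring.
    simpl Cpow; ring.
Qed.

Lemma gsum_bessel_up (n : nat) (z : C) :
  z * gsum (bcoef (S n)) (bexp (S n)) z
  = z * gsum (dcoef (bcoef n) (bexp n)) (dexp (bexp n)) z
    - INR n * gsum (bcoef n) (bexp n) z.
Proof.
  assert (HE := entire_bessel n).
  assert (H := Cseries_plus _ _ _ _ (euler_gsum _ _ z HE)
     (Cseries_scal (- RtoC (INR n)) _ _ (gsum_correct _ _ z HE))).
  assert (K := Cseries_scal z _ _ (gsum_correct _ _ z (entire_bessel (S n)))).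
  set (a := fun k => (bcoef n k * (INR (bexp n k) - INR n))%R * z ^ bexp n k).
  apply (Cseries_ext _ a) in H.
  2:{ intros k; unfold a; pushC; ring. }
  apply (Cseries_ext _ (fun k => a (S k))) in K.
  - apply Cseries_shift in K. assert (E := Cseries_inj _ _ _ H K).
    assert (E0 : a 0%nat = 0).
    { unfold a; rewrite INR_bexp; simpl INR.
      replace (_ * _)%R with 0%R by ring. ring. }
    rewrite E0, Cplus_0_l in E; rewrite <- E; ring.
  - intros k; unfold a; rewrite INR_bexp, S_INR, bcoef_up.
    unfold bexp; replace (2 * S k + n)%nat with (S (S (2 * k + n))) by lia.
    replace (2 * k + S n)%nat with (S (2 * k + n)) by lia.
    replace (2 * (INR k + 1) + INR n - INR n)%R with (2 * (INR k + 1))%R by ring.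
    simpl Cpow; ring.
Qed.

Lemma gsum_bessel_down (n : nat) (z : C) :
  z * gsum (bcoef n) (bexp n) z
  = z * gsum (dcoef (bcoef (S n)) (bexp (S n))) (dexp (bexp (S n))) z
    + INR (S n) * gsum (bcoef (S n)) (bexp (S n)) z.
Proof.
  assert (HE := entire_bessel (S n)).
  assert (H := Cseries_plus _ _ _ _ (euler_gsum _ _ z HE)
     (Cseries_scal (RtoC (INR (S n))) _ _ (gsum_correct _ _ z HE))).
  assert (K := Cseries_scal z _ _ (gsum_correct _ _ z (entire_bessel n))).
  eapply Cseries_inj; [exact K|]. eapply Cseries_ext; [|exact H].
  intros k; cbv beta; rewrite (bcoef_down n k), INR_bexp, S_INR.
  unfold bexp; replace (2 * k + S n)%nat with (S (2 * k + n)) by lia.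
  pushC; simpl Cpow; ring.
Qed.

(** Product of z I_(m-1) = z I_m' + m I_m and z I_(m+1) = z I_m' - m I_m, a difference of squares.
    Orders enter through their absolute value, so m = 0 has I_1 on both sides and a negative m
    exchanges the two factors. *)
Lemma bessel_neighbours (m : Z) (z : C) :
  z ^ 2 * (BesselI (m - 1) z * BesselI (m + 1) z)
  = z ^ 2 * DI m z ^ 2 - RtoC (IZR m ^ 2) * BesselI m z ^ 2.
Proof.
  rewrite !BesselI_gsum, <- abs_nat_sqr; unfold DI.
  assert (Hcase : (Z.abs_nat m = 0 /\ Z.abs_nat (m - 1) = 1 /\ Z.abs_nat (m + 1) = 1 \/
    exists n, Z.abs_nat m = S n /\
      (Z.abs_nat (m - 1) = n /\ Z.abs_nat (m + 1) = S (S n) \/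
       Z.abs_nat (m + 1) = n /\ Z.abs_nat (m - 1) = S (S n)))%nat).
  { destruct (Z.abs_nat m) as [|n] eqn:E; [left; lia|right; exists n; lia]. }
  destruct Hcase as [(-> & -> & ->) | (n & -> & [[-> ->] | [-> ->]])].
  - transitivity ((z * gsum (bcoef 1) (bexp 1) z) ^ 2); [ring|].
    rewrite gsum_bessel_up; simpl INR.
    replace (0 ^ 2)%R with 0%R by ring. ring.
  - transitivity ((z * gsum (bcoef n) (bexp n) z)
      * (z * gsum (bcoef (S (S n))) (bexp (S (S n))) z)); [ring|].
    rewrite gsum_bessel_up, gsum_bessel_down.
    rewrite RtoC_pow; ring.
  - transitivity ((z * gsum (bcoef n) (bexp n) z)
      * (z * gsum (bcoef (S (S n))) (bexp (S (S n))) z)); [ring|].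
    rewrite gsum_bessel_up, gsum_bessel_down.
    rewrite RtoC_pow; ring.
Qed.

Lemma BesselI_conj (m : Z) (z : C) : Cconj (BesselI m z) = BesselI m (Cconj z).
Proof.
  rewrite !BesselI_gsum; eapply Cseries_inj;
    [apply Cseries_conj, gsum_correct, entire_bessel|].
  eapply Cseries_ext; [|apply gsum_correct, entire_bessel].
  intros k; cbv beta; now rewrite Cconj_mult, Cconj_pow, Cconj_RtoC.
Qed.

Lemma DI_conj (m : Z) (z : C) : Cconj (DI m z) = DI m (Cconj z).
Proof.
  assert (HE := entire_dcoef _ _ (entire_bessel (Z.abs_nat m))).
  refine (Cseries_inj _ _ _ (Cseries_conj _ _ (gsum_correct _ _ z HE)) _).
  refine (Cseries_ext _ _ _ _ (gsum_correct _ _ (Cconj z) HE)).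
  intros k; cbv beta; now rewrite Cconj_mult, Cconj_pow, Cconj_RtoC.
Qed.

(** * Behaviour at the origin and absence of zeros when [Re (w ^ 2)] is positive *)

Lemma BesselI_at_0 (m : Z) : m <> 0%Z -> BesselI m 0 = 0.
Proof.
  intros Hm; rewrite BesselI_gsum.
  eapply Cseries_inj; [apply gsum_correct, entire_bessel|].
  eapply Cseries_ext; [|replace (RtoC 0) with (0 * BesselI m 0) by ring; rewrite BesselI_gsum;
    apply Cseries_scal, gsum_correct, entire_bessel].
  intros k; cbv beta; unfold bexp.
  replace (2 * k + Z.abs_nat m)%nat with (S (2 * k + Z.abs_nat m - 1)) by lia.
  simpl Cpow; ring.
Qed.

(** The leading term dominates: I_m(z) = z^n (b_0 + z^2 T) with |T| at most twice the sum of the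
    remaining coefficients. This provides the strict inequality that starts the energy argument. *)
Lemma BesselI_nonzero_near_0 (m : Z) :
  exists eps : R, (0 < eps)%R /\
    forall z : C, z <> 0 -> (Cmod z < eps)%R -> BesselI m z <> 0.
Proof.
  set (n := Z.abs_nat m).
  assert (HS : ex_series (fun k => bcoef n (S k))).
  { apply (ex_series_incr_1 (bcoef n)).
    eapply ex_series_ext; [|apply (proj2 (entire_bessel n) 1%R); lra].
    intros k; simpl; rewrite pow1; ring. }
  set (s := Series (fun k => bcoef n (S k))).
  assert (Hs : (0 <= s)%R).
  { replace 0%R with (Series (fun k => 0 * bcoef n (S k))%R)
      by (rewrite Series_scal_l; ring).
    apply Series_le; [|exact HS]. intros k; generalize (bcoef_pos n (S k)); lra. }
  assert (Hb := bcoef_pos n 0).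
  (* For |z| < 1 and below this radius, |z^2 T| <= 2 s |z| < b_0; the [+ 1] covers s = 0. *)
  assert (Heps : (0 < bcoef n 0 / (2 * s + 1))%R) by (apply Rdiv_lt_0_compat; lra).
  exists (Rmin 1 (bcoef n 0 / (2 * s + 1))); split; [apply Rmin_pos; lra|].
  intros z Hz Hlt.
  assert (H1 : (Cmod z < 1)%R)
    by (generalize (Rmin_l 1 (bcoef n 0 / (2 * s + 1))); lra).
  assert (H2 : (Cmod z < bcoef n 0 / (2 * s + 1))%R)
    by (generalize (Rmin_r 1 (bcoef n 0 / (2 * s + 1))); lra).
  assert (H0 := Cmod_ge_0 z).
  destruct (Cseries_dominated (fun k => bcoef n (S k) * z ^ (2 * k))
    (fun k => bcoef n (S k))) as (T & HT & HTb).
  { intros k; rewrite Cmod_mult, Cmod_R, Cmod_pow, Rabs_pos_eq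
      by (left; apply bcoef_pos).
    rewrite <- (Rmult_1_r (bcoef n (S k))) at 2.
    apply Rmult_le_compat_l; [left; apply bcoef_pos|].
    rewrite <- (pow1 (2 * k)); apply pow_incr; lra. }
  { exact HS. }
  assert (E : BesselI m z = z ^ n * (bcoef n 0 + z ^ 2 * T)).
  { rewrite BesselI_gsum; fold n.
    eapply Cseries_inj; [apply gsum_correct, entire_bessel|].
    replace (z ^ n * (bcoef n 0 + z ^ 2 * T))
      with (bcoef n 0 * z ^ bexp n 0 + z ^ (2 + n) * T)
      by (unfold bexp; simpl Nat.mul; simpl Nat.add; simpl Cpow; ring).
    apply (Cseries_shift (fun k => bcoef n k * z ^ bexp n k)).
    eapply Cseries_ext; [|apply Cseries_scal, HT].
    intros k; cbv beta; unfold bexp.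
    replace (2 * S k + n)%nat with (2 + n + 2 * k)%nat by lia.
    rewrite (Cpow_add_r z (2 + n) (2 * k)); ring. }
  rewrite E; apply Cmult_neq_0; [now apply Cpow_nz|].
  intros Hc.
  assert (Hc' : Cmod (z ^ 2 * T) = bcoef n 0).
  { replace (z ^ 2 * T) with (- RtoC (bcoef n 0)).
    - rewrite Cmod_opp, Cmod_R; apply Rabs_pos_eq; lra.
    - transitivity (bcoef n 0 + z ^ 2 * T - bcoef n 0); [rewrite Hc; ring|ring]. }
  rewrite Cmod_mult, Cmod_pow in Hc'; fold s in HTb.
  assert (H3 : ((2 * s + 1) * Cmod z < bcoef n 0)%R).
  { replace (bcoef n 0) with ((2 * s + 1) * (bcoef n 0 / (2 * s + 1)))%R by (field; lra).
    apply Rmult_lt_compat_l; lra. }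
  assert (Cmod z ^ 2 * Cmod T <= Cmod z * (2 * s))%R.
  { apply Rmult_le_compat; [apply pow2_ge_0|apply Cmod_ge_0| |exact HTb]. nra. }
  nra.
Qed.

(* Multiplying the equation by [r conj y] gives [h' = r |y'|^2 + (m^2/r + Re(w^2) r) |y|^2]
   for [h r = Re (r y' conj y)], so [h] increases from [h 0 = 0]. *)
Lemma bessel_energy_pos (m : Z) (w : C) (a : R) :
  (0 < Re (w ^ 2))%R -> (0 < a)%R ->
  (0 < Re (a * (w * DI m (w * a)) * Cconj (BesselI m (w * a))))%R.
Proof.
  intros Hw Ha.
  set (y := fun r : R => BesselI m (w * r)).
  set (y1 := fun r : R => w * DI m (w * r)).
  set (h := fun r : R => Re (r * y1 r * Cconj (y r))).
  set (dh := fun r : R => Re ((y1 r + r * (w * (w * DDI m (w * r)))) * Cconj (y r)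
                + r * y1 r * Cconj (y1 r))).
  assert (Hd : forall r, is_derive h r (dh r)).
  { intros r.
    assert (K : is_Cderive (fun r : R => r * y1 r * Cconj (y r)) r
      ((1 * y1 r + r * (w * (w * DDI m (w * r)))) * Cconj (y r)
       + r * y1 r * Cconj (y1 r))).
    { apply Cderive_mult; [apply Cderive_mult; [apply Cderive_RtoC|]|].
      - apply Cderive_scal, DI_ray.
      - exact (Cderive_conj _ _ _ (BesselI_ray m w r)). }
    rewrite Cmult_1_l in K. exact (proj1 K). }
  assert (Hdh : forall r, (0 < r)%R ->
    (r * dh r >= r ^ 2 * Re (w ^ 2) * Cmod (y r) ^ 2)%R).
  { intros r Hr.
    assert (E : r * ((y1 r + r * (w * (w * DDI m (w * r)))) * Cconj (y r)
                + r * y1 r * Cconj (y1 r))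
       = (RtoC r ^ 2 * w ^ 2 + RtoC (IZR m ^ 2)) * (y r * Cconj (y r))
         + RtoC r ^ 2 * (y1 r * Cconj (y1 r))).
    { assert (O := bessel_ode m (w * r)); fold (y r) in O.
      transitivity (((w * r) ^ 2 * DDI m (w * r) + w * r * DI m (w * r)) * Cconj (y r)
        + RtoC r ^ 2 * (y1 r * Cconj (y1 r))); [unfold y1; ring|].
      rewrite O; ring. }
    rewrite !Cmult_conj in E.
    apply (f_equal Re) in E.
    replace (r * dh r)%R with (Re (r * ((y1 r + r * (w * (w * DDI m (w * r)))) * Cconj (y r)
                + r * y1 r * Cconj (y1 r)))) by (unfold dh; rewrite (Re_mult r); csplit; ring).
    rewrite E.
    rewrite <- RtoC_pow.
    rewrite Re_plus, !(Re_mult _ (RtoC _)), Re_plus, (Re_mult (RtoC (r ^ 2))).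
    rewrite !Re_RtoC, !Im_RtoC.
    generalize (pow2_ge_0 (IZR m)) (pow2_ge_0 (Cmod (y r))) (pow2_ge_0 (Cmod (y1 r)))
      (pow2_ge_0 r); intros P1 P2 P3 P4.
    generalize (Rmult_le_pos _ _ P1 P2) (Rmult_le_pos _ _ P4 P3); lra. }
  assert (H0 : h 0%R = 0%R) by (unfold h; csplit; ring).
  assert (Hdl : forall r, derivable_pt_lim h r (dh r))
    by (intros r; apply is_derive_Reals, Hd).
  assert (Hwnz : w <> 0).
  { intros ->; revert Hw; replace (0 ^ 2) with (RtoC 0) by ring.
    rewrite Re_RtoC; lra. }
  assert (Hwm : (0 < Cmod w)%R) by now apply Cmod_gt_0.
  destruct (BesselI_nonzero_near_0 m) as (eps & Heps & Hnz).
  (* Inside (0, b) the function y has no zero, so the mean value theorem on [0, b] yields a strictly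
     positive increment; on [b, a] monotonicity is enough. *)
  set (b := Rmin a (eps / Cmod w)).
  assert (Hb : (0 < b)%R) by (apply Rmin_pos; [exact Ha|now apply Rdiv_lt_0_compat]).
  assert (Hba : (b <= a)%R) by apply Rmin_l.
  assert (Hbe : (b <= eps / Cmod w)%R) by apply Rmin_r.
  destruct (MVT_cor2 h dh 0 b Hb (fun c _ => Hdl c)) as (c & Hc & Hc0 & Hcb).
  assert (Hyc : y c <> 0).
  { apply Hnz.
    - apply Cmult_neq_0; [exact Hwnz|apply RtoC_neq_0; lra].
    - rewrite Cmod_mult, Cmod_R, Rabs_pos_eq by lra.
      apply Rlt_le_trans with (Cmod w * (eps / Cmod w))%R;
        [apply Rmult_lt_compat_l; lra|right; field; lra]. }
  assert (Hhb : (0 < h b)%R).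
  { specialize (Hdh c Hc0).
    assert (P : (0 < c ^ 2 * Re (w ^ 2) * Cmod (y c) ^ 2)%R).
    { apply Cmod_gt_0 in Hyc.
      repeat apply Rmult_lt_0_compat; try apply pow_lt; lra. }
    assert (0 < dh c)%R.
    { apply Rmult_lt_reg_l with c; lra. }
    rewrite H0 in Hc.
    assert (0 < dh c * (b - 0))%R by (apply Rmult_lt_0_compat; lra). lra. }
  change (0 < h a)%R.
  destruct (Rle_lt_or_eq_dec b a Hba) as [Hlt|Heq]; [|rewrite <- Heq; exact Hhb].
  destruct (MVT_cor2 h dh b a Hlt (fun c _ => Hdl c)) as (x & Hx & Hx0 & _).
  assert (Hxp : (0 < x)%R) by lra.
  specialize (Hdh x Hxp).
  assert (0 <= dh x)%R.
  { apply Rmult_le_reg_l with x; [exact Hxp|].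
    assert (0 <= x ^ 2 * Re (w ^ 2) * Cmod (y x) ^ 2)%R.
    { apply Rmult_le_pos; [apply Rmult_le_pos; [apply pow2_ge_0|lra]|apply pow2_ge_0]. }
    lra. }
  assert (0 <= dh x * (a - b))%R by (apply Rmult_le_pos; lra). lra.
Qed.

Lemma BesselI_nonzero (m : Z) (w : C) (a : R) :
  (0 < Re (w ^ 2))%R -> (0 < a)%R -> BesselI m (w * a) <> 0.
Proof.
  intros Hw Ha E; generalize (bessel_energy_pos m w a Hw Ha); rewrite E.
  csplit; lra.
Qed.

(** A zero would turn the positive quantity of [bessel_energy_pos] into -(a K / D) |I_m(w a)|^2,
    which is negative. *)
Lemma robin_denominator_nonzero (m : Z) (w : C) (a D K : R) :
  (0 < Re (w ^ 2))%R -> (0 < a)%R -> (0 < D)%R -> (0 < K)%R ->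
  D * w * BesselI' m (w * a) + K * BesselI m (w * a) <> 0.
Proof.
  intros Hw Ha HD HK E; rewrite BesselI'_DI in E.
  assert (H := bessel_energy_pos m w a Hw Ha).
  assert (H' : (0 < Cmod (BesselI m (w * a)))%R)
    by now apply Cmod_gt_0, BesselI_nonzero.
  assert (E' : a * (w * DI m (w * a)) * Cconj (BesselI m (w * a))
    = RtoC (- (a * K / D * Cmod (BesselI m (w * a)) ^ 2))).
  { transitivity (a / D * (D * w * DI m (w * a) + K * BesselI m (w * a))
        * Cconj (BesselI m (w * a))
      - a * K / D * (BesselI m (w * a) * Cconj (BesselI m (w * a)))).
    - field; apply RtoC_neq_0; lra.
    - rewrite E, Cmult_conj, RtoC_opp, RtoC_mult, RtoC_div, RtoC_mult by lra. ring. }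
  rewrite E', Re_RtoC in H.
  assert (0 < a * K / D * Cmod (BesselI m (w * a)) ^ 2)%R; [|lra].
  apply Rmult_lt_0_compat; [|now apply pow_lt].
  apply Rdiv_lt_0_compat; [now apply Rmult_lt_0_compat|exact HD].
Qed.

(* [F r = (w^2 r^2 y^2 - r^2 y'^2 + m^2 y^2) / 2] is a primitive of [w^2 r y^2]. *)
Lemma lommel_integral (m : Z) (w : C) (a : R) : w <> 0 -> (0 < a)%R ->
  is_CInt (fun r => r * BesselI m (w * r) ^ 2) 0 a
    (a ^ 2 / 2 * (BesselI m (w * a) ^ 2 - BesselI (m - 1) (w * a) * BesselI (m + 1) (w * a))).
Proof.
  intros Hw Ha.
  set (y := fun r : R => BesselI m (w * r)).
  set (d := fun r : R => w * r * DI m (w * r)).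
  assert (Hy : forall r, is_Cderive y r (w * DI m (w * r)))
    by (intros r; exact (BesselI_ray m w r)).
  assert (Hd : forall r, is_Cderive d r (w * DI m (w * r) + w * r * (w * DDI m (w * r)))).
  { intros r; unfold d; eapply Cderive_eq.
    - apply Cderive_mult; [apply Cderive_scal, Cderive_RtoC|apply DI_ray].
    - cbv beta; ring. }
  set (F := fun r : R => / 2 * / w ^ 2 * ((w ^ 2 * (r * r) + RtoC (IZR m ^ 2)) * (y r * y r)
              - d r * d r)).
  assert (HF : forall r, is_Cderive F r (r * y r ^ 2)).
  { intros r; unfold F; eapply Cderive_eq.
    - apply Cderive_scal, Cderive_minus; [|apply Cderive_mult; apply Hd].
      apply Cderive_mult; [|apply Cderive_mult; apply Hy].
      apply Cderive_plus; [|apply Cderive_const].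
      apply Cderive_scal, Cderive_mult; apply Cderive_RtoC.
    - cbv beta.
      assert (O := bessel_ode m (w * r)); fold (y r) in O.
      assert (E : d r * (w * DI m (w * r) + w * r * (w * DDI m (w * r)))
        = w * DI m (w * r) * ((w * r) ^ 2 + RtoC (IZR m ^ 2)) * y r).
      { transitivity (w * DI m (w * r)
          * ((w * r) ^ 2 * DDI m (w * r) + w * r * DI m (w * r))); [unfold d; ring|].
        rewrite O; ring. }
      transitivity (/ 2 * / w ^ 2 * (w ^ 2 * (2 * r) * (y r * y r)
         + 2 * (w ^ 2 * (r * r) + RtoC (IZR m ^ 2)) * y r * (w * DI m (w * r))
         - 2 * (d r * (w * DI m (w * r) + w * r * (w * DDI m (w * r)))))); [ring|].
      rewrite E. field; exact Hw. }
  eapply is_CInt_eq; [apply (is_CInt_derive F)|].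
  - intros r _; apply HF.
  - intros r _; apply (Ccontinuous_ext (fun s : R => s * (y s * y s))).
    + intros s; unfold y; ring.
    + apply Ccontinuous_mult; [eapply Cderive_continuous, Cderive_RtoC|].
      apply Ccontinuous_mult; eapply Cderive_continuous, Hy.
  - unfold F.
    (* The primitive vanishes at the lower end: for m = 0 through the factors r and m^2, otherwise
       because I_m(0) = 0. *)
    assert (E0 : (w ^ 2 * (0%R * 0%R) + RtoC (IZR m ^ 2)) * (y 0%R * y 0%R) - d 0%R * d 0%R = 0).
    { destruct (Z.eq_dec m 0) as [->|Hm].
      - unfold d; replace (0 ^ 2)%R with 0%R by ring. ring.
      - assert (Hy0 : y 0%R = 0) by (unfold y; rewrite Cmult_0_r; now apply BesselI_at_0).
        rewrite Hy0; unfold d; ring. }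
    rewrite E0.
    assert (N := bessel_neighbours m (w * a)); fold (y a) in N |- *.
    transitivity (/ 2 * / w ^ 2 * ((w * a) ^ 2 * (y a) ^ 2
       - (w * a) ^ 2 * (BesselI (m - 1) (w * a) * BesselI (m + 1) (w * a)))).
    + rewrite N; unfold d; ring.
    + field; exact Hw.
Qed.

(** Half-angle formulas: the two real roots have squares differing by Re z and a product equal to
    |Im z| / 2, and the sign factor restores Im z. *)
Lemma Csqrt_sqr (z : C) : Csqrt z ^ 2 = z.
Proof.
  assert (H1 := abs_Re_le z); assert (H2 := Rle_abs (Re z)).
  assert (H3 := Rle_abs (- Re z)); rewrite Rabs_Ropp in H3.
  assert (S1 : (sqrt ((Cmod z + Re z) / 2) ^ 2 = (Cmod z + Re z) / 2)%R)
    by (apply pow2_sqrt; lra).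
  assert (S2 : (sqrt ((Cmod z - Re z) / 2) ^ 2 = (Cmod z - Re z) / 2)%R)
    by (apply pow2_sqrt; lra).
  assert (S3 : (2 * (sqrt ((Cmod z + Re z) / 2) * sqrt ((Cmod z - Re z) / 2)) = Rabs (Im z))%R).
  { rewrite <- sqrt_mult by lra.
    replace ((Cmod z + Re z) / 2 * ((Cmod z - Re z) / 2))%R with ((Im z / 2) ^ 2)%R.
    - rewrite <- Rsqr_pow2, sqrt_Rsqr_abs. unfold Rdiv.
      rewrite Rabs_mult, (Rabs_pos_eq (/ 2)) by lra. lra.
    - generalize (Cmod_sqr z); intros; nra. }
  unfold Csqrt; destruct (Rle_dec 0 (Im z)) as [Hp|Hp].
  - rewrite Rabs_pos_eq in S3 by exact Hp.
    apply C_ext; unfold Cpow, Cmult, Re, Im, RtoC in *; simpl in *; nra.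
  - rewrite Rabs_left in S3 by lra.
    apply C_ext; unfold Cpow, Cmult, Re, Im, RtoC in *; simpl in *; nra.
Qed.

(** Positive real part keeps z off the branch cut: a negative real z equals its conjugate while its
    root is not real. On the positive axis the imaginary part of the root is 0, which hides the sign
    convention. *)
Lemma Csqrt_conj (z : C) : (0 < Re z)%R -> Csqrt (Cconj z) = Cconj (Csqrt z).
Proof.
  intros Hz; unfold Csqrt; rewrite Re_conj, Im_conj.
  replace (Cmod (Cconj z)) with (Cmod z)
    by (unfold Cmod; f_equal; unfold Cconj; simpl; ring).
  destruct (Req_dec (Im z) 0) as [E|E].
  - assert (E2 : (Cmod z - Re z = 0)%R).
    { assert (Hm := Cmod_sqr z); rewrite E in Hm.
      generalize (Cmod_ge_0 z); intros; nra. }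
    rewrite E2; unfold Rdiv at 2 4; rewrite Rmult_0_l, sqrt_0.
    unfold Cconj; simpl; f_equal; ring.
  - destruct (Rle_dec 0 (- Im z)), (Rle_dec 0 (Im z)); try lra;
      unfold Cconj; simpl; f_equal; ring.
Qed.

(** * Radial profiles and Green's identity on one Fourier mode *)

(* [Am] and [Bm] are instances of [robin], the radial factors of [Ext] of [profile]. *)
Definition robin (K D : R) (w : C) (m : Z) (a : R) : C :=
  K * BesselI m (w * a) / (D * w * BesselI' m (w * a) + K * BesselI m (w * a)).
Definition profile (K D : R) (w : C) (m : Z) (a r : R) : C :=
  robin K D w m a * (BesselI m (w * r) / BesselI m (w * a)).
Definition profile1 (K D : R) (w : C) (m : Z) (a r : R) : C :=
  robin K D w m a / BesselI m (w * a) * (w * DI m (w * r)).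
Definition profile2 (K D : R) (w : C) (m : Z) (a r : R) : C :=
  robin K D w m a / BesselI m (w * a) * (w * (w * DDI m (w * r))).

Lemma profile_derive (K D : R) (w : C) (m : Z) (a r : R) :
  is_Cderive (profile K D w m a) r (profile1 K D w m a r).
Proof.
  apply (Cderive_ext (fun s => robin K D w m a / BesselI m (w * a) * BesselI m (w * s))).
  - intros s; unfold profile, Cdiv; ring.
  - apply Cderive_scal, BesselI_ray.
Qed.

Lemma profile1_derive (K D : R) (w : C) (m : Z) (a r : R) :
  is_Cderive (profile1 K D w m a) r (profile2 K D w m a r).
Proof. apply Cderive_scal, Cderive_scal, DI_ray. Qed.

Lemma profile_ode (K D : R) (w : C) (m : Z) (a r : R) :
  r ^ 2 * profile2 K D w m a r + r * profile1 K D w m a r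
  = (w ^ 2 * r ^ 2 + RtoC (IZR m ^ 2)) * profile K D w m a r.
Proof.
  unfold profile, profile1, profile2; unfold Cdiv.
  transitivity (robin K D w m a * / BesselI m (w * a)
    * ((w * r) ^ 2 * DDI m (w * r) + w * r * DI m (w * r))); [ring|].
  rewrite bessel_ode; ring.
Qed.

Lemma profile_boundary (K D : R) (w : C) (m : Z) (a : R) :
  (0 < Re (w ^ 2))%R -> (0 < a)%R ->
  profile K D w m a a = robin K D w m a.
Proof.
  intros Hw Ha; unfold profile; field; now apply BesselI_nonzero.
Qed.

(** This is the Robin condition D p' = K (1 - p) with surface value 1; it is how the factors K_u p_m
    and K_v q_m of [Phi] arise. *)
Lemma profile1_boundary (K D : R) (w : C) (m : Z) (a : R) :
  (0 < Re (w ^ 2))%R -> (0 < a)%R -> (0 < D)%R -> (0 < K)%R ->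
  D * profile1 K D w m a a = K * (1 - robin K D w m a).
Proof.
  intros Hw Ha HD HK; unfold profile1, robin.
  assert (H1 := BesselI_nonzero m w a Hw Ha).
  assert (H2 := robin_denominator_nonzero m w a D K Hw Ha HD HK).
  rewrite <- BesselI'_DI; field; now split.
Qed.

(* The derivative is prescribed on the open interval only, so its continuity up
   to the end points is not needed. *)
Lemma is_RInt_derive_open (E dE h : R -> R) (a : R) : (0 < a)%R ->
  (forall x, (0 <= x <= a)%R -> is_derive E x (dE x)) ->
  (forall x, (0 < x < a)%R -> dE x = h x) ->
  (forall x, continuous h x) ->
  is_RInt h 0 a (E a - E 0)%R.
Proof.
  intros Ha HE Heq Hc.
  assert (HI : forall x, is_RInt h 0 x (RInt h 0 x)).
  { intros x; apply (RInt_correct (V := R_CompleteNormedModule)).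
    apply (ex_RInt_continuous (V := R_CompleteNormedModule)); auto. }
  assert (HG : forall x, is_derive (fun y => RInt h 0 y) x (h x)).
  { intros x; apply (is_derive_RInt (V := R_NormedModule) h _ 0 x); [|apply Hc].
    exists (mkposreal 1 Rlt_0_1); intros y _; apply HI. }
  (* The difference of [E] and the integral of [h] is continuous on the closed interval with zero
     derivative inside, hence constant. *)
  destruct (MVT_gen (fun x => E x - RInt h 0 x)%R 0 a (fun _ => 0%R)) as (c & _ & Hcc).
  - intros x Hx; rewrite Rmin_left, Rmax_right in Hx by lra.
    assert (K := is_derive_minus (V := R_NormedModule) _ _ _ _ _
      (HE x (conj (Rlt_le _ _ (proj1 Hx)) (Rlt_le _ _ (proj2 Hx)))) (HG x)).
    rewrite (Heq x Hx) in K;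
    match type of K with is_derive _ _ ?v => replace v with 0%R in K end; [exact K|].
    unfold minus, plus, opp; simpl; ring.
  - intros x Hx; rewrite Rmin_left, Rmax_right in Hx by lra.
    apply continuity_pt_filterlim, (ex_derive_continuous (fun x => E x - RInt h 0 x)%R).
    exists (minus (dE x) (h x)).
    apply (is_derive_minus (V := R_NormedModule)); [apply HE; lra|apply HG].
  - assert (H0 : RInt h 0 0 = 0%R) by exact (RInt_point (V := R_CompleteNormedModule) 0 h).
    replace (E a - E 0)%R with (RInt h 0 a) by lra. apply HI.
Qed.

Lemma is_CInt_derive_open (E dE h : R -> C) (a : R) : (0 < a)%R ->
  (forall x, (0 <= x <= a)%R -> is_Cderive E x (dE x)) ->
  (forall x, (0 < x < a)%R -> dE x = h x) ->
  (forall x, Ccontinuous h x) ->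
  is_CInt h 0 a (E a - E 0%R).
Proof.
  intros Ha HE Heq Hc; split.
  - apply (is_RInt_derive_open (fun x => Re (E x)) (fun x => Re (dE x))); auto.
    + intros x Hx; apply HE, Hx.
    + intros x Hx; now rewrite Heq.
    + intros x; exact (proj1 (Hc x)).
  - apply (is_RInt_derive_open (fun x => Im (E x)) (fun x => Im (dE x))); auto.
    + intros x Hx; apply HE, Hx.
    + intros x Hx; now rewrite Heq.
    + intros x; exact (proj2 (Hc x)).
Qed.

(** The derivative of r (U' p - U p') is r (p L U - U L p) for the radial Laplacian L of mode m, and
    the zeroth-order terms cancel because p solves the homogeneous equation with the same [lam]. The
    factor r removes the boundary term at 0. *)
Lemma green_mode (K D sig a : R) (lam w : C) (m : Z) (U U1 U2 G : R -> C) :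
  (0 < a)%R -> (0 < D)%R -> w ^ 2 = (lam + sig) / D ->
  (forall r, (0 <= r <= a)%R -> is_Cderive U r (U1 r) /\ is_Cderive U1 r (U2 r)) ->
  (forall r, Ccontinuous G r) ->
  (forall r, (0 < r < a)%R ->
     lam * U r - (D * (U2 r + U1 r / r - RtoC (IZR m ^ 2) / r ^ 2 * U r) - sig * U r) = G r) ->
  is_CInt (fun r => profile K D w m a r * G r * r) 0 a
    (- (a * (D * U1 a * profile K D w m a a - U a * (D * profile1 K D w m a a)))).
Proof.
  intros Ha HD Hw HU HG Heq.
  set (p := profile K D w m a). set (p1 := profile1 K D w m a).
  set (p2 := profile2 K D w m a).
  assert (HDn : RtoC D <> 0) by (apply RtoC_neq_0; lra).
  set (E := fun r : R => - RtoC D * (r * (U1 r * p r - U r * p1 r))).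
  set (dE := fun r : R => - RtoC D * (1 * (U1 r * p r - U r * p1 r)
     + r * ((U2 r * p r + U1 r * p1 r) - (U1 r * p1 r + U r * p2 r)))).
  eapply is_CInt_eq; [apply (is_CInt_derive_open E dE _ a Ha)|].
  - intros r Hr; destruct (HU r Hr) as [H1 H2].
    apply Cderive_scal, Cderive_mult; [apply Cderive_RtoC|].
    apply Cderive_minus; apply Cderive_mult; try assumption.
    + apply profile_derive.
    + apply profile1_derive.
  - intros r Hr.
    assert (Hrn : RtoC r <> 0) by (apply RtoC_neq_0; lra).
    assert (O := profile_ode K D w m a r); fold p p1 p2 in O; rewrite Hw in O.
    rewrite <- (Heq r Hr).
    assert (O' : p2 r = ((lam + sig) / D + RtoC (IZR m ^ 2) / r ^ 2) * p r - p1 r / r).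
    { transitivity ((r ^ 2 * p2 r + r * p1 r) / r ^ 2 - p1 r / r); [field; exact Hrn|].
      rewrite O; field; now split. }
    unfold dE; rewrite O'; field; now split.
  - intros r; apply Ccontinuous_mult; [apply Ccontinuous_mult|].
    + eapply Cderive_continuous, profile_derive.
    + apply HG.
    + eapply Cderive_continuous, Cderive_RtoC.
  - unfold E; ring.
Qed.

(** * Fourier coefficients in the angle *)

(** There is no division by 2 pi, hence the factors [RtoC (2 * PI)] in what follows. [hat] has a
    value for any h; [is_hat] also asserts that the integral exists. *)
Definition hat (m : Z) (h : R -> C) : C :=
  CInt (fun t => h t * cis (- IZR m * t)) 0 (2 * PI).
Definition is_hat (m : Z) (h : R -> C) (l : C) : Prop :=
  is_CInt (fun t => h t * cis (- IZR m * t)) 0 (2 * PI) l.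

Lemma Ccontinuous_cis (k t : R) : Ccontinuous (fun s => cis (k * s)) t.
Proof. eapply Cderive_continuous, Cderive_cis. Qed.

Lemma hat_correct (m : Z) (h : R -> C) :
  (forall t, Ccontinuous h t) -> is_hat m h (hat m h).
Proof.
  intros Hc; apply is_CInt_continuous; intros t _.
  apply Ccontinuous_mult; [apply Hc|apply Ccontinuous_cis].
Qed.

Lemma is_hat_plus (m : Z) (h k : R -> C) (l l' : C) :
  is_hat m h l -> is_hat m k l' -> is_hat m (fun t => h t + k t) (l + l').
Proof.
  intros H H'; eapply is_CInt_ext; [|exact (is_CInt_plus _ _ _ _ _ _ H H')].
  intros t _; cbv beta; ring.
Qed.

Lemma is_hat_scal (m : Z) (c : C) (h : R -> C) (l : C) :
  is_hat m h l -> is_hat m (fun t => c * h t) (c * l).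
Proof.
  intros H; eapply is_CInt_ext; [|exact (is_CInt_scal c _ _ _ _ H)].
  intros t _; cbv beta; ring.
Qed.

Lemma is_hat_ext (m : Z) (h k : R -> C) (l : C) :
  (forall t, h t = k t) -> is_hat m h l -> is_hat m k l.
Proof. intros E; apply is_CInt_ext; intros t _; cbv beta; now rewrite E. Qed.

Lemma is_hat_inj (m : Z) (h : R -> C) (l l' : C) : is_hat m h l -> is_hat m h l' -> l = l'.
Proof. apply is_CInt_inj. Qed.

Lemma cis_plus (x y : R) : cis (x + y) = cis x * cis y.
Proof.
  unfold cis; rewrite cos_plus, sin_plus.
  apply C_ext; unfold Cmult, Re, Im; simpl; ring.
Qed.

Lemma cis_0 : cis 0 = 1.
Proof. unfold cis; now rewrite cos_0, sin_0. Qed.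

Lemma cis_conj (x : R) : Cconj (cis x) = cis (- x).
Proof. unfold cis, Cconj; simpl; now rewrite cos_neg, sin_neg. Qed.

Lemma cis_2PI (m : Z) : cis (IZR m * (2 * PI)) = 1.
Proof.
  assert (H : forall k : nat, cis (INR k * (2 * PI)) = 1).
  { intros k; replace (INR k * (2 * PI))%R with (0 + 2 * INR k * PI)%R by ring.
    unfold cis; now rewrite cos_period, sin_period, cos_0, sin_0. }
  destruct (Z_le_gt_dec 0 m) as [Hm|Hm].
  - rewrite <- (Z2Nat.id m Hm), <- INR_IZR_INZ; apply H.
  - replace m with (- Z.of_nat (Z.to_nat (- m)))%Z by lia.
    rewrite opp_IZR, <- INR_IZR_INZ.
    replace (- INR (Z.to_nat (- m)) * (2 * PI))%R
      with (- (INR (Z.to_nat (- m)) * (2 * PI)))%R by ring.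
    rewrite <- cis_conj, H; apply Cconj_RtoC.
Qed.

Lemma is_hat_cis (m k : Z) :
  is_hat m (fun t => cis (IZR k * t)) (if Z.eq_dec k m then RtoC (2 * PI) else 0).
Proof.
  destruct (Z.eq_dec k m) as [->|Hkm].
  - apply (is_CInt_ext (fun _ => RtoC 1)).
    + intros t _; rewrite <- cis_plus, <- cis_0; f_equal; ring.
    + eapply is_CInt_eq; [apply is_CInt_const|].
      replace (2 * PI - 0)%R with (2 * PI)%R by ring; ring.
  - assert (Hj : RtoC (IZR (k - m)) <> 0) by (apply RtoC_neq_0, not_0_IZR; lia).
    apply (is_CInt_ext (fun t => cis (IZR (k - m) * t))).
    { intros t _; rewrite <- cis_plus; f_equal; rewrite minus_IZR; ring. }
    eapply is_CInt_eq;
      [apply (is_CInt_derive (fun t => / (Ci * IZR (k - m)) * cis (IZR (k - m) * t)))|].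
    + intros t _; eapply Cderive_eq; [apply Cderive_scal, Cderive_cis|].
      field; split; [exact Hj|apply Ci_nz].
    + intros t _; apply Ccontinuous_cis.
    + rewrite cis_2PI, Rmult_0_r, cis_0; ring.
Qed.

(** Two integrations by parts at once: h' e - i k h e, with e = e^(i k t) and k = -m, has derivative
    (h'' + m^2 h) e and equal values at both ends by periodicity. *)
Lemma hat_second_derivative (m : Z) (h h1 h2 : R -> C) (l : C) :
  (forall t, is_Cderive h t (h1 t)) -> (forall t, is_Cderive h1 t (h2 t)) ->
  (forall t, Ccontinuous h2 t) -> (forall t, h (t + 2 * PI)%R = h t) ->
  is_hat m h l -> is_hat m h2 (- RtoC (IZR m ^ 2) * l).
Proof.
  intros H1 H2 Hc Hper Hl.
  (* Periodicity is assumed for [h]; differentiating its translate passes it on to the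
     derivative. *)
  assert (Hp1 : h1 (2 * PI)%R = h1 0%R).
  { rewrite <- (Cderive_unique _ _ _ (H1 0%R)).
    symmetry; apply Cderive_unique.
    apply (Cderive_ext (fun t => h (t + 2 * PI)%R)); [exact Hper|].
    assert (S : is_derive (fun t : R => (t + 2 * PI)%R) 0%R 1%R)
      by (auto_derive; [exact I|ring]).
    assert (K := H1 (2 * PI)%R); rewrite <- (Rplus_0_l (2 * PI)) in K at 1.
    destruct K as [K1 K2]; split.
    - generalize (is_derive_comp _ _ _ _ _ K1 S); unfold scal; simpl; unfold mult; simpl.
      now rewrite Rmult_1_l.
    - generalize (is_derive_comp _ _ _ _ _ K2 S); unfold scal; simpl; unfold mult; simpl.
      now rewrite Rmult_1_l. }
  set (k := (- IZR m)%R).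
  assert (HI : is_CInt (fun t => h2 t * cis (k * t) + RtoC (IZR m ^ 2) * (h t * cis (k * t)))
    0 (2 * PI) 0).
  { eapply is_CInt_eq; [apply (is_CInt_derive
       (fun t => h1 t * cis (k * t) - Ci * k * (h t * cis (k * t))))|].
    - intros t _; eapply Cderive_eq.
      + apply Cderive_minus; [apply Cderive_mult; [apply H2|apply Cderive_cis]|].
        apply Cderive_scal, Cderive_mult; [apply H1|apply Cderive_cis].
      + cbv beta; replace (RtoC (IZR m ^ 2)) with (- (Ci * Ci) * RtoC k ^ 2).
        * ring.
        * rewrite <- RtoC_pow; unfold k.
          replace ((- IZR m) ^ 2)%R with (IZR m ^ 2)%R by ring.
          apply C_ext; unfold Ci, Cmult, Copp, RtoC, Re, Im; simpl; ring.
    - intros t _; apply Ccontinuous_plus.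
      + apply Ccontinuous_mult; [apply Hc|apply Ccontinuous_cis].
      + apply Ccontinuous_mult; [apply Ccontinuous_const|].
        apply Ccontinuous_mult; [|apply Ccontinuous_cis].
        eapply Cderive_continuous, H1.
    - cbv beta. rewrite Hp1, Rmult_0_r.
      replace (k * (2 * PI))%R with (IZR (- m) * (2 * PI))%R
        by (unfold k; rewrite opp_IZR; ring).
      rewrite cis_2PI, cis_0.
      replace (2 * PI)%R with (0 + 2 * PI)%R by ring; rewrite Hper; ring. }
  eapply is_CInt_ext; [|eapply is_CInt_eq;
    [apply (is_CInt_plus _ _ _ _ _ _ HI (is_CInt_scal (- RtoC (IZR m ^ 2)) _ _ _ _ Hl))|ring]].
  intros t _; cbv beta; fold k; ring.
Qed.

Lemma continuity_2d_snd (h : R -> R -> R) (x y : R) :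
  continuity_2d_pt h x y -> continuous (fun t => h x t) y.
Proof.
  intros H; apply continuity_2d_pt_filterlim in H.
  apply (continuous_comp_2 (fun _ : R => x) (fun t : R => t) h y).
  - apply continuous_const.
  - apply continuous_id.
  - exact H.
Qed.

(** Differentiation under the integral sign; [ex_diff_n] of order 1 supplies the joint continuity of
    the derivative that allows it. *)
Lemma is_derive_RInt_kernel (h : R -> R -> R) (kappa : R -> R) (a b x delta : R) :
  (0 < delta)%R -> (forall t, continuous kappa t) ->
  (forall r t, (Rabs (r - x) < delta)%R -> ex_diff_n h 1 r t) ->
  is_derive (fun r => RInt (fun t => h r t * kappa t)%R a b) x
    (RInt (fun t => Derive (fun r => h r t) x * kappa t)%R a b).
Proof.
  intros Hd Hk Hh.
  assert (E : (fun t => Derive (fun r => h r t) x * kappa t)%R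
    = (fun t => Derive (fun r => h r t * kappa t)%R x))
    by (apply functional_extensionality; intros t; now rewrite Derive_scal_l).
  rewrite E.
  apply (is_derive_RInt_param (fun r t => (h r t * kappa t)%R)).
  - exists (mkposreal _ Hd); intros r Hr t _.
    destruct (Hh r t Hr) as (_ & Hx & _).
    auto_derive; exact Hx.
  - intros t _.
    apply (continuity_2d_pt_ext (fun u v => (Derive (fun z => h z v) u * kappa v)%R)).
    + intros u v; now rewrite Derive_scal_l.
    + apply continuity_2d_pt_mult.
      * destruct (Hh x t) as (_ & _ & _ & Hx & _);
          [rewrite Rminus_diag, Rabs_R0; exact Hd|apply Hx].
      * apply (continuity_1d_2d_pt_comp kappa (fun _ v => v)).
        -- apply continuity_pt_filterlim, Hk.
        -- apply continuity_2d_pt_id2.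
  - exists (mkposreal _ Hd); intros r Hr.
    apply (ex_RInt_continuous (V := R_CompleteNormedModule)); intros t _.
    apply (continuous_mult (fun t => h r t) kappa); [|apply Hk].
    apply continuity_2d_snd; apply (Hh r t Hr).
Qed.

(** Differentiation under the integral is done for real integrands, so the product with [cis] is
    expanded into four real integrals against cosine and sine. The expansion uses continuity of
    [U r], known for r near x, hence the local comparison. *)
Lemma hat_derive (m : Z) (U : R -> R -> C) (x delta : R) : (0 < delta)%R ->
  (forall r t, (Rabs (r - x) < delta)%R ->
     ex_diff_n (fun x y => Re (U x y)) 1 r t /\ ex_diff_n (fun x y => Im (U x y)) 1 r t) ->
  is_Cderive (fun r => hat m (U r)) x (hat m (d_r U x)).
Proof.
  intros Hd H.
  set (k := (- IZR m)%R).
  set (c := fun t => cos (k * t)). set (s := fun t => sin (k * t)).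
  assert (Hc : forall t, continuous c t) by (intros t; apply (Ccontinuous_cis k t)).
  assert (Hs : forall t, continuous s t) by (intros t; apply (Ccontinuous_cis k t)).
  set (J := fun (h : R -> R) (kap : R -> R) => RInt (fun t => h t * kap t)%R 0 (2 * PI)).
  assert (HJ : forall (V : R -> C), (forall t, Ccontinuous V t) ->
    hat m V = (J (fun t => Re (V t)) c - J (fun t => Im (V t)) s,
               J (fun t => Re (V t)) s + J (fun t => Im (V t)) c)%R).
  { intros V HV; apply CInt_unique.
    assert (EX : forall h kap, (forall t, continuous h t) -> (forall t, continuous kap t) ->
      is_RInt (fun t => h t * kap t)%R 0 (2 * PI) (J h kap)).
    { intros h kap Hh Hkap; apply (RInt_correct (V := R_CompleteNormedModule)).
      apply (ex_RInt_continuous (V := R_CompleteNormedModule)); intros t _.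
      now apply (continuous_mult h kap). }
    assert (RV : forall t, continuous (fun t => Re (V t)) t) by (intros t; exact (proj1 (HV t))).
    assert (IV : forall t, continuous (fun t => Im (V t)) t) by (intros t; exact (proj2 (HV t))).
    split.
    - exact (is_RInt_minus _ _ _ _ _ _ (EX _ _ RV Hc) (EX _ _ IV Hs)).
    - exact (is_RInt_plus _ _ _ _ _ _ (EX _ _ RV Hs) (EX _ _ IV Hc)). }
  assert (Hcont : forall r, (Rabs (r - x) < delta)%R -> forall t, Ccontinuous (U r) t).
  { intros r Hr t; destruct (H r t Hr) as [[A _] [B _]].
    split; [exact (continuity_2d_snd _ _ _ A)|exact (continuity_2d_snd _ _ _ B)]. }
  assert (Hx0 : (Rabs (x - x) < delta)%R) by (rewrite Rminus_diag, Rabs_R0; exact Hd).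
  assert (Hdcont : forall t, Ccontinuous (d_r U x) t).
  { intros t; destruct (H x t Hx0) as [(_ & _ & _ & A & _) (_ & _ & _ & B & _)].
    split; [exact (continuity_2d_snd _ _ _ (proj1 A))
           |exact (continuity_2d_snd _ _ _ (proj1 B))]. }
  assert (DRe : forall kap, (forall t, continuous kap t) ->
    is_derive (fun r => J (fun t => Re (U r t)) kap) x (J (fun t => Re (d_r U x t)) kap)).
  { intros kap Hkap; apply (is_derive_RInt_kernel (fun r t => Re (U r t)) kap 0 (2 * PI) x delta
      Hd Hkap).
    intros r t Hr; apply (H r t Hr). }
  assert (DIm : forall kap, (forall t, continuous kap t) ->
    is_derive (fun r => J (fun t => Im (U r t)) kap) x (J (fun t => Im (d_r U x t)) kap)).
  { intros kap Hkap; apply (is_derive_RInt_kernel (fun r t => Im (U r t)) kap 0 (2 * PI) x delta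
      Hd Hkap).
    intros r t Hr; apply (H r t Hr). }
  rewrite (HJ _ Hdcont); split.
  - apply (is_derive_ext_loc (fun r => J (fun t => Re (U r t)) c - J (fun t => Im (U r t)) s)%R).
    + exists (mkposreal _ Hd); intros r Hr; now rewrite (HJ _ (Hcont r Hr)).
    + apply (is_derive_minus (V := R_NormedModule)); [now apply DRe|now apply DIm].
  - apply (is_derive_ext_loc (fun r => J (fun t => Re (U r t)) s + J (fun t => Im (U r t)) c)%R).
    + exists (mkposreal _ Hd); intros r Hr; now rewrite (HJ _ (Hcont r Hr)).
    + apply (is_derive_plus (V := R_NormedModule)); [now apply DRe|now apply DIm].
Qed.

(** [C2_disc] reaches beyond both ends, so the coefficients have two-sided derivatives at r = 0 and
    r = a as well; the claim on the Laplacian, with its divisions by r, leaves out r = 0. *)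
Lemma laplacian_hat (m : Z) (a : R) (U : R -> R -> C) : C2_disc a U ->
  (forall r, (0 <= r <= a)%R ->
     is_hat m (U r) (hat m (U r)) /\ is_hat m (d_r U r) (hat m (d_r U r)) /\
     is_Cderive (fun r => hat m (U r)) r (hat m (d_r U r)) /\
     is_Cderive (fun r => hat m (d_r U r)) r (hat m (d_r (d_r U) r))) /\
  (forall r, (0 < r <= a)%R ->
     is_hat m (laplacian U r)
       (hat m (d_r (d_r U) r) + hat m (d_r U r) / r
        - RtoC (IZR m ^ 2) / r ^ 2 * hat m (U r))).
Proof.
  intros (Hper & _ & delta & Hd & HC).
  assert (HC0 : forall r t, (- delta < r < a + delta)%R -> Ccontinuous (U r) t).
  { intros r t Hr; destruct (HC r t Hr) as [[A _] [B _]].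
    split; [exact (continuity_2d_snd _ _ _ A)|exact (continuity_2d_snd _ _ _ B)]. }
  assert (HC1 : forall r t, (- delta < r < a + delta)%R -> Ccontinuous (d_r U r) t).
  { intros r t Hr; destruct (HC r t Hr) as [(_ & _ & _ & [A _] & _) (_ & _ & _ & [B _] & _)].
    split; [exact (continuity_2d_snd _ _ _ A)|exact (continuity_2d_snd _ _ _ B)]. }
  assert (HC2 : forall r t, (- delta < r < a + delta)%R -> Ccontinuous (d_r (d_r U) r) t).
  { intros r t Hr; destruct (HC r t Hr)
      as [(_ & _ & _ & (_ & _ & _ & [A _] & _) & _) (_ & _ & _ & (_ & _ & _ & [B _] & _) & _)].
    split; [exact (continuity_2d_snd _ _ _ A)|exact (continuity_2d_snd _ _ _ B)]. }
  assert (HT2 : forall r t, (- delta < r < a + delta)%R -> Ccontinuous (d_t (d_t U) r) t).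
  { intros r t Hr; destruct (HC r t Hr)
      as [(_ & _ & _ & _ & (_ & _ & _ & _ & [A _])) (_ & _ & _ & _ & (_ & _ & _ & _ & [B _]))].
    split; [exact (continuity_2d_snd _ _ _ A)|exact (continuity_2d_snd _ _ _ B)]. }
  split.
  - intros r Hr.
    assert (Hin : forall s, (Rabs (s - r) < delta)%R -> (- delta < s < a + delta)%R)
      by (intros s Hs; apply Rabs_def2 in Hs; lra).
    assert (Hrr : (- delta < r < a + delta)%R) by lra.
    split; [|split; [|split]].
    + apply (hat_correct m (U r)); intros t; now apply HC0.
    + apply (hat_correct m (d_r U r)); intros t; now apply HC1.
    + apply (hat_derive m U r delta Hd).
      intros s t Hs; destruct (HC s t (Hin s Hs)) as [A B].
      assert (H12 : (1 <= 2)%nat) by lia.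
      split; [exact (ex_diff_n_m 2 1 H12 _ _ _ A)|exact (ex_diff_n_m 2 1 H12 _ _ _ B)].
    + apply (hat_derive m (d_r U) r delta Hd).
      intros s t Hs; destruct (HC s t (Hin s Hs)) as [A B].
      split; [exact (proj1 (proj2 (proj2 (proj2 A))))|exact (proj1 (proj2 (proj2 (proj2 B))))].
  - intros r Hr.
    assert (Hrr : (- delta < r < a + delta)%R) by lra.
    assert (Hrn : RtoC r <> 0) by (apply RtoC_neq_0; lra).
    assert (H0 : is_hat m (U r) (hat m (U r)))
      by (apply hat_correct; intros t; now apply HC0).
    assert (H1 : is_hat m (d_r U r) (hat m (d_r U r)))
      by (apply hat_correct; intros t; now apply HC1).
    assert (H2 : is_hat m (d_r (d_r U) r) (hat m (d_r (d_r U) r)))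
      by (apply hat_correct; intros t; now apply HC2).
    assert (HT : is_hat m (d_t (d_t U) r) (- RtoC (IZR m ^ 2) * hat m (U r))).
    { apply (hat_second_derivative m (U r) (d_t U r)); try assumption.
      - intros t; destruct (HC r t Hrr) as [(_ & _ & A & _) (_ & _ & B & _)].
        split; apply Derive_correct; [exact A|exact B].
      - intros t; destruct (HC r t Hrr)
          as [(_ & _ & _ & _ & (_ & _ & A & _)) (_ & _ & _ & _ & (_ & _ & B & _))].
        split; apply Derive_correct; [exact A|exact B].
      - intros t; now apply HT2.
      - intros t; apply Hper; lra. }
    replace (hat m (d_r (d_r U) r) + hat m (d_r U r) / r
        - RtoC (IZR m ^ 2) / r ^ 2 * hat m (U r))
      with (hat m (d_r (d_r U) r) + / r * hat m (d_r U r)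
        + / r ^ 2 * (- RtoC (IZR m ^ 2) * hat m (U r))) by (field; exact Hrn).
    apply (is_hat_ext m (fun t => d_r (d_r U) r t + / r * d_r U r t + / r ^ 2 * d_t (d_t U) r t)).
    { intros t; unfold laplacian, Cdiv; ring. }
    apply is_hat_plus; [apply is_hat_plus; [exact H2|]|]; now apply is_hat_scal.
Qed.

Lemma circle_hat (m : Z) (u : R -> C) : C2_circle u ->
  is_hat m u (hat m u) /\ is_hat m (d_tt u) (- RtoC (IZR m ^ 2) * hat m u).
Proof.
  intros (Hper & HR & HI).
  assert (H1 : forall t, is_Cderive u t (CDerive u t)).
  { intros t; split; apply Derive_correct.
    - exact (proj1 (HR t) 1%nat ltac:(lia)).
    - exact (proj1 (HI t) 1%nat ltac:(lia)). }
  assert (H2 : forall t, is_Cderive (CDerive u) t (d_tt u t)).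
  { intros t; split; apply Derive_correct.
    - exact (proj1 (HR t) 2%nat ltac:(lia)).
    - exact (proj1 (HI t) 2%nat ltac:(lia)). }
  assert (Hu : is_hat m u (hat m u))
    by (apply hat_correct; intros t; eapply Cderive_continuous, H1).
  split; [exact Hu|].
  apply (hat_second_derivative m u (CDerive u)); try assumption.
  intros t; split; [exact (proj2 (HR t))|exact (proj2 (HI t))].
Qed.

(** * Fields supported on one Fourier mode *)

(** The radial factors are recorded because the inner product is computed from them, and their
    continuity because it makes the integrals exist. *)
Definition modal (k : Z) (W : field) (a b : R -> C) (x y : C) : Prop :=
  (forall r t, bU W r t = a r * cis (IZR k * t) /\ bV W r t = b r * cis (IZR k * t)) /\
  (forall t, su W t = x * cis (IZR k * t) /\ sv W t = y * cis (IZR k * t)) /\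
  (forall r, Ccontinuous a r /\ Ccontinuous b r).
Definition on_mode (k : Z) (W : field) : Prop := exists a b x y, modal k W a b x y.
(** [Bop] and [Cop] read the surface rows alone. [W0000] is radial in the bulk only for r up to the
    radius, so this weaker notion is the one that fits it. *)
Definition surface_on_mode (k : Z) (W : field) : Prop :=
  exists x y, forall t, su W t = x * cis (IZR k * t) /\ sv W t = y * cis (IZR k * t).

Lemma on_mode_surface (k : Z) (W : field) : on_mode k W -> surface_on_mode k W.
Proof. intros (a & b & x & y & _ & H & _); now exists x, y. Qed.

Lemma modal_plus (k : Z) (W Z : field) (a b a' b' : R -> C) (x y x' y' : C) :
  modal k W a b x y -> modal k Z a' b' x' y' ->
  modal k (W + Z)%fld (fun r => a r + a' r) (fun r => b r + b' r) (x + x') (y + y').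
Proof.
  intros (H1 & H2 & H3) (K1 & K2 & K3); repeat split; simpl.
  - rewrite (proj1 (H1 r t)), (proj1 (K1 r t)); ring.
  - rewrite (proj2 (H1 r t)), (proj2 (K1 r t)); ring.
  - rewrite (proj1 (H2 t)), (proj1 (K2 t)); ring.
  - rewrite (proj2 (H2 t)), (proj2 (K2 t)); ring.
  - apply (proj1 (Ccontinuous_plus _ _ _ (proj1 (H3 r)) (proj1 (K3 r)))).
  - apply (proj2 (Ccontinuous_plus _ _ _ (proj1 (H3 r)) (proj1 (K3 r)))).
  - apply (proj1 (Ccontinuous_plus _ _ _ (proj2 (H3 r)) (proj2 (K3 r)))).
  - apply (proj2 (Ccontinuous_plus _ _ _ (proj2 (H3 r)) (proj2 (K3 r)))).
Qed.

Lemma modal_scal (k : Z) (c : C) (W : field) (a b : R -> C) (x y : C) :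
  modal k W a b x y ->
  modal k (c *: W)%fld (fun r => c * a r) (fun r => c * b r) (c * x) (c * y).
Proof.
  intros (H1 & H2 & H3); split; [|split]; simpl.
  - intros r t; rewrite (proj1 (H1 r t)), (proj2 (H1 r t)); split; ring.
  - intros t; rewrite (proj1 (H2 t)), (proj2 (H2 t)); split; ring.
  - intros r; destruct (H3 r); split; now apply Ccontinuous_mult; [apply Ccontinuous_const|].
Qed.

Lemma on_mode_plus (k : Z) (W Z : field) :
  on_mode k W -> on_mode k Z -> on_mode k (W + Z)%fld.
Proof.
  intros (a & b & x & y & H) (a' & b' & x' & y' & H').
  do 4 eexists; exact (modal_plus _ _ _ _ _ _ _ _ _ _ _ H H').
Qed.

Lemma on_mode_scal (k : Z) (c : C) (W : field) : on_mode k W -> on_mode k (c *: W)%fld.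
Proof. intros (a & b & x & y & H); do 4 eexists; exact (modal_scal _ _ _ _ _ _ _ H). Qed.

Lemma on_mode_opp (k : Z) (W : field) : on_mode k W -> on_mode k (- W)%fld.
Proof. apply on_mode_scal. Qed.

Lemma cis_mode_conj (k : Z) (t : R) : Cconj (cis (IZR k * t)) = cis (IZR (- k) * t).
Proof. rewrite cis_conj, opp_IZR; f_equal; ring. Qed.

Lemma cis_mode_mult (j k : Z) (t : R) :
  cis (IZR (j + k) * t) = cis (IZR j * t) * cis (IZR k * t).
Proof. rewrite plus_IZR, <- cis_plus; f_equal; ring. Qed.

Lemma surface_on_mode_conj (k : Z) (W : field) :
  surface_on_mode k W -> surface_on_mode (- k) (fconj W).
Proof.
  intros (x & y & H); exists (Cconj x), (Cconj y); intros t; simpl.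
  rewrite (proj1 (H t)), (proj2 (H t)), !Cconj_mult, cis_mode_conj; now split.
Qed.

Lemma on_mode_conj (k : Z) (W : field) : on_mode k W -> on_mode (- k) (fconj W).
Proof.
  intros (a & b & x & y & H1 & H2 & H3).
  exists (fun r => Cconj (a r)), (fun r => Cconj (b r)), (Cconj x), (Cconj y).
  split; [|split]; simpl.
  - intros r t; rewrite (proj1 (H1 r t)), (proj2 (H1 r t)), !Cconj_mult, cis_mode_conj.
    now split.
  - intros t; rewrite (proj1 (H2 t)), (proj2 (H2 t)), !Cconj_mult, cis_mode_conj; now split.
  - intros r; destruct (H3 r); split; now apply Ccontinuous_conj.
Qed.

(** Bilinearity pulls the two exponentials out and their frequencies add. The target index is a
    separate variable with an equation, so that integer arithmetic can settle it. *)
Lemma on_mode_Bop (P : model) (j k l : Z) (W Z : field) : l = (j + k)%Z ->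
  surface_on_mode j W -> surface_on_mode k Z -> on_mode l (Bop P W Z).
Proof.
  intros -> (x & y & H) (x' & y' & H').
  exists (fun _ => RtoC 0), (fun _ => RtoC 0),
    (fst (B2 P (x, y) (x', y'))), (snd (B2 P (x, y) (x', y'))).
  split; [|split]; simpl.
  - intros r t; split; ring.
  - intros t; rewrite (proj1 (H t)), (proj2 (H t)), (proj1 (H' t)), (proj2 (H' t)),
      cis_mode_mult; unfold D2; simpl; split; unfold Cdiv; ring.
  - intros r; split; apply Ccontinuous_const.
Qed.

Lemma on_mode_Cop (P : model) (i j k l : Z) (V W Z : field) : l = (i + j + k)%Z ->
  surface_on_mode i V -> surface_on_mode j W -> surface_on_mode k Z ->
  on_mode l (Cop P V W Z).
Proof.
  intros -> (x & y & H) (x' & y' & H') (x'' & y'' & H'').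
  exists (fun _ => RtoC 0), (fun _ => RtoC 0),
    (fst (C3 P (x, y) (x', y') (x'', y''))), (snd (C3 P (x, y) (x', y') (x'', y''))).
  split; [|split]; simpl.
  - intros r t; split; ring.
  - intros t; rewrite (proj1 (H t)), (proj2 (H t)), (proj1 (H' t)), (proj2 (H' t)),
      (proj1 (H'' t)), (proj2 (H'' t)), !cis_mode_mult; unfold D3; simpl; split;
      unfold Cdiv; ring.
  - intros r; split; apply Ccontinuous_const.
Qed.

Lemma profile_continuous (K D : R) (w : C) (m : Z) (a r : R) :
  Ccontinuous (profile K D w m a) r.
Proof. eapply Cderive_continuous, profile_derive. Qed.

Lemma modal_Ext (P : model) (m : Z) (lam : C) (x : vec2) :
  modal m (Ext P m lam x)
    (fun r => profile (Ku P) (Du P) (Omu P lam) m (rad P) r * fst x)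
    (fun r => profile (Kv P) (Dv P) (Omv P lam) m (rad P) r * snd x) (fst x) (snd x).
Proof.
  split; [|split].
  - intros r t; now split.
  - intros t; now split.
  - intros r; split;
      exact (Ccontinuous_mult _ _ _ (profile_continuous _ _ _ _ _ r) (Ccontinuous_const _ r)).
Qed.

Lemma modal_Sfield (P : model) (mu1 : R * R) (m : Z) (lam : C) (x : vec2) :
  modal m (Sfield P mu1 m lam x) (fun _ => RtoC 0)
    (fun r => snd mu1 * Omv P lam ^ 2 * snd x
              * profile (Kv P) (Dv P) (Omv P lam) m (rad P) r)
    0 (- fst mu1 * qm P m lam * snd x).
Proof.
  split; [|split].
  - intros r t; split; simpl; [ring|].
    unfold profile; change (robin (Kv P) (Dv P) (Omv P lam) m (rad P)) with (Bm P m lam).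
    ring.
  - intros t; split; simpl; [ring|reflexivity].
  - intros r; split; [apply Ccontinuous_const|].
    apply Ccontinuous_mult; [apply Ccontinuous_const|apply profile_continuous].
Qed.

Lemma on_mode_Ext (P : model) (m : Z) (lam : C) (x : vec2) : on_mode m (Ext P m lam x).
Proof. do 4 eexists; apply modal_Ext. Qed.

Lemma on_mode_Sfield (P : model) (mu1 : R * R) (m : Z) (lam : C) (x : vec2) :
  on_mode m (Sfield P mu1 m lam x).
Proof. do 4 eexists; apply modal_Sfield. Qed.

Lemma surface_on_mode_radial (P : model) (W : field) :
  radial_field P W -> surface_on_mode 0 W.
Proof.
  intros [_ H]; exists (su W 0%R), (sv W 0%R); intros t.
  rewrite Rmult_0_l, cis_0, !Cmult_1_r; apply H.
Qed.

Lemma conj_cis_cis (x : R) : Cconj (cis x) * cis x = 1.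
Proof. rewrite cis_conj, <- cis_plus, <- cis_0; f_equal; ring. Qed.

(** Since conj(e) e = 1 for e = e^(i k t), the inner radial integral does not depend on the angle,
    and the double integral is 2 pi times a single one. *)
Lemma inner_modal (P : model) (k : Z) (V W : field) (a' b' a b : R -> C) (x' y' x y l : C) :
  modal k V a' b' x' y' -> modal k W a b x y ->
  is_CInt (fun r => (Cconj (a' r) * a r + Cconj (b' r) * b r) * r) 0 (rad P) l ->
  inner P V W = RtoC (2 * PI) * (l + (Cconj x' * x + Cconj y' * y) * rad P).
Proof.
  intros (H1 & H2 & _) (K1 & K2 & _) Hl; unfold inner.
  replace (fun t => CInt (fun r => (Cconj (bU V r t) * bU W r t
     + Cconj (bV V r t) * bV W r t) * r) 0 (rad P)) with (fun _ : R => l).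
  - replace (fun t => (Cconj (su V t) * su W t + Cconj (sv V t) * sv W t) * rad P)
      with (fun _ : R => (Cconj x' * x + Cconj y' * y) * rad P).
    + rewrite !(CInt_unique _ _ _ _ (is_CInt_const _ _ _)), Rminus_0_r; ring.
    + apply functional_extensionality; intros t.
      rewrite (proj1 (H2 t)), (proj2 (H2 t)), (proj1 (K2 t)), (proj2 (K2 t)), !Cconj_mult.
      transitivity ((Cconj x' * x + Cconj y' * y) * rad P
        * (Cconj (cis (IZR k * t)) * cis (IZR k * t))); [rewrite conj_cis_cis|]; ring.
  - apply functional_extensionality; intros t; symmetry; apply CInt_unique.
    eapply is_CInt_ext; [|exact Hl]. intros r _; cbv beta.
    rewrite (proj1 (H1 r t)), (proj2 (H1 r t)), (proj1 (K1 r t)), (proj2 (K1 r t)), !Cconj_mult.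
    transitivity ((Cconj (a' r) * a r + Cconj (b' r) * b r) * r
        * (Cconj (cis (IZR k * t)) * cis (IZR k * t))); [rewrite conj_cis_cis|]; ring.
Qed.

Lemma modal_pairing_correct (P : model) (k : Z) (V W : field)
    (a' b' a b : R -> C) (x' y' x y : C) :
  modal k V a' b' x' y' -> modal k W a b x y ->
  exists l, is_CInt (fun r => (Cconj (a' r) * a r + Cconj (b' r) * b r) * r) 0 (rad P) l.
Proof.
  intros (_ & _ & H) (_ & _ & K); eexists; apply is_CInt_continuous; intros r _.
  destruct (H r), (K r).
  apply Ccontinuous_mult; [|eapply Cderive_continuous, Cderive_RtoC].
  apply Ccontinuous_plus; apply Ccontinuous_mult; try assumption; now apply Ccontinuous_conj.
Qed.

(** [CInt] is a total function, and additivity is available where the integrals exist; a common mode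
    with continuous radial factors guarantees that. *)
Lemma inner_plus (P : model) (k : Z) (V W Z : field) :
  on_mode k V -> on_mode k W -> on_mode k Z ->
  inner P V (W + Z)%fld = inner P V W + inner P V Z.
Proof.
  intros (a' & b' & x' & y' & HV) (a & b & x & y & HW) (c & d & z & w & HZ).
  destruct (modal_pairing_correct P _ _ _ _ _ _ _ _ _ _ _ HV HW) as (l & Hl).
  destruct (modal_pairing_correct P _ _ _ _ _ _ _ _ _ _ _ HV HZ) as (n & Hn).
  rewrite (inner_modal P _ _ _ _ _ _ _ _ _ _ _ _ HV HW Hl),
    (inner_modal P _ _ _ _ _ _ _ _ _ _ _ _ HV HZ Hn).
  rewrite (inner_modal P _ _ _ _ _ _ _ _ _ _ _ (l + n) HV
             (modal_plus _ _ _ _ _ _ _ _ _ _ _ HW HZ)).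
  - ring.
  - eapply is_CInt_ext; [|exact (is_CInt_plus _ _ _ _ _ _ Hl Hn)].
    intros r _; cbv beta; ring.
Qed.

Lemma inner_scal (P : model) (k : Z) (c : C) (V W : field) :
  on_mode k V -> on_mode k W -> inner P V (c *: W)%fld = c * inner P V W.
Proof.
  intros (a' & b' & x' & y' & HV) (a & b & x & y & HW).
  destruct (modal_pairing_correct P _ _ _ _ _ _ _ _ _ _ _ HV HW) as (l & Hl).
  rewrite (inner_modal P _ _ _ _ _ _ _ _ _ _ _ _ HV HW Hl).
  rewrite (inner_modal P _ _ _ _ _ _ _ _ _ _ _ (c * l) HV (modal_scal _ _ _ _ _ _ _ HW)).
  - ring.
  - eapply is_CInt_ext; [|exact (is_CInt_scal c _ _ _ _ Hl)].
    intros r _; cbv beta; ring.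
Qed.

(** The m-th Fourier coefficients of [G] are those of a field with data a, b, x, y on mode m. Other
    modes of [G] stay unconstrained, so non-resonant forcing can be added freely. *)
Definition projects (m : Z) (G : field) (a b : R -> C) (x y : C) : Prop :=
  (forall r, is_hat m (bU G r) (RtoC (2 * PI) * a r) /\
             is_hat m (bV G r) (RtoC (2 * PI) * b r)) /\
  is_hat m (su G) (RtoC (2 * PI) * x) /\ is_hat m (sv G) (RtoC (2 * PI) * y).

Lemma is_hat_mode (m : Z) (h : R -> C) (c : C) :
  (forall t, h t = c * cis (IZR m * t)) -> is_hat m h (RtoC (2 * PI) * c).
Proof.
  intros H; apply (is_hat_ext m (fun t => c * cis (IZR m * t))); [now intros t; rewrite H|].
  assert (K := is_hat_scal m c _ _ (is_hat_cis m m)).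
  destruct (Z.eq_dec m m); [|contradiction].
  now rewrite Cmult_comm in K.
Qed.

Lemma is_hat_other_mode (m k : Z) (h : R -> C) (c : C) : k <> m ->
  (forall t, h t = c * cis (IZR k * t)) -> is_hat m h 0.
Proof.
  intros Hk H; apply (is_hat_ext m (fun t => c * cis (IZR k * t))); [now intros t; rewrite H|].
  assert (K := is_hat_scal m c _ _ (is_hat_cis m k)).
  destruct (Z.eq_dec k m); [contradiction|].
  now rewrite Cmult_0_r in K.
Qed.

Lemma projects_modal (m : Z) (F : field) (a b : R -> C) (x y : C) :
  modal m F a b x y -> projects m F a b x y.
Proof.
  intros (H1 & H2 & _); split; [intros r; split|split]; apply is_hat_mode; intros t.
  - exact (proj1 (H1 r t)).
  - exact (proj2 (H1 r t)).
  - exact (proj1 (H2 t)).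
  - exact (proj2 (H2 t)).
Qed.

Lemma projects_plus_other (m k : Z) (G N : field) (a b : R -> C) (x y : C) :
  projects m G a b x y -> k <> m -> on_mode k N -> projects m (G + N)%fld a b x y.
Proof.
  intros (G1 & G2 & G3) Hk (c & d & z & w & N1 & N2 & _).
  assert (Z0 : forall h l q, is_hat m h l -> (exists p, forall t, q t = p * cis (IZR k * t)) ->
    is_hat m (fun t => h t + q t) l).
  { intros h l q Hh (p & Hp).
    rewrite <- (Cplus_0_r l); apply is_hat_plus; [exact Hh|].
    exact (is_hat_other_mode m k q p Hk Hp). }
  split; [|split].
  - intros r; split; apply Z0.
    + exact (proj1 (G1 r)).
    + exists (c r); intros t; exact (proj1 (N1 r t)).
    + exact (proj2 (G1 r)).
    + exists (d r); intros t; exact (proj2 (N1 r t)).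
  - apply Z0; [exact G2|]. exists z; intros t; exact (proj1 (N2 t)).
  - apply Z0; [exact G3|]. exists w; intros t; exact (proj2 (N2 t)).
Qed.

(** * The adjoint eigenfunctions and the solvability condition *)

(** This inequality serves twice: it keeps the radicand off the branch cut, and it is the hypothesis
    of the energy estimate once the root is squared. *)
Lemma Re_shifted_pos (lam : C) (s D : R) :
  (0 <= Re lam)%R -> (0 < s)%R -> (0 < D)%R -> (0 < Re ((lam + s) / D))%R.
Proof.
  intros Hl Hs HD; unfold Cdiv; rewrite <- RtoC_inv by lra; csplit.
  assert (0 < / D)%R by now apply Rinv_0_lt_compat.
  rewrite Rmult_0_r, Rminus_0_r; apply Rmult_lt_0_compat; lra.
Qed.

Lemma Re_Csqrt_sqr_pos (lam : C) (s D : R) :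
  (0 <= Re lam)%R -> (0 < s)%R -> (0 < D)%R -> (0 < Re (Csqrt ((lam + s) / D) ^ 2))%R.
Proof. rewrite Csqrt_sqr; apply Re_shifted_pos. Qed.

Lemma Csqrt_shifted_conj (lam : C) (s D : R) :
  (0 <= Re lam)%R -> (0 < s)%R -> (0 < D)%R ->
  Csqrt ((Cconj lam + s) / D) = Cconj (Csqrt ((lam + s) / D)).
Proof.
  intros Hl Hs HD; rewrite <- Csqrt_conj by now apply Re_shifted_pos.
  now rewrite Cconj_div, Cconj_plus, !Cconj_RtoC.
Qed.

Lemma robin_conj (K D : R) (w : C) (m : Z) (a : R) :
  Cconj (robin K D w m a) = robin K D (Cconj w) m a.
Proof.
  unfold robin; rewrite !BesselI'_DI, Cconj_div, Cconj_plus, !Cconj_mult, !Cconj_RtoC,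
    !BesselI_conj, DI_conj, !Cconj_mult, !Cconj_RtoC; reflexivity.
Qed.

Lemma profile_conj (K D : R) (w : C) (m : Z) (a r : R) :
  Cconj (profile K D w m a r) = profile K D (Cconj w) m a r.
Proof.
  unfold profile; rewrite Cconj_mult, Cconj_div, robin_conj, !BesselI_conj, !Cconj_mult,
    !Cconj_RtoC; reflexivity.
Qed.

(** All coefficients are real and the roots commute with conjugation. A kernel vector of the
    conjugate transpose at [lam] is thus one of the transpose at the conjugate of [lam], as
    [Lstar_Ext] requires. *)
Lemma Phi_conj (P : model) (m : Z) (lam : C) : admissible P -> (0 <= Re lam)%R ->
  mconj (Phi P m lam) = Phi P m (Cconj lam).
Proof.
  intros [(HR & HDu & HDv & Hsu & Hsv & _) _] Hl.
  assert (EA : Cconj (Am P m lam) = Am P m (Cconj lam)).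
  { change (Cconj (robin (Ku P) (Du P) (Omu P lam) m (rad P))
      = robin (Ku P) (Du P) (Omu P (Cconj lam)) m (rad P)).
    unfold Omu; rewrite Csqrt_shifted_conj by assumption; apply robin_conj. }
  assert (EB : Cconj (Bm P m lam) = Bm P m (Cconj lam)).
  { change (Cconj (robin (Kv P) (Dv P) (Omv P lam) m (rad P))
      = robin (Kv P) (Dv P) (Omv P (Cconj lam)) m (rad P)).
    unfold Omv; rewrite Csqrt_shifted_conj by assumption; apply robin_conj. }
  unfold mconj, Phi, pm, qm; simpl m11; simpl m12; simpl m21; simpl m22.
  rewrite <- EA, <- EB.
  repeat (rewrite ?Cconj_minus, ?Cconj_plus, ?Cconj_div, ?Cconj_pow, ?Cconj_mult, ?Cconj_RtoC).
  reflexivity.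
Qed.

Lemma laplacian_mode (m : Z) (c c1 c2 : R -> C) (U : R -> R -> C) (r t : R) :
  (forall s, is_Cderive c s (c1 s)) -> (forall s, is_Cderive c1 s (c2 s)) ->
  U = (fun s x => c s * cis (IZR m * x)) ->
  laplacian U r t
  = (c2 r + c1 r / r - RtoC (IZR m ^ 2) / r ^ 2 * c r) * cis (IZR m * t).
Proof.
  intros H1 H2 ->; unfold laplacian.
  assert (HT : forall c c1 : R -> C, (forall s, is_Cderive c s (c1 s)) ->
    d_r (fun s x => c s * cis (IZR m * x)) = (fun s x => c1 s * cis (IZR m * x))).
  { intros d d1 Hd; apply functional_extensionality; intros s.
    apply functional_extensionality; intros x; apply Cderive_unique.
    apply (Cderive_ext (fun s => cis (IZR m * x) * d s)); [intros; ring|].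
    eapply Cderive_eq; [apply Cderive_scal, Hd|ring]. }
  rewrite (HT c c1 H1), (HT c1 c2 H2).
  assert (HC : forall d : C, d_t (fun _ x => d * cis (IZR m * x))
    = (fun _ x => Ci * IZR m * d * cis (IZR m * x))).
  { intros d; apply functional_extensionality; intros s.
    apply functional_extensionality; intros x; apply Cderive_unique.
    eapply Cderive_eq; [apply Cderive_scal, Cderive_cis|ring]. }
  change (d_t (d_t (fun s x => c s * cis (IZR m * x))) r t) with
    (d_t (d_t (fun _ x => c r * cis (IZR m * x))) r t).
  rewrite HC, HC.
  replace (RtoC (IZR m ^ 2)) with (- (Ci * IZR m * (Ci * IZR m))).
  - unfold Cdiv; ring.
  - apply C_ext; unfold Ci, Cmult, Copp, RtoC, Re, Im; simpl; ring.
Qed.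

Lemma d_tt_mode (m : Z) (x : C) (t : R) :
  d_tt (fun s => x * cis (IZR m * s)) t = - RtoC (IZR m ^ 2) * (x * cis (IZR m * t)).
Proof.
  unfold d_tt.
  assert (HC : forall d : C, CDerive (fun x => d * cis (IZR m * x))
    = (fun x => Ci * IZR m * d * cis (IZR m * x))).
  { intros d; apply functional_extensionality; intros s; apply Cderive_unique.
    eapply Cderive_eq; [apply Cderive_scal, Cderive_cis|ring]. }
  rewrite HC, HC.
  replace (RtoC (IZR m ^ 2)) with (- (Ci * IZR m * (Ci * IZR m))).
  - ring.
  - apply C_ext; unfold Ci, Cmult, Copp, RtoC, Re, Im; simpl; ring.
Qed.

Lemma profile_helmholtz (K D s a r : R) (lam : C) (m : Z) : (0 < r)%R -> (0 < D)%R ->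
  let w := Csqrt ((lam + s) / D) in
  D * (profile2 K D w m a r + profile1 K D w m a r / r
       - RtoC (IZR m ^ 2) / r ^ 2 * profile K D w m a r) - s * profile K D w m a r
  = lam * profile K D w m a r.
Proof.
  intros Hr HD w.
  assert (Hrn : RtoC r <> 0) by (apply RtoC_neq_0; lra).
  assert (HDn : RtoC D <> 0) by (apply RtoC_neq_0; lra).
  assert (O := profile_ode K D w m a r); unfold w in O at 3; rewrite Csqrt_sqr in O.
  assert (O' : profile2 K D w m a r = ((lam + s) / D + RtoC (IZR m ^ 2) / r ^ 2)
       * profile K D w m a r - profile1 K D w m a r / r).
  { transitivity ((r ^ 2 * profile2 K D w m a r + r * profile1 K D w m a r) / r ^ 2
      - profile1 K D w m a r / r); [field; exact Hrn|].
    rewrite O; field; now split. }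
  rewrite O'; field; now split.
Qed.

(** The bulk rows hold for every x by the Bessel equation. In the surface rows the trace of U is A_m
    u, so -K_u (u - U) is -K_u p_m u, and likewise for v; what remains are the rows of the transpose
    of [Phi]. *)
Lemma Lstar_Ext (P : model) (m : Z) (lam : C) (x : vec2) :
  admissible P -> (0 <= Re lam)%R -> mapply (mtr (Phi P m lam)) x = vzero ->
  field_eq P (Lstar P (Ext P m lam x)) (lam *: Ext P m lam x)%fld.
Proof.
  intros [(HR & HDu & HDv & Hsu & Hsv & _) _] Hl Hx.
  assert (HRn : RtoC (rad P) <> 0) by (apply RtoC_neq_0; lra).
  assert (HIu : BesselI m (Omu P lam * rad P) <> 0)
    by (apply BesselI_nonzero; [now apply Re_Csqrt_sqr_pos|exact HR]).
  assert (HIv : BesselI m (Omv P lam * rad P) <> 0)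
    by (apply BesselI_nonzero; [now apply Re_Csqrt_sqr_pos|exact HR]).
  assert (Hx1 := f_equal fst Hx); assert (Hx2 := f_equal snd Hx).
  cbn [mapply mtr Phi m11 m12 m21 m22 fst snd vzero] in Hx1, Hx2.
  assert (Hbulk : forall (K D s : R) (z : C) (r t : R), (0 < D)%R -> (0 < r)%R ->
    let p := profile K D (Csqrt ((lam + s) / D)) m (rad P) in
    D * laplacian (fun s t => p s * z * cis (IZR m * t)) r t
      - s * (p r * z * cis (IZR m * t)) = lam * (p r * z * cis (IZR m * t))).
  { intros K D s z r t HD Hr p.
    rewrite (laplacian_mode m (fun r => z * p r)
      (fun r => z * profile1 K D (Csqrt ((lam + s) / D)) m (rad P) r)
      (fun r => z * profile2 K D (Csqrt ((lam + s) / D)) m (rad P) r)).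
    - transitivity (z * cis (IZR m * t) * (lam * p r)); [|ring].
      unfold p; rewrite <- profile_helmholtz by assumption.
      unfold Cdiv; ring.
    - intros; apply Cderive_scal, profile_derive.
    - intros; apply Cderive_scal, profile1_derive.
    - apply functional_extensionality; intros r'.
      apply functional_extensionality; intros t'; ring. }
  split.
  - intros r t [Hr _]; split.
    + exact (Hbulk (Ku P) (Du P) (sigu P) (fst x) r t HDu Hr).
    + exact (Hbulk (Kv P) (Dv P) (sigv P) (snd x) r t HDv Hr).
  - intros t; simpl; rewrite !d_tt_mode, RtoC_pow; unfold pm, qm in *.
    split; apply Ceq_minus.
    + transitivity ((fu P - lam - (Ku P * (1 - Am P m lam) + IZR m ^ 2 * du P / rad P ^ 2))
        * fst x * cis (IZR m * t) + gu P * snd x * cis (IZR m * t)).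
      * field; now split.
      * transitivity (((fu P - lam - (Ku P * (1 - Am P m lam) + IZR m ^ 2 * du P / rad P ^ 2))
          * fst x + gu P * snd x) * cis (IZR m * t)); [ring|].
        rewrite Hx1; ring.
    + transitivity ((gv P - lam - (Kv P * (1 - Bm P m lam) + IZR m ^ 2 * dv P / rad P ^ 2))
        * snd x * cis (IZR m * t) + fv P * fst x * cis (IZR m * t)).
      * field; now split.
      * transitivity ((fv P * fst x
          + (gv P - lam - (Kv P * (1 - Bm P m lam) + IZR m ^ 2 * dv P / rad P ^ 2))
          * snd x) * cis (IZR m * t)); [ring|].
        rewrite Hx2; ring.
Qed.

(* Projecting the system on [cis (m t)] leaves a radial problem; Green's identity
   against the adjoint profile turns it into [K (A u - U(R)) + A bc = - int a F r dr / R],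
   and pairing the surface rows with the left kernel of [Phi] cancels the unknowns. *)
Lemma solvability (P : model) (m : Z) (lam : C) (xs : vec2) (X G F : field)
    (a b : R -> C) (x y beta : C) (bc : R -> C) :
  admissible P -> (0 <= Re lam)%R ->
  mapply (mtr (mconj (Phi P m lam))) xs = vzero ->
  smooth_field P X ->
  field_eq P (lam *: X - Lop P X)%fld G ->
  (forall t, BC P X t = (RtoC 0, bc t)) ->
  is_hat m bc (RtoC (2 * PI) * beta) ->
  modal m F a b x y -> projects m G a b x y ->
  inner P (Ext P m (Cconj lam) xs) F
  = - RtoC (2 * PI * rad P) * Bm P m lam * Cconj (snd xs) * beta.
Proof.
  intros HP Hl Hxs (HXU & HXV & HXu & HXv) [Heqb Heqs] HBC Hbc HF [HG1 [HG2 HG3]].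
  destruct HP as [(HR & HDu & HDv & Hsu & Hsv & HKu & HKv & _) _].
  assert (HRn : RtoC (rad P) <> 0) by (apply RtoC_neq_0; lra).
  assert (Hwu := Re_Csqrt_sqr_pos lam (sigu P) (Du P) Hl Hsu HDu).
  assert (Hwv := Re_Csqrt_sqr_pos lam (sigv P) (Dv P) Hl Hsv HDv).
  destruct (laplacian_hat m _ _ HXU) as [HU HUL].
  destruct (laplacian_hat m _ _ HXV) as [HV HVL].
  destruct (circle_hat m _ HXu) as [Hu Hut].
  destruct (circle_hat m _ HXv) as [Hv Hvt].
  set (U0 := fun r => hat m (bU X r)) in *.
  set (V0 := fun r => hat m (bV X r)) in *.
  set (U1 := fun r => hat m (d_r (bU X) r)) in *.
  set (V1 := fun r => hat m (d_r (bV X) r)) in *.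
  set (u0 := hat m (su X)) in *. set (v0 := hat m (sv X)) in *.
  set (pu := profile (Ku P) (Du P) (Omu P lam) m (rad P)).
  set (pv := profile (Kv P) (Dv P) (Omv P lam) m (rad P)).
  destruct HF as (HF1 & HF2 & HF3).
  assert (GU : is_CInt (fun r => pu r * (RtoC (2 * PI) * a r) * r) 0 (rad P)
    (- (rad P * (Du P * U1 (rad P) * pu (rad P)
      - U0 (rad P) * (Du P * profile1 (Ku P) (Du P) (Omu P lam) m (rad P) (rad P)))))).
  { apply (green_mode (Ku P) (Du P) (sigu P) (rad P) lam (Omu P lam) m U0 U1
      (fun r => hat m (d_r (d_r (bU X)) r))); try assumption.
    - apply Csqrt_sqr.
    - intros r Hr; exact (proj2 (proj2 (HU r Hr))).
    - intros r; exact (Ccontinuous_mult _ _ _ (Ccontinuous_const _ r) (proj1 (HF3 r))).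
    - intros r Hr.
      assert (Hr1 : (0 <= r <= rad P)%R) by lra.
      assert (Hr2 : (0 < r <= rad P)%R) by lra.
      (* Two values of one Fourier coefficient are compared, one computed from the operator and the
         other from the forcing; the boundary and surface rows below are treated alike. *)
      eapply is_hat_inj; [|exact (proj1 (HG1 r))].
      eapply is_hat_ext; [intros t; exact (proj1 (Heqb r t Hr))|];
        cbn [bU bV su sv Lop fplus fscal fopp BC fst snd].
      assert (K := is_hat_plus m _ _ _ _ (is_hat_scal m lam _ _ (proj1 (HU r Hr1)))
        (is_hat_scal m (- RtoC 1) _ _ (is_hat_plus m _ _ _ _
           (is_hat_scal m (Du P) _ _ (HUL r Hr2))
           (is_hat_scal m (- sigu P) _ _ (proj1 (HU r Hr1)))))).
      eapply is_CInt_eq; [eapply is_hat_ext; [|exact K]|].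
      + intros t; cbv beta; ring.
      + unfold U0, U1; ring. }
  assert (GV : is_CInt (fun r => pv r * (RtoC (2 * PI) * b r) * r) 0 (rad P)
    (- (rad P * (Dv P * V1 (rad P) * pv (rad P)
      - V0 (rad P) * (Dv P * profile1 (Kv P) (Dv P) (Omv P lam) m (rad P) (rad P)))))).
  { apply (green_mode (Kv P) (Dv P) (sigv P) (rad P) lam (Omv P lam) m V0 V1
      (fun r => hat m (d_r (d_r (bV X)) r))); try assumption.
    - apply Csqrt_sqr.
    - intros r Hr; exact (proj2 (proj2 (HV r Hr))).
    - intros r; exact (Ccontinuous_mult _ _ _ (Ccontinuous_const _ r) (proj2 (HF3 r))).
    - intros r Hr.
      assert (Hr1 : (0 <= r <= rad P)%R) by lra.
      assert (Hr2 : (0 < r <= rad P)%R) by lra.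
      eapply is_hat_inj; [|exact (proj2 (HG1 r))].
      eapply is_hat_ext; [intros t; exact (proj2 (Heqb r t Hr))|];
        cbn [bU bV su sv Lop fplus fscal fopp BC fst snd].
      assert (K := is_hat_plus m _ _ _ _ (is_hat_scal m lam _ _ (proj1 (HV r Hr1)))
        (is_hat_scal m (- RtoC 1) _ _ (is_hat_plus m _ _ _ _
           (is_hat_scal m (Dv P) _ _ (HVL r Hr2))
           (is_hat_scal m (- sigv P) _ _ (proj1 (HV r Hr1)))))).
      eapply is_CInt_eq; [eapply is_hat_ext; [|exact K]|].
      + intros t; cbv beta; ring.
      + unfold V0, V1; ring. }
  assert (HRR : (0 <= rad P <= rad P)%R) by lra.
  destruct (HU _ HRR) as (HUR & HU1R & _). destruct (HV _ HRR) as (HVR & HV1R & _).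
  fold (U0 (rad P)) in HUR; fold (U1 (rad P)) in HU1R.
  fold (V0 (rad P)) in HVR; fold (V1 (rad P)) in HV1R.
  assert (BU : Du P * U1 (rad P) - Ku P * (u0 - U0 (rad P)) = 0).
  { eapply (is_hat_inj m (fun _ => RtoC 0)).
    - eapply is_hat_ext; [intros t; exact (f_equal fst (HBC t))|];
        cbn [bU bV su sv Lop fplus fscal fopp BC fst snd].
      assert (K := is_hat_plus m _ _ _ _ (is_hat_scal m (Du P) _ _ HU1R)
        (is_hat_scal m (- Ku P) _ _ (is_hat_plus m _ _ _ _ Hu
           (is_hat_scal m (- RtoC 1) _ _ HUR)))).
      eapply is_CInt_eq; [eapply is_hat_ext; [|exact K]|].
      + intros t; cbv beta; ring.
      + ring.
    - rewrite <- (Cmult_0_l 0); eapply is_hat_ext;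
        [|apply is_hat_scal, (is_hat_other_mode m (m + 1)
            (fun t => 1 * cis (IZR (m + 1) * t)) 1)].
      + intros t; cbv beta; ring.
      + lia.
      + reflexivity. }
  assert (BV : Dv P * V1 (rad P) - Kv P * (v0 - V0 (rad P)) = RtoC (2 * PI) * beta).
  { eapply is_hat_inj; [|exact Hbc].
    eapply is_hat_ext; [intros t; exact (f_equal snd (HBC t))|];
      cbn [bU bV su sv Lop fplus fscal fopp BC fst snd].
    assert (K := is_hat_plus m _ _ _ _ (is_hat_scal m (Dv P) _ _ HV1R)
        (is_hat_scal m (- Kv P) _ _ (is_hat_plus m _ _ _ _ Hv
           (is_hat_scal m (- RtoC 1) _ _ HVR)))).
    eapply is_CInt_eq; [eapply is_hat_ext; [|exact K]|].
    + intros t; cbv beta; ring.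
    + ring. }
  assert (SU : lam * u0 - (du P / rad P ^ 2 * (- RtoC (IZR m ^ 2) * u0)
      - Ku P * (u0 - U0 (rad P)) + fu P * u0 + fv P * v0) = RtoC (2 * PI) * x).
  { eapply is_hat_inj; [|exact HG2].
    eapply is_hat_ext; [intros t; exact (proj1 (Heqs t))|];
      cbn [bU bV su sv Lop fplus fscal fopp BC fst snd].
    assert (K := is_hat_plus m _ _ _ _ (is_hat_scal m lam _ _ Hu)
      (is_hat_scal m (- RtoC 1) _ _ (is_hat_plus m _ _ _ _ (is_hat_plus m _ _ _ _
        (is_hat_plus m _ _ _ _ (is_hat_scal m (du P / rad P ^ 2) _ _ Hut)
          (is_hat_scal m (- Ku P) _ _ (is_hat_plus m _ _ _ _ Hu
             (is_hat_scal m (- RtoC 1) _ _ HUR))))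
        (is_hat_scal m (fu P) _ _ Hu)) (is_hat_scal m (fv P) _ _ Hv)))).
    eapply is_CInt_eq; [eapply is_hat_ext; [|exact K]|].
    + intros t; cbv beta; ring.
    + ring. }
  assert (SV : lam * v0 - (dv P / rad P ^ 2 * (- RtoC (IZR m ^ 2) * v0)
      - Kv P * (v0 - V0 (rad P)) + gu P * u0 + gv P * v0) = RtoC (2 * PI) * y).
  { eapply is_hat_inj; [|exact HG3].
    eapply is_hat_ext; [intros t; exact (proj2 (Heqs t))|];
      cbn [bU bV su sv Lop fplus fscal fopp BC fst snd].
    assert (K := is_hat_plus m _ _ _ _ (is_hat_scal m lam _ _ Hv)
      (is_hat_scal m (- RtoC 1) _ _ (is_hat_plus m _ _ _ _ (is_hat_plus m _ _ _ _
        (is_hat_plus m _ _ _ _ (is_hat_scal m (dv P / rad P ^ 2) _ _ Hvt)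
          (is_hat_scal m (- Kv P) _ _ (is_hat_plus m _ _ _ _ Hv
             (is_hat_scal m (- RtoC 1) _ _ HVR))))
        (is_hat_scal m (gu P) _ _ Hu)) (is_hat_scal m (gv P) _ _ Hv)))).
    eapply is_CInt_eq; [eapply is_hat_ext; [|exact K]|].
    + intros t; cbv beta; ring.
    + ring. }
  (* The boundary terms left by Green's identity; divided by 2 pi and weighted by the conjugate of
     [xs], they form the bulk part of the inner product. *)
  set (IU := - (rad P * (Du P * U1 (rad P) * pu (rad P)
      - U0 (rad P) * (Du P * profile1 (Ku P) (Du P) (Omu P lam) m (rad P) (rad P))))) in GU.
  set (IV := - (rad P * (Dv P * V1 (rad P) * pv (rad P)
      - V0 (rad P) * (Dv P * profile1 (Kv P) (Dv P) (Omv P lam) m (rad P) (rad P))))) in GV.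
  assert (H2PI : RtoC (2 * PI) <> 0) by (apply RtoC_neq_0; generalize PI_RGT_0; lra).
  rewrite (inner_modal P m _ F _ _ a b _ _ x y
    (/ RtoC (2 * PI) * (Cconj (fst xs) * IU + Cconj (snd xs) * IV))
    (modal_Ext P m (Cconj lam) xs) (conj HF1 (conj HF2 HF3))).
  2:{ eapply is_CInt_ext; [|exact (is_CInt_scal (/ RtoC (2 * PI)) _ _ _ _
        (is_CInt_plus _ _ _ _ _ _ (is_CInt_scal (Cconj (fst xs)) _ _ _ _ GU)
          (is_CInt_scal (Cconj (snd xs)) _ _ _ _ GV)))].
      intros r _; cbv beta.
      rewrite !Cconj_mult, !profile_conj.
      (* The conjugated profile at [Cconj lam] is the profile at [lam], the one used in Green's
         identity. *)
      assert (Eu : Cconj (Omu P (Cconj lam)) = Omu P lam)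
        by (unfold Omu; rewrite Csqrt_shifted_conj by assumption; apply Cconj_conj).
      assert (Ev : Cconj (Omv P (Cconj lam)) = Omv P lam)
        by (unfold Omv; rewrite Csqrt_shifted_conj by assumption; apply Cconj_conj).
      rewrite Eu, Ev; fold pu pv. field; exact H2PI. }
  (* The Robin conditions of the unknown and of the profile eliminate both normal derivatives; the
     inhomogeneity [beta] survives in the V part. *)
  assert (EIU : IU = - (rad P * (Ku P * (Am P m lam * u0 - U0 (rad P))))).
  { unfold IU, pu; rewrite profile1_boundary, profile_boundary by assumption.
    change (robin (Ku P) (Du P) (Omu P lam) m (rad P)) with (Am P m lam).
    replace (Du P * U1 (rad P)) with (Ku P * (u0 - U0 (rad P)))
      by (symmetry; apply Ceq_minus, BU).
    ring. }
  assert (EIV : IV = - (rad P * (Kv P * (Bm P m lam * v0 - V0 (rad P))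
      + Bm P m lam * (RtoC (2 * PI) * beta)))).
  { unfold IV, pv; rewrite profile1_boundary, profile_boundary by assumption.
    change (robin (Kv P) (Dv P) (Omv P lam) m (rad P)) with (Bm P m lam).
    rewrite <- BV; ring. }
  (* Conjugating the kernel equation makes the conjugate of [xs] a left null vector of [Phi]
     itself. *)
  assert (Hk1 := f_equal (fun v => Cconj (fst v)) Hxs).
  assert (Hk2 := f_equal (fun v => Cconj (snd v)) Hxs).
  cbn [mapply mtr mconj Phi m11 m12 m21 m22 fst snd vzero] in Hk1, Hk2.
  rewrite Cconj_plus, !Cconj_mult, !Cconj_conj in Hk1, Hk2.
  transitivity (Cconj (fst xs) * IU + Cconj (snd xs) * IV
    + (Cconj (fst xs) * (RtoC (2 * PI) * x) + Cconj (snd xs) * (RtoC (2 * PI) * y)) * rad P);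
    [field; exact H2PI|].
  rewrite EIU, EIV, <- SU, <- SV.
  rewrite !RtoC_pow, (RtoC_mult (2 * PI)).
  apply Ceq_minus; unfold pm, qm in Hk1, Hk2.
  (* The traces [U0] and [V0] cancel between bulk and surface terms; the difference of the two sides
     is this combination of the null-vector equations, weighted by the unknown [u0] and [v0]. *)
  match type of Hk1 with ?e1 = _ => match type of Hk2 with ?e2 = _ =>
    transitivity (- rad P * (u0 * e1 + v0 * e2)) end end.
  - field; exact HRn.
  - rewrite Hk1, Hk2, Cconj_RtoC; ring.
Qed.

(** The conjugated adjoint profile and the profile in the forcing share the same [Om], so the bulk
    integrand is a multiple of r I_m(Om r)^2, without a modulus, and [lommel_integral] evaluates
    it. *)
Lemma inner_Sfield (P : model) (mu1 : R * R) (m : Z) (lam : C) (xs x : vec2) :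
  admissible P -> (0 <= Re lam)%R ->
  let Om := Omv P lam in
  inner P (Ext P m (Cconj lam) xs) (Sfield P mu1 m lam x)
  = RtoC (2 * PI * rad P) * Cconj (snd xs) * snd x
    * (Bm P m lam ^ 2 * Om ^ 2 * (rad P / 2)
         * (1 - BesselI (m - 1) (Om * rad P) * BesselI (m + 1) (Om * rad P)
                / BesselI m (Om * rad P) ^ 2) * snd mu1
       - qm P m lam * fst mu1).
Proof.
  intros [(HR & _ & HDv & _ & Hsv & _) _] Hl Om.
  assert (Hw : (0 < Re (Om ^ 2))%R) by now apply Re_Csqrt_sqr_pos.
  assert (HI : BesselI m (Om * rad P) <> 0) by now apply BesselI_nonzero.
  assert (HOm : Om <> 0).
  { intros E; rewrite E in Hw; revert Hw; replace (0 ^ 2) with (RtoC 0) by ring.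
    rewrite Re_RtoC; lra. }
  rewrite (inner_modal P m _ _ _ _ _ _ _ _ _ _
    (Cconj (snd xs) * (snd mu1 * Om ^ 2 * snd x) * (Bm P m lam / BesselI m (Om * rad P)) ^ 2
     * (rad P ^ 2 / 2 * (BesselI m (Om * rad P) ^ 2
         - BesselI (m - 1) (Om * rad P) * BesselI (m + 1) (Om * rad P))))
    (modal_Ext P m (Cconj lam) xs) (modal_Sfield P mu1 m lam x)).
  - rewrite (RtoC_mult (2 * PI)). field; exact HI.
  - eapply is_CInt_ext; [|apply is_CInt_scal, (lommel_integral m Om (rad P) HOm HR)].
    intros r _; cbv beta.
    rewrite !Cconj_mult, !profile_conj.
    assert (Ev : Cconj (Omv P (Cconj lam)) = Om)
      by (unfold Omv; rewrite Csqrt_shifted_conj by assumption; apply Cconj_conj).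
    rewrite Ev; fold Om; unfold profile.
    change (robin (Kv P) (Dv P) Om m (rad P)) with (Bm P m lam).
    unfold Cdiv; ring.
Qed.

(** The part linear in A and dA, common to both bifurcations; the normalisation gives [dA] the
    coefficient -1. *)
Lemma inner_forcing (P : model) (mu1 : R * R) (m : Z) (lam : C) (xs x : vec2)
    (w : field) (A dA : C) :
  admissible P -> (0 <= Re lam)%R -> surface_on_mode 0 w ->
  let Om := Omv P lam in
  let W := Ext P m lam x in
  let Ws := Ext P m (Cconj lam) xs in
  inner P Ws W = 1 ->
  inner P Ws (- (dA *: W) + A *: (2 *: Bop P W w + Sfield P mu1 m lam x))%fld
  = - dA + 2 * inner P Ws (Bop P W w) * A
    + RtoC (2 * PI * rad P) * Cconj (snd xs) * snd x
      * (Bm P m lam ^ 2 * Om ^ 2 * (rad P / 2)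
         * (1 - BesselI (m - 1) (Om * rad P) * BesselI (m + 1) (Om * rad P)
                / BesselI m (Om * rad P) ^ 2) * snd mu1
       - qm P m lam * fst mu1) * A.
Proof.
  intros HP Hl Hw Om W Ws H1.
  assert (MWs : on_mode m Ws) by apply on_mode_Ext.
  assert (MW : on_mode m W) by apply on_mode_Ext.
  assert (MS : on_mode m (Sfield P mu1 m lam x)) by apply on_mode_Sfield.
  assert (MB : on_mode m (Bop P W w))
    by (apply (on_mode_Bop P m 0); [lia|now apply on_mode_surface|exact Hw]).
  unfold fopp.
  rewrite (inner_plus P m), !(inner_scal P m), (inner_plus P m), (inner_scal P m), H1
    by (repeat first [assumption | apply on_mode_scal | apply on_mode_plus]).
  unfold Ws at 2; rewrite inner_Sfield by assumption; fold Om; ring.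
Qed.

(** * Specialisation to the Hopf and pitchfork eigenvalues *)

Lemma conj_imaginary (x : R) : Cconj (Ci * x) = - (Ci * x).
Proof. apply C_ext; unfold Cconj, Ci, Cmult, Copp, RtoC, Re, Im; simpl; ring. Qed.

Lemma Re_imaginary (x : R) : (0 <= Re (Ci * x))%R.
Proof. right; unfold Ci, Cmult, RtoC, Re; simpl; ring. Qed.

(** [G] is the whole forcing and [F] its resonant part; the boundary datum is constant in the angle,
    so it lies on mode 0 too. *)
Lemma hopf_condition (P : model) (mu1 : R * R) (lamI : R) (phi0 phi0s : vec2) (A : C)
    (G F X : field) :
  admissible P -> hopf_data P lamI phi0 phi0s -> smooth_field P X ->
  solvesX P mu1 lamI phi0 A G X -> on_mode 0 F ->
  (forall a b x y, modal 0 F a b x y -> projects 0 G a b x y) ->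
  ode0_lhs P mu1 lamI phi0 phi0s A = inner P (W0s P lamI phi0s) F.
Proof.
  intros HP (_ & _ & _ & _ & _ & Hk & _) HX [Heq HBC] (a & b & x & y & HF) HG.
  unfold W0s; rewrite <- conj_imaginary.
  rewrite (solvability P 0 (Ci * lamI) phi0s X G F a b x y
    (beta_mu P mu1 * qm P 0 (Ci * lamI) * snd phi0 * A)
    (fun _ => beta_mu P mu1 * qm P 0 (Ci * lamI) * snd phi0 * A)).
  - unfold ode0_lhs; ring.
  - exact HP.
  - apply Re_imaginary.
  - exact Hk.
  - exact HX.
  - exact Heq.
  - exact HBC.
  - apply is_hat_mode; intros t; rewrite Rmult_0_l, cis_0; ring.
  - exact HF.
  - now apply HG.
Qed.

(** The forcing is carried by the modes n, -n, 3n and -3n, distinct since n is nonzero, so the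
    projection on mode n sees [T] alone. *)
Lemma pitchfork_condition (P : model) (mu1 : R * R) (n : Z) (phin phins : R * R) (A : C)
    (T Rr Y : field) :
  admissible P -> pitchfork_data P n phin phins -> smooth_field P Y ->
  solvesY P mu1 n phin A T Rr Y -> on_mode n T -> on_mode (3 * n) Rr ->
  oden_lhs P mu1 n phin phins A = inner P (Wns P n phins) T.
Proof.
  intros HP (Hn & _ & _ & _ & _ & Hk & _) HY [Heq HBC] HT HR.
  assert (Hz : (0 <= Re 0)%R) by (rewrite Re_RtoC; lra).
  destruct HT as (a & b & x & y & HT).
  unfold Wns; rewrite <- (Cconj_RtoC 0).
  set (c := beta_mu P mu1 * qm P n 0 * snd phin).
  rewrite (solvability P n 0 (vreal phins) Y (T + fconj T + Rr + fconj Rr)%fld T a b x y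
    (c * A) (fun t => c * (A * cis (IZR n * t) + Cconj A * cis (- (IZR n * t))))).
  - unfold oden_lhs, c, vreal; simpl snd; rewrite Cconj_RtoC; ring.
  - exact HP.
  - exact Hz.
  (* At the real eigenvalue 0 the matrix is its own conjugate, so the plain transpose is the
     adjoint. *)
  - rewrite Phi_conj by assumption; now rewrite Cconj_RtoC.
  - exact HY.
  - destruct Heq as [H1 H2]; split.
    + intros r t Hr; destruct (H1 r t Hr) as [<- <-]; simpl; split; ring.
    + intros t; destruct (H2 t) as [<- <-]; simpl; split; ring.
  - exact HBC.
  - apply (is_hat_ext n (fun t => c * A * cis (IZR n * t)
      + c * Cconj A * cis (IZR (- n) * t))).
    + intros t; rewrite opp_IZR.
      replace (- IZR n * t)%R with (- (IZR n * t))%R by ring; ring.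
    (* The e^(-i n theta) half of the boundary datum is orthogonal to mode n. *)
    + rewrite <- (Cplus_0_r (RtoC (2 * PI) * _)); apply is_hat_plus.
      * now apply is_hat_mode.
      * apply (is_hat_other_mode n (- n) _ (c * Cconj A)); [lia|reflexivity].
  - exact HT.
  - apply projects_plus_other with (k := (- (3 * n))%Z); [|lia|now apply on_mode_conj].
    apply projects_plus_other with (k := (3 * n)%Z); [|lia|exact HR].
    apply projects_plus_other with (k := (- n)%Z);
      [now apply projects_modal|lia|apply on_mode_conj; now exists a, b, x, y].
Qed.

(** * Angular modes of the nonlinear terms and the resulting amplitude equations *)

Lemma fplus_assoc (W Y Z : field) : (W + (Y + Z))%fld = (W + Y + Z)%fld.
Proof.
  unfold fplus; simpl; f_equal; apply functional_extensionality; intros r;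
    try (apply functional_extensionality; intros t); ring.
Qed.

(** Modes are read off the syntax: sums and multiples keep the mode, conjugation negates it,
    products add. The indices of the factors stay open until the factors fix them, and [lia] then
    checks the total. *)
Ltac surface :=
  lazymatch goal with
  | |- surface_on_mode _ (fconj _) => apply surface_on_mode_conj; surface
  | |- surface_on_mode _ (Ext _ _ _ _) => apply on_mode_surface, on_mode_Ext
  | |- _ => eassumption
  end.
Ltac mode :=
  lazymatch goal with
  | |- on_mode _ (fplus _ _) => apply on_mode_plus; mode
  | |- on_mode _ (fopp _) => apply on_mode_opp; mode
  | |- on_mode _ (fscal _ _) => apply on_mode_scal; mode
  | |- on_mode _ (Ext _ _ _ _) => apply on_mode_Ext
  | |- on_mode _ (Sfield _ _ _ _ _) => apply on_mode_Sfield
  | |- on_mode _ (Bop _ _ _) => eapply on_mode_Bop; [|surface|surface]; lia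
  | |- on_mode _ (Cop _ _ _ _) => eapply on_mode_Cop; [|surface|surface|surface]; lia
  | |- _ => assumption
  end.

Lemma on_mode_cub0 (P : model) (lamI : R) (phi0 u2000 u1100 : vec2) :
  on_mode 0 (cub0 P (W0 P lamI phi0) (W1100 P u1100) (W2000 P lamI u2000)).
Proof. unfold cub0, W0, W1100, W2000; mode. Qed.

Lemma on_mode_cub0n (P : model) (lamI : R) (n : Z) (phi0 u0011 u1010 : vec2)
    (phin : R * R) :
  on_mode 0 (cub0n P (W0 P lamI phi0) (Wn P n phin) (Wmn P n phin) (W0011 P u0011)
    (W1001 P lamI n u1010) (W1010 P lamI n u1010)).
Proof. unfold cub0n, W0, Wn, Wmn, W0011, W1001, W1010; mode. Qed.

Lemma on_mode_cubn (P : model) (n : Z) (phin : R * R) (u0011 u0020 : vec2) :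
  on_mode n (cubn P (Wn P n phin) (Wmn P n phin) (W0011 P u0011) (W0020 P n u0020)).
Proof. unfold cubn, Wn, Wmn, W0011, W0020; mode. Qed.

Lemma on_mode_cubn0 (P : model) (lamI : R) (n : Z) (phi0 u1100 u1010 : vec2)
    (phin : R * R) :
  on_mode n (cubn0 P (W0 P lamI phi0) (Wn P n phin) (W1100 P u1100)
    (W0110 P lamI n u1010) (W1010 P lamI n u1010)).
Proof. unfold cubn0, W0, Wn, W1100, W0110, W1001, W1010; mode. Qed.

Lemma on_mode_Rres (P : model) (n : Z) (phin : R * R) (u0020 : vec2) (A : C) :
  on_mode (3 * n) (Rres P n phin (W0020 P n u0020) A).
Proof. unfold Rres, Wn, W0020; mode. Qed.

Lemma on_mode_rhs0 (P : model) (mu1 : R * R) (lamI : R) (phi0 u2000 u1100 : vec2)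
    (w : field) (A dA : C) : surface_on_mode 0 w ->
  on_mode 0 (rhs0 P mu1 lamI phi0 w (W1100 P u1100) (W2000 P lamI u2000) A dA).
Proof.
  intros Hw; assert (H := on_mode_cub0 P lamI phi0 u2000 u1100).
  unfold rhs0, W0 in *; mode.
Qed.

Lemma on_mode_Tres (P : model) (mu1 : R * R) (n : Z) (phin : R * R) (u0011 u0020 : vec2)
    (w : field) (A dA : C) : surface_on_mode 0 w ->
  on_mode n (Tres P mu1 n phin w (W0011 P u0011) (W0020 P n u0020) A dA).
Proof.
  intros Hw; assert (H := on_mode_cubn P n phin u0011 u0020).
  unfold Tres, Wn in *; mode.
Qed.

Lemma inner_rhs0 (P : model) (mu1 : R * R) (lamI : R) (phi0 phi0s u2000 u1100 : vec2)
    (w : field) (A dA : C) :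
  admissible P -> hopf_data P lamI phi0 phi0s -> surface_on_mode 0 w ->
  inner P (W0s P lamI phi0s)
    (rhs0 P mu1 lamI phi0 w (W1100 P u1100) (W2000 P lamI u2000) A dA)
  = ode0_rhs P mu1 lamI phi0 phi0s w (W1100 P u1100) (W2000 P lamI u2000) A dA.
Proof.
  intros HP (_ & _ & _ & _ & _ & _ & H1) Hw.
  assert (H := on_mode_cub0 P lamI phi0 u2000 u1100).
  assert (MWs : on_mode 0 (W0s P lamI phi0s)) by exact (on_mode_Ext _ _ _ _).
  unfold rhs0, ode0_rhs.
  rewrite (inner_plus P 0), (inner_scal P 0); try exact MWs; try exact H;
    [|unfold W0; mode|mode].
  unfold W0, W0s in H1 |- *; rewrite <- conj_imaginary in H1 |- *.
  rewrite inner_forcing by (assumption || apply Re_imaginary).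
  (* Orders enter by absolute value, so I_(-1) and I_1 coincide by computation and the product of
     neighbours becomes the square of I_1. *)
  change (BesselI (0 - 1)) with (BesselI 1).
  change (BesselI (0 + 1)) with (BesselI 1).
  unfold Cdiv; rewrite !Cpow_mult_l.
  set (Om := Omv P (Ci * lamI)).
  assert (HOm : BesselI 0 (Om * rad P) <> 0).
  { destruct HP as [(HR & _ & HDv & _ & Hsv & _) _].
    apply BesselI_nonzero; [apply Re_Csqrt_sqr_pos|]; try assumption; apply Re_imaginary. }
  replace ((/ BesselI 0 (Om * rad P)) ^ 2) with (/ BesselI 0 (Om * rad P) ^ 2)
    by (field; exact HOm).
  ring.
Qed.

Lemma inner_Tres (P : model) (mu1 : R * R) (n : Z) (phin phins : R * R)
    (u0011 u0020 : vec2) (w : field) (A dA : C) :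
  admissible P -> pitchfork_data P n phin phins -> surface_on_mode 0 w ->
  inner P (Wns P n phins) (Tres P mu1 n phin w (W0011 P u0011) (W0020 P n u0020) A dA)
  = oden_rhs P mu1 n phin phins w (W0011 P u0011) (W0020 P n u0020) A dA.
Proof.
  intros HP (_ & _ & _ & _ & _ & _ & H1) Hw.
  assert (H := on_mode_cubn P n phin u0011 u0020).
  assert (MWs : on_mode n (Wns P n phins)) by exact (on_mode_Ext _ _ _ _).
  unfold Tres, oden_rhs.
  rewrite (inner_plus P n), (inner_scal P n); try exact MWs; try exact H;
    [|unfold Wn; mode|mode].
  unfold Wn, Wns in H1 |- *.
  replace (Ext P n 0 (vreal phins)) with (Ext P n (Cconj 0) (vreal phins)) in H1 |- *
    by now rewrite Cconj_RtoC.
  rewrite inner_forcing by (assumption || (rewrite Re_RtoC; lra)).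
  rewrite !Cconj_RtoC.
  change (snd (vreal phins)) with (RtoC (snd phins)).
  change (snd (vreal phin)) with (RtoC (snd phin)).
  rewrite Cconj_RtoC; ring.
Qed.

Lemma Lstar_W0s (P : model) (lamI : R) (phi0 phi0s : vec2) :
  admissible P -> hopf_data P lamI phi0 phi0s ->
  field_eq P (Lstar P (W0s P lamI phi0s)) ((- (Ci * lamI)) *: W0s P lamI phi0s)%fld.
Proof.
  intros HP (_ & _ & _ & _ & _ & Hk & _).
  unfold W0s; rewrite <- conj_imaginary; apply Lstar_Ext; [exact HP| |].
  - rewrite Re_conj; apply Re_imaginary.
  - now rewrite <- Phi_conj by (exact HP || apply Re_imaginary).
Qed.

Lemma Lstar_Wns (P : model) (n : Z) (phin phins : R * R) :
  admissible P -> pitchfork_data P n phin phins ->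
  field_eq P (Lstar P (Wns P n phins)) fzero.
Proof.
  intros HP (_ & _ & _ & _ & _ & Hk & _).
  assert (H : field_eq P (Lstar P (Wns P n phins)) (0 *: Wns P n phins)%fld)
    by (apply Lstar_Ext; [exact HP|rewrite Re_RtoC; lra|exact Hk]).
  destruct H as [H1 H2]; split.
  - intros r t Hr; destruct (H1 r t Hr) as [-> ->]; simpl; split; ring.
  - intros t; destruct (H2 t) as [-> ->]; simpl; split; ring.
Qed.

Theorem lemma2p2 (P : model) (HP : admissible P)
    (mu1 : R * R) (Hmu1 : sqrt (fst mu1 ^ 2 + snd mu1 ^ 2) = 1%R)
    (W0000 : field) (HW0000 : is_W0000 P mu1 W0000) :
  (forall (lamI : R) (phi0 phi0s u2000 u1100 : vec2),
    hopf_data P lamI phi0 phi0s ->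
    hopf_second P lamI phi0 u2000 u1100 ->
    let W1100 := W1100 P u1100 in
    let W2000 := W2000 P lamI u2000 in
    field_eq P (Lstar P (W0s P lamI phi0s)) ((- (Ci * lamI)) *: W0s P lamI phi0s)%fld /\
    forall (A0 : R -> C) (tau : R),
      ex_derive (K := R_AbsRing) (V := C_R_NormedModule) A0 tau ->
      (exists X : field, smooth_field P X /\
         solvesX P mu1 lamI phi0 (A0 tau)
           (rhs0 P mu1 lamI phi0 W0000 W1100 W2000 (A0 tau) (CDerive A0 tau)) X) ->
      ode0_lhs P mu1 lamI phi0 phi0s (A0 tau)
      = ode0_rhs P mu1 lamI phi0 phi0s W0000 W1100 W2000
          (A0 tau) (CDerive A0 tau))
  /\
  (forall (n : Z) (phin phins : R * R) (u0020 u0011 : vec2),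
    pitchfork_data P n phin phins ->
    pitchfork_second P n phin u0020 u0011 ->
    let W0011 := W0011 P u0011 in
    let W0020 := W0020 P n u0020 in
    field_eq P (Lstar P (Wns P n phins)) fzero /\
    forall (An : R -> C) (tau : R),
      ex_derive (K := R_AbsRing) (V := C_R_NormedModule) An tau ->
      (exists Y : field, smooth_field P Y /\
         solvesY P mu1 n phin (An tau)
           (Tres P mu1 n phin W0000 W0011 W0020 (An tau) (CDerive An tau))
           (Rres P n phin W0020 (An tau)) Y) ->
      oden_lhs P mu1 n phin phins (An tau)
      = oden_rhs P mu1 n phin phins W0000 W0011 W0020
          (An tau) (CDerive An tau))
  /\
  (forall (lamI : R) (n : Z) (phi0 phi0s : vec2) (phin phins : R * R)
      (u2000 u1100 u0020 u0011 u1010 : vec2),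
    hopf_data P lamI phi0 phi0s ->
    pitchfork_data P n phin phins ->
    hopf_second P lamI phi0 u2000 u1100 ->
    pitchfork_second P n phin u0020 u0011 ->
    mixed_second P lamI n phi0 phin u1010 ->
    let W0 := W0 P lamI phi0 in
    let W0s := W0s P lamI phi0s in
    let Wn := Wn P n phin in
    let Wmn := Wmn P n phin in
    let Wns := Wns P n phins in
    let W2000 := W2000 P lamI u2000 in
    let W1100 := W1100 P u1100 in
    let W0020 := W0020 P n u0020 in
    let W0002 := W0002 P n u0020 in
    let W0011 := W0011 P u0011 in
    let W1010 := W1010 P lamI n u1010 in
    let W1001 := W1001 P lamI n u1010 in
    let W0110 := W0110 P lamI n u1010 in
    field_eq P (Lstar P W0s) ((- (Ci * lamI)) *: W0s)%fld /\
    field_eq P (Lstar P Wns) fzero /\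
    forall (A0 An : R -> C) (tau : R),
      ex_derive (K := R_AbsRing) (V := C_R_NormedModule) A0 tau ->
      ex_derive (K := R_AbsRing) (V := C_R_NormedModule) An tau ->
      (exists X Y : field, smooth_field P X /\ smooth_field P Y /\
         solvesX P mu1 lamI phi0 (A0 tau)
           (rhs0 P mu1 lamI phi0 W0000 W1100 W2000 (A0 tau) (CDerive A0 tau)
            + (sqmod (An tau) * A0 tau) *: cub0n P W0 Wn Wmn W0011 W1001 W1010
            + Pmix P W0 Wn Wmn W0020 W0002 W1010 W1001 (A0 tau) (An tau))%fld X /\
         solvesY P mu1 n phin (An tau)
           (Tres P mu1 n phin W0000 W0011 W0020 (An tau) (CDerive An tau)
            + (sqmod (A0 tau) * An tau) *: cubn0 P W0 Wn W1100 W0110 W1010)%fld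
           (Rres P n phin W0020 (An tau)) Y) ->
      ode0_lhs P mu1 lamI phi0 phi0s (A0 tau)
      = ode0_rhs P mu1 lamI phi0 phi0s W0000 W1100 W2000
          (A0 tau) (CDerive A0 tau)
        + inner P W0s (cub0n P W0 Wn Wmn W0011 W1001 W1010)
          * sqmod (An tau) * A0 tau
      /\
      oden_lhs P mu1 n phin phins (An tau)
      = oden_rhs P mu1 n phin phins W0000 W0011 W0020
          (An tau) (CDerive An tau)
        + inner P Wns (cubn0 P W0 Wn W1100 W0110 W1010)
          * sqmod (A0 tau) * An tau).
Proof.
  assert (Hw : surface_on_mode 0 W0000)
    by (apply (surface_on_mode_radial P), HW0000).
  split; [|split].
  - intros lamI phi0 phi0s u2000 u1100 HH _ W1100 W2000.
    split; [now apply (Lstar_W0s P lamI phi0)|].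
    intros A0 tau _ (X & HX & Hsol).
    assert (E0 := inner_rhs0 P mu1 lamI phi0 phi0s u2000 u1100 W0000 (A0 tau)
      (CDerive A0 tau) HP HH Hw); fold W1100 W2000 in E0; rewrite <- E0.
    apply (hopf_condition P mu1 lamI phi0 phi0s _ _ _ X HP HH HX Hsol).
    + now apply on_mode_rhs0.
    + intros a b x y; apply projects_modal.
  - intros n phin phins u0020 u0011 HH _ W0011 W0020.
    split; [now apply (Lstar_Wns P n phin)|].
    intros An tau _ (Y & HY & Hsol).
    assert (En := inner_Tres P mu1 n phin phins u0011 u0020 W0000 (An tau)
      (CDerive An tau) HP HH Hw); fold W0011 W0020 in En; rewrite <- En.
    apply (pitchfork_condition P mu1 n phin phins _ _ _ Y HP HH HY Hsol).
    + now apply on_mode_Tres.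
    + apply on_mode_Rres.
  - intros lamI n phi0 phi0s phin phins u2000 u1100 u0020 u0011 u1010 HH HN _ _ _
      w0 w0s wn wmn wns W2000 W1100 W0020 W0002 W0011 W1010 W1001 W0110.
    split; [now apply (Lstar_W0s P lamI phi0)|].
    split; [now apply (Lstar_Wns P n phin)|].
    intros A0 An tau _ _ (X & Y & HX & HY & HsX & HsY).
    assert (Hn : n <> 0%Z) by apply HN.
    assert (M0 := on_mode_rhs0 P mu1 lamI phi0 u2000 u1100 W0000 (A0 tau) (CDerive A0 tau) Hw).
    assert (M0n := on_mode_cub0n P lamI n phi0 u0011 u1010 phin).
    assert (MT := on_mode_Tres P mu1 n phin u0011 u0020 W0000 (An tau) (CDerive An tau) Hw).
    assert (Mn0 := on_mode_cubn0 P lamI n phi0 u1100 u1010 phin).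
    split.
    + assert (E0 := inner_rhs0 P mu1 lamI phi0 phi0s u2000 u1100 W0000 (A0 tau)
      (CDerive A0 tau) HP HH Hw); fold W1100 W2000 in E0; rewrite <- E0.
      (* In [cub0n] the frequencies n and -n cancel, so this coupling is resonant and stays in the
         amplitude equation. *)
      transitivity (inner P w0s (rhs0 P mu1 lamI phi0 W0000 W1100 W2000 (A0 tau) (CDerive A0 tau)
        + (sqmod (An tau) * A0 tau) *: cub0n P w0 wn wmn W0011 W1001 W1010)%fld).
      * apply (hopf_condition P mu1 lamI phi0 phi0s _ _ _ X HP HH HX HsX).
        -- apply on_mode_plus; [exact M0|apply on_mode_scal, M0n].
        -- intros a b x y Hm.
           (* The two halves of [Pmix] lie on the modes 2n and -2n; neither is 0, so they leave the
              mode-0 equation untouched. *)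
           unfold Pmix; rewrite fplus_assoc.
           apply projects_plus_other with (k := (- (2 * n))%Z); [|lia|].
           ++ apply projects_plus_other with (k := (2 * n)%Z);
                [now apply projects_modal|lia|].
              unfold w0, wn, W0020, W1010, Defs.W0, Defs.Wn, Defs.W0020, Defs.W1010; mode.
           ++ unfold w0, wmn, W0002, W1001, Defs.W0, Defs.Wmn, Defs.W0002, Defs.W0020,
                Defs.W1001; mode.
      * rewrite (inner_plus P 0), (inner_scal P 0);
          [unfold w0s; ring|exact (on_mode_Ext _ _ _ _)|exact M0n
          |exact (on_mode_Ext _ _ _ _)|exact M0|apply on_mode_scal, M0n].
    + assert (En := inner_Tres P mu1 n phin phins u0011 u0020 W0000 (An tau)
      (CDerive An tau) HP HN Hw); fold W0011 W0020 in En; rewrite <- En.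
      (* [cubn0] has mode n, so it joins the resonant part of the forcing of Y. *)
      transitivity (inner P wns (Tres P mu1 n phin W0000 W0011 W0020 (An tau) (CDerive An tau)
        + (sqmod (A0 tau) * An tau) *: cubn0 P w0 wn W1100 W0110 W1010)%fld).
      * apply (pitchfork_condition P mu1 n phin phins _ _ _ Y HP HN HY HsY).
        -- apply on_mode_plus; [exact MT|apply on_mode_scal, Mn0].
        -- apply on_mode_Rres.
      * rewrite (inner_plus P n), (inner_scal P n);
          [unfold wns; ring|exact (on_mode_Ext _ _ _ _)|exact Mn0
          |exact (on_mode_Ext _ _ _ _)|exact MT|apply on_mode_scal, Mn0].
Qed.
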